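(* Let $K_{\rm cr}\in\mathcal L(X_{\rm cr},X)$ satisfy $$\|e^{(A_{\rm cr}+B_{\rm cr}K_{\rm cr})t}\|_{\mathcal L(X_{\rm cr})}\le M_{\rm cr}e^{-\omega_{\rm cr}t},\qquad t\ge0,$$ for some $M_{\rm cr}\ge1$ and $\omega_{\rm cr}>0$. Define $A_F:=A_n+BK_{\rm cr}P_{\rm cr}$ with $D(A_F)=D(A_n)$. Then $A_F$ generates an analytic exponentially stable $C_0$-semigroup on $X$. More precisely, for every $0<\omega<\min\{\rho,\omega_{\rm cr}\}$ there exists $M_F\ge1$ such that $$\|e^{A_Ft}\|_{\mathcal L(X)}\le M_Fe^{-\omega t},\qquad t\ge0.$$
   Context: Let $\ell>0$, $I=(0,\ell)$, $X=L^2(I)$, $\epsilon_1>0$, $\bar\alpha_1\in L^\infty(I;\mathbb R)$, and let $g\in L^\infty(I)$ satisfy $|\{x\in I:g(x)\neq0\}|>0$. On $X$ let $A_n\phi=\epsilon_1\phi_{xx}+\bar\alpha_1\phi$ with $D(A_n)=H^2(I)\cap H_0^1(I)$ (self-adjoint, bounded above, with compact resolvent), and let $B\in\mathcal L(X)$ be $(B\psi)(x)=g(x)\psi(x)$. Fix $\rho>0$. $P_{\rm cr}$ denotes the orthogonal spectral projection of $A_n$ associated with the eigenvalues contained in $(-\rho,\infty)$; $X_{\rm cr}=P_{\rm cr}X$ (finite-dimensional), $A_{\rm cr}=A_n|_{X_{\rm cr}}$, and $B_{\rm cr}=P_{\rm cr}B\in\mathcal L(X,X_{\rm cr})$. *)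

(* Defs.v *)
From HB Require Import structures.
From mathcomp Require Import all_boot all_order all_algebra.
From mathcomp Require Import generic_quotient ring_quotient.
From mathcomp Require Import all_classical all_reals all_analysis.
From mathcomp Require Import ess_sup_inf measurable_realfun complex.

Set Implicit Arguments.
Unset Strict Implicit.
Unset Printing Implicit Defensive.

Import Order.TTheory GRing.Theory Num.Theory.
Import numFieldNormedType.Exports.
Import ComplexField.Normc.

Local Open Scope classical_set_scope.
Local Open Scope ring_scope.
Local Open Scope complex_scope.

Local Notation Re := (@complex.Re _) (only parsing).
Local Notation Im := (@complex.Im _) (only parsing).

Section complex_L2.
Context d (T : measurableType d) (R : realType).
Variable mu : {measure set T -> \bar R}.

(* Complex-valued square-integrable functions: |f|^2 = (Re f)^2 + (Im f)^2, so
   this asks that both parts be measurable and square-integrable. *)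
Definition cL2 : {pred T -> R[i]} :=
  [pred f | (Re \o f \in Lfun mu 2%:E) && (Im \o f \in Lfun mu 2%:E)].

Let le12 : (1 <= 2%:E :> \bar R)%E.
Proof. by rewrite lee_fin ler1n. Qed.

Lemma Lfun2D (f g : T -> R) : f \in Lfun mu 2%:E -> g \in Lfun mu 2%:E ->
  f \+ g \in Lfun mu 2%:E.
Proof. exact: (Lfun_addr_closed mu le12).2. Qed.

Lemma Lfun2Z (a : R) (f : T -> R) : f \in Lfun mu 2%:E ->
  a \*o f \in Lfun mu 2%:E.
Proof.
move=> fL; exact: (GRing.subsemimod_closedZ (GRing.submod_closed_semi (Lfun_submod_closed mu le12))).
Qed.

Lemma cL2_submod_closed : submod_closed cL2.
Proof.
split.
  by apply/andP; split; exact: (Lfun_submod_closed mu le12).1.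
move=> [a b] f g /andP[/= f1 f2] /andP[/= g1 g2]; apply/andP => /=; split.
  rewrite (_ : _ \o _ = ((a \*o (Re \o f)) \+ ((- b) \*o (Im \o f))) \+ (Re \o g)).
    by rewrite Lfun2D// Lfun2D// Lfun2Z.
  apply/funext => x /=; rewrite !fctE.
  by case: (f x) (g x) => [u v] [w z] /=; rewrite mulNr.
rewrite (_ : _ \o _ = ((a \*o (Im \o f)) \+ (b \*o (Re \o f))) \+ (Im \o g)).
  by rewrite Lfun2D// Lfun2D// Lfun2Z.
apply/funext => x /=; rewrite !fctE.
by case: (f x) (g x) => [u v] [w z] /=.
Qed.

HB.instance Definition _ :=
  GRing.isSubmodClosed.Build R[i] (T -> R[i]) cL2 cL2_submod_closed.

Record L2fun := MkL2fun { L2fun_val :> T -> R[i]; L2funP : L2fun_val \in cL2 }.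
HB.instance Definition _ := [isSub for L2fun_val].
HB.instance Definition _ := [Choice of L2fun by <:].
HB.instance Definition _ := [SubChoice_isSubLmodule of L2fun by <:].

Definition null_L2fun : {pred L2fun} :=
  [pred f : L2fun | `[< {ae mu, forall x, f x = 0} >]].

Lemma null_zmod_closed : zmod_closed null_L2fun.
Proof.
split; first by apply/asboolP; exact: aeW.
move=> f g /asboolP f0 /asboolP g0; apply/asboolP.
by apply: filterS2 f0 g0 => x /= fx gx; rewrite [LHS]/= !fctE fx gx subrr.
Qed.

HB.instance Definition _ :=
  GRing.isZmodClosed.Build L2fun null_L2fun null_zmod_closed.

Definition L2 : Type := Quotient.quot null_L2fun.
HB.instance Definition _ := Choice.on L2.
HB.instance Definition _ := EqQuotient.on L2.
HB.instance Definition _ := GRing.Zmodule.on L2.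

Local Open Scope quotient_scope.

(* Junk value 0 when f is not square-integrable. *)
Definition L2cls (f : T -> R[i]) : L2 := \pi_L2 (insubd 0 f).

Lemma L2_piP (f g : L2fun) :
  \pi_L2 f = \pi_L2 g <-> {ae mu, forall x, f x = g x}.
Proof.
split=> [/eqP|fg].
  rewrite -[_ == _]/(\pi_(Quotient.quot null_L2fun) f == \pi g).
  rewrite -Quotient.idealrBE => /asboolP; apply: filterS => x.
  by rewrite [X in X = _ -> _]/= !fctE => /eqP; rewrite subr_eq0 => /eqP.
apply/eqP; rewrite -[_ == _]/(\pi_(Quotient.quot null_L2fun) f == \pi g).
rewrite -Quotient.idealrBE; apply/asboolP.
by apply: filterS fg => x; rewrite [X in _ -> X = _]/= !fctE => ->; rewrite subrr.
Qed.

Lemma L2_reprK (f : L2fun) : {ae mu, forall x, repr (\pi_L2 f) x = f x}.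
Proof. by apply/L2_piP; rewrite reprK. Qed.

Lemma L2_piD (f g : L2fun) : \pi_L2 (f + g) = \pi_L2 f + \pi_L2 g.
Proof. exact: (Quotient.pi_add null_L2fun f g). Qed.

Definition L2scale (a : R[i]) (x : L2) : L2 := \pi_L2 (a *: repr x).

Lemma L2scale_pi a (f : L2fun) : L2scale a (\pi_L2 f) = \pi_L2 (a *: f).
Proof.
apply/L2_piP; apply: filterS (L2_reprK f) => x fx.
by rewrite [LHS]/= [RHS]/= !fctE fx.
Qed.

Lemma L2scaleA a b x : L2scale a (L2scale b x) = L2scale (a * b) x.
Proof. by rewrite L2scale_pi scalerA. Qed.

Lemma L2scale1 : left_id 1 L2scale.
Proof. by move=> x; rewrite /L2scale scale1r reprK. Qed.

Lemma L2scaleDr : right_distributive L2scale +%R.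
Proof.
move=> a x y; rewrite -[x]reprK -[y]reprK -L2_piD !L2scale_pi -L2_piD.
by rewrite scalerDr.
Qed.

Lemma L2scaleDl x : {morph L2scale^~ x : a b / a + b}.
Proof. by move=> a b; rewrite /L2scale scalerDl L2_piD. Qed.

HB.instance Definition _ := GRing.Zmodule_isLmodule.Build R[i] L2
  L2scaleA L2scale1 L2scaleDr L2scaleDl.

(* The norm ( \int |x|^2 )^(1/2). *)
Definition L2norm (x : L2) : R :=
  fine ('N[mu]_2%:E[EFin \o (fun t => normc (repr x t))]).

Lemma le_Lnorm2 (f g : T -> R) : measurable_fun setT f -> measurable_fun setT g ->
  {ae mu, forall x, `|f x| <= `|g x|} ->
  ('N[mu]_2%:E[EFin \o f] <= 'N[mu]_2%:E[EFin \o g])%E.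
Proof.
move=> mf mg fg; rewrite unlock gt0_ler_poweR ?in_itv/= ?leey ?integral_ge0//.
have mN (h : T -> R) : measurable_fun setT h ->
    measurable_fun setT (EFin \o (fun x => `|h x| `^ 2)).
  move=> mh; apply/measurable_EFinP.
  apply: (@measurableT_comp _ _ _ _ _ _ (fun x : R => x `^ 2)%R) => //.
  exact: measurableT_comp.
apply: ae_ge0_le_integral => //; [exact: mN|exact: mN|].
by apply: filterS fg => x fg _; rewrite lee_fin ge0_ler_powR// nnegrE.
Qed.

Lemma normc_ge0 (z : R[i]) : 0 <= normc z.
Proof. by case: z => a b; exact: sqrtr_ge0. Qed.

Lemma normc_le_ReIm (z : R[i]) : normc z <= `|Re z| + `|Im z|.
Proof.
case: z => a b /=; rewrite -(ger0_norm (sqrtr_ge0 _)) -ler_sqr ?nnegrE ?addr_ge0//.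
rewrite real_normK ?num_real// sqr_sqrtr ?addr_ge0 ?sqr_ge0//.
rewrite sqrrD !real_normK ?num_real// lerD2r lerDl mulrn_wge0 ?mulr_ge0//.
Qed.

Lemma normcD (x y : R[i]) : normc (x + y) <= normc x + normc y.
Proof. by have := ler_normD x y; rewrite -[X in X <= _]/((normc _)%:C) -[X in _ <= X]/((normc x)%:C + (normc y)%:C) -rmorphD lecR. Qed.

Lemma measurable_normc (f : L2fun) : measurable_fun setT (fun t => normc (f t)).
Proof.
have /andP[/andP[mr _] /andP[mi _]] := L2funP f.
rewrite !inE/= in mr mi.
have -> : (fun t => normc (f t)) =
    (fun t => ((Re (f t)) ^+ 2 + (Im (f t)) ^+ 2) `^ 2^-1).
  apply/funext => t; case: (f t) => a b /=.
  by rewrite powR12_sqrt ?addr_ge0 ?sqr_ge0.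
apply: (@measurableT_comp _ _ _ _ _ _ (fun x : R => x `^ 2^-1)%R) => //.
by apply: measurable_funD; exact: measurable_funX.
Qed.

Lemma L2fun_normc_lty (f : L2fun) :
  ('N[mu]_2%:E[EFin \o (fun t => normc (f t))] < +oo)%E.
Proof.
have /andP[fr fi] := L2funP f.
have [/andP[mr lr] /andP[mi li]] := (fr, fi).
rewrite !inE/= in mr lr mi li.
have mN (h : T -> R) : measurable_fun setT h -> measurable_fun setT (fun t => `|h t|).
  by move=> ?; exact: measurableT_comp.
apply: (@le_lt_trans _ _ ('N[mu]_2%:E[EFin \o
    ((fun t => `|Re (f t)|) \+ (fun t => `|Im (f t)|))%R])%E).
  apply: le_Lnorm2; [exact: measurable_normc|apply: measurable_funD; exact: mN|].
  apply: aeW => x; rewrite [leRHS]ger0_norm ?[leLHS]ger0_norm ?addr_ge0//.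
    exact: normc_le_ReIm.
  exact: normc_ge0.
apply: le_lt_trans (eminkowski _ _ _ _) _ => //; [exact: mN|exact: mN|].
apply: lte_add_pinfty.
- by rewrite -[X in Lnorm _ _ X]/(abse \o (EFin \o (Re \o f))) Lnorm_abse.
- by rewrite -[X in Lnorm _ _ X]/(abse \o (EFin \o (Im \o f))) Lnorm_abse.
Qed.

Lemma L2normE (f : L2fun) :
  (L2norm (\pi_L2 f))%:E = 'N[mu]_2%:E[EFin \o (fun t => normc (f t))]%E.
Proof.
rewrite /L2norm fineK ?ge0_fin_numE ?Lnorm_ge0 ?L2fun_normc_lty//.
by apply/eqP; rewrite eq_le; apply/andP; split;
  apply: le_Lnorm2; do ?exact: measurable_normc;
  apply: filterS (L2_reprK f) => x ->.
Qed.

Lemma L2normD (x y : L2) :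
  (L2norm (x + y))%:C <= (L2norm x)%:C + (L2norm y)%:C.
Proof.
rewrite -rmorphD lecR -[x]reprK -[y]reprK -L2_piD -lee_fin EFinD !L2normE.
apply: le_trans (eminkowski _ _ _ _) => //; do ?exact: measurable_normc.
apply: le_Lnorm2; [exact: measurable_normc| |].
  by apply: measurable_funD; exact: measurable_normc.
apply: aeW => t; rewrite [leRHS]ger0_norm ?[leLHS]ger0_norm ?addr_ge0 ?normc_ge0//.
exact: normcD.
Qed.

Lemma L2normZ (a : R[i]) (x : L2) : (L2norm (a *: x))%:C = `|a| * (L2norm x)%:C.
Proof.
rewrite -[`|a|]/((normc a)%:C) -rmorphM; congr (_%:C).
apply: EFin_inj; rewrite EFinM -[x]reprK -[_ *: _]/(L2scale a _) L2scale_pi !L2normE.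
set f := repr x.
have fL : (fun t => normc (f t)) \in Lfun mu 2%:E.
  rewrite !inE/=; apply/andP; split; rewrite inE/=; last exact: L2fun_normc_lty.
  exact: measurable_normc.
have := LnormZ (Lfun_Sub le12 fL) (normc a); rewrite ger0_norm ?normc_ge0// => <-.
by apply: eq_Lnorm => t /=; rewrite !fctE normcM.
Qed.

Lemma L2norm_eq0 (x : L2) : (L2norm x)%:C = 0 -> x = 0.
Proof.
move=> -[x0]; set f := repr x.
have mf : measurable_fun setT (EFin \o (fun t => normc (f t))).
  by apply/measurable_EFinP; exact: measurable_normc.
have /(Lnorm_eq0_eq0 mf) fae : 'N[mu]_2%:E[EFin \o (fun t => normc (f t))]%E = 0%E.
  by rewrite -L2normE reprK x0.
have {}fae : EFin \o (fun t => normc (f t)) = \0%E %[ae mu].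
  by apply: fae; rewrite lte_fin.
rewrite -[x]reprK -/f.
have : {ae mu, forall t, f t = (0 : L2fun) t}.
  by apply: filterS fae => t /(_ I) [] /eq0_normc.
by move=> /L2_piP ->; apply: (addrI (\pi_L2 0)); rewrite addr0 -L2_piD addr0.
Qed.

HB.instance Definition _ := Lmodule_isNormed.Build R[i] L2
  L2normD L2normZ L2norm_eq0.

Lemma L2_normE (x : L2) : `|x| = (L2norm x)%:C.
Proof. by []. Qed.

Definition cintegral (f : T -> R[i]) : R[i] :=
  (\int[mu]_t Re (f t)) +i* (\int[mu]_t Im (f t)).

Definition L2dot (x y : L2) : R[i] :=
  cintegral (fun t => repr x t * (repr y t)^*).

Definition cLinfty : {pred T -> R[i]} :=
  [pred f | (Re \o f \in Lfun mu +oo%E) && (Im \o f \in Lfun mu +oo%E)].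

(* The multiplication operator x |-> g x; for essentially bounded g it is
   pointwise multiplication of classes, see L2mul_ae below. *)
Definition L2mul (g : T -> R[i]) (x : L2) : L2 :=
  L2cls (fun t => g t * repr x t).

Lemma Lfun_mul_oo (f h : T -> R) : f \in Lfun mu +oo%E -> h \in Lfun mu 2%:E ->
  (fun t => f t * h t) \in Lfun mu 2%:E.
Proof.
move=> /andP[mf lf] /andP[mh lh]; rewrite !inE/= in mf lf mh lh.
have [c c0 fc] : exists2 c : R, 0 <= c & {ae mu, forall t, `|f t| <= c}.
  move: lf; rewrite /finite_norm unlock; case: ifPn => [_ lf|mu0 _]; last first.
    exists 0 => //; exists setT; split => //.
    by apply/eqP; rewrite eq_le measure_ge0 leNgt mu0.
  exists (Num.max 0 (fine (ess_sup mu (abse \o (EFin \o f))))).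
    by rewrite le_max lexx.
  apply: filterS (ess_sup_ge mu (abse \o (EFin \o f))) => t /=.
  case: (ess_sup _ _) lf => [r _||] //=.
  by rewrite lee_fin le_max => ->; rewrite orbT.
have cL : (c \*o h) \in Lfun mu 2%:E by rewrite Lfun2Z// !inE/=; apply/andP; rewrite !inE.
move: (cL) => /andP[mc lc]; rewrite !inE/= in mc lc.
have mfh : measurable_fun setT (fun t => f t * h t) by exact: measurable_funM.
rewrite !inE/=; apply/andP; rewrite !inE/=; split => //.
apply: le_lt_trans lc; apply: le_Lnorm2 => //.
by apply: filterS fc => t ft; rewrite !normrM (ger0_norm c0) ler_wpM2r.
Qed.

Lemma cL2_mul (g f : T -> R[i]) : g \in cLinfty -> f \in cL2 ->
  (fun t => g t * f t) \in cL2.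
Proof.
move=> /andP[/= g1 g2] /andP[/= f1 f2]; apply/andP => /=; split.
  rewrite (_ : _ \o _ = (fun t => Re (g t) * Re (f t)) \+
      ((-1) \*o (fun t => Im (g t) * Im (f t)))).
    by rewrite Lfun2D// ?Lfun2Z// Lfun_mul_oo.
  by apply/funext => x /=; case: (f x) (g x) => [u v] [w z] /=; rewrite mulN1r.
rewrite (_ : _ \o _ = (fun t => Re (g t) * Im (f t)) \+
    (fun t => Im (g t) * Re (f t))); first by rewrite Lfun2D// Lfun_mul_oo.
by apply/funext => x /=; case: (f x) (g x) => [u v] [w z].
Qed.

Lemma L2mul_ae (g : T -> R[i]) (x : L2) : g \in cLinfty ->
  {ae mu, forall t, repr (L2mul g x) t = g t * repr x t}.
Proof.
move=> gL; set f := fun s => g s * repr x s.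
apply: filterS (L2_reprK (insubd 0 f)) => t; rewrite -/(L2cls f) => ->.
by rewrite -[LHS]/(val (insubd (0 : L2fun) f) t)
  val_insubd cL2_mul ?L2funP.
Qed.

(* Orthogonal projection onto the subspace S, with junk value 0 at the points
   having no best approximation in S; there are no such points when S is
   complete. *)
Definition orth_proj (S : set L2) (x : L2) : L2 :=
  xget 0 [set y | S y /\ forall z, S z -> L2dot (x - y) z = 0].

End complex_L2.

Arguments L2mul {d T R} mu g x.
Arguments cLinfty {d T R} mu.
Arguments L2 {d T R} mu.

(* The norm of a normed module over R[i] takes its values in R[i]; the order of
   R[i] compares complex numbers with equal imaginary parts. *)
Section operators.
Context (R : realType) (X : normedModType R[i]).
Implicit Types (S : set X) (F : X -> X) (T : R -> X -> X).

(* || F ||_{L(S,X)} <= c, for F linear on the subspace S. *)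
Definition opnorm_le S F (c : R) :=
  forall x, S x -> `|F x| <= c%:C * `|x|.

Definition bounded_linear_on S F :=
  (forall (a : R[i]) x y, S x -> S y -> F (a *: x + y) = a *: F x + F y) /\
  exists c : R, opnorm_le S F c.

(* e^{tF} for a bounded F; if F maps a complete subspace S into itself and is
   bounded on S, only the values of F on S matter for x in S. *)
Definition expop (F : X -> X) (t : R) (x : X) : X :=
  limn (fun n => \sum_(k < n) (t ^+ k / k`!%:R)%:C *: iter k F x).

(* Only the values of opfun on dom are meaningful. *)
Record unbounded_op := UnboundedOp { dom : set X ; opfun :> X -> X }.

Definition eigenvectors (A : unbounded_op) (J : set R) : set X :=
  [set v | v != 0 /\ dom A v /\ exists2 k : R, J k & A v = k%:C *: v].

Definition lin_span (E : set X) : set X :=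
  [set x | exists (n : nat) (c : 'I_n -> R[i]) (v : 'I_n -> X),
    (forall i, E (v i)) /\ x = \sum_(i < n) c i *: v i].

Definition C0_semigroup T :=
  [/\ forall t, 0 <= t -> bounded_linear_on setT (T t),
      forall x, T 0 x = x,
      forall s t x, 0 <= s -> 0 <= t -> T (s + t) x = T s (T t x) &
      forall x, T t x @[t --> 0^'+] --> x].

(* The generator of T, with its domain, is exactly A. *)
Definition generates (A : unbounded_op) T :=
  C0_semigroup T /\
  forall x y, ((h^-1)%:C *: (T h x - x) @[h --> 0^'+] --> y) <->
              dom A x /\ y = A x.

(* { z != 0 : |arg z| < delta }, for delta <= pi. *)
Definition sector (delta : R) : set R[i] :=
  [set z | exists r theta : R,
    [/\ 0 < r, `|theta| < delta & z = (r * cos theta) +i* (r * sin theta)]].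

(* Complex differentiability on the open set D for the operator norm. *)
Definition norm_holomorphic (D : set R[i]) (S : R[i] -> X -> X) :=
  forall z, D z -> exists2 S' : X -> X, bounded_linear_on setT S' &
    forall e : R, 0 < e -> exists2 r : R, 0 < r &
      forall h : R[i], 0 < `|h| < r%:C ->
        opnorm_le setT (fun x => h^-1 *: (S (z + h) x - S z x) - S' x) e.

(* T extends to a sector of angle delta in (0, pi/2] as a holomorphic semigroup
   which is strongly continuous at 0 on every smaller sector. *)
Definition analytic_semigroup T :=
  C0_semigroup T /\
  exists (delta : R) (S : R[i] -> X -> X),
    [/\ 0 < delta <= pi / 2,
        forall t x, 0 <= t -> S t%:C x = T t x,
        (forall z, sector delta z -> bounded_linear_on setT (S z)) /\
        (forall z w x, sector delta z -> sector delta w ->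
           S (z + w) x = S z (S w x)),
        norm_holomorphic (sector delta) S &
        forall delta' x, 0 < delta' < delta -> forall e : R, 0 < e ->
          exists2 r : R, 0 < r &
            forall z, sector delta' z -> `|z| < r%:C -> `|S z x - x| < e%:C].

Definition exp_bounded T (M omega : R) :=
  forall t, 0 <= t -> opnorm_le setT (T t) (M * expR (- omega * t)).

Definition exponentially_stable T :=
  exists M omega : R, [/\ 1 <= M, 0 < omega & exp_bounded T M omega].

End operators.

Section interval.
Variables (R : realType) (l : R).

(* Lebesgue measure on I = ]0, l[, as a measure on the whole line; functions on
   I are represented by functions on the line, whose values outside I are
   irrelevant. *)
Definition muI : {measure set (measurableTypeR R) -> \bar R} :=
  mrestr (@lebesgue_measure R) (measurable_itv `]0, l[).

Definition L2I : normedModType R[i] := L2 muI.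

(* C^1 functions whose support is a compact subset of ]0, l[, extended by 0.
   As in Brezis, Functional Analysis, Sobolev Spaces and PDEs, Chapter 8, the
   Sobolev spaces on an interval are defined with the test space C^1_c. *)
Definition C1c (f : R -> R) :=
  [/\ forall x, derivable f x 1, continuous (derive1 f) &
      exists a b, [/\ 0 < a, b < l & forall x, ~~ (a <= x <= b) -> f x = 0]].

Definition test_fun (phi : R -> R[i]) := C1c (Re \o phi) /\ C1c (Im \o phi).

Definition cderiv (phi : R -> R[i]) (x : R) : R[i] :=
  derive1 (Re \o phi) x +i* derive1 (Im \o phi) x.

Definition weak_deriv (u w : L2I) :=
  forall phi, test_fun phi ->
    cintegral muI (fun x => repr u x * cderiv phi x) =
    - cintegral muI (fun x => repr w x * phi x).

Definition wderiv (u : L2I) : L2I := xget 0 [set w | weak_deriv u w].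

Definition H1 : set L2I := [set u | exists w, weak_deriv u w].

Definition H2 : set L2I := [set u | H1 u /\ H1 (wderiv u)].

(* Closure of the test functions in the norm of H^1. *)
Definition H10 : set L2I :=
  [set u | H1 u /\ exists phi : nat -> R -> R[i],
    [/\ forall n, test_fun (phi n),
        (L2cls muI (phi n) : L2I) @[n --> \oo] --> u &
        (L2cls muI (cderiv (phi n)) : L2I) @[n --> \oo] --> wderiv u]].

(* A u = eps u_xx + alpha u with Dirichlet boundary conditions. *)
Definition An (eps : R) (alpha : R -> R) : unbounded_op L2I :=
  UnboundedOp (H2 `&` H10)
    (fun u => eps%:C *: wderiv (wderiv u) + L2mul muI (fun x => (alpha x)%:C) u).

(* Orthogonal projection onto the sum of the eigenspaces of A for the
   eigenvalues in J; meant for a self-adjoint A, bounded above with compact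
   resolvent, and J bounded below, so that this sum is finite-dimensional,
   hence closed. *)
Definition spectral_proj (A : unbounded_op L2I) (J : set R) : L2I -> L2I :=
  orth_proj (lin_span (eigenvectors A J)).

End interval.

(* Main.v *)
From mathcomp Require Import all_boot all_order all_algebra.
From mathcomp Require Import all_classical all_reals all_analysis.
From mathcomp Require Import ess_sup_inf measurable_realfun complex ring lra.
Require Import Defs.

Set Implicit Arguments.
Unset Strict Implicit.
Unset Printing Implicit Defensive.

Import Order.TTheory GRing.Theory Num.Theory.
Import numFieldNormedType.Exports.
Import ComplexField.Normc.

Local Open Scope classical_set_scope.
Local Open Scope ring_scope.
Local Open Scope complex_scope.

Local Notation Re := (@complex.Re _) (only parsing).
Local Notation Im := (@complex.Im _) (only parsing).


(** The operator [A] is diagonal. Its quadratic form [eps |u'|^2 - (alpha u, u)], minimised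
    successively on orthogonal complements, yields a total orthonormal system [e k] (zero vectors
    being allowed as padding) with real eigenvalues [lam k] tending to minus infinity, and [u] lies
    in the domain with [A u = y] exactly when each coordinate of [y] is [lam k] times that of [u]
    ([An_spectral]). The compactness behind this is Ehrling's inequality [ehrling]. In these
    coordinates [P] keeps the finitely many modes with [lam k > - rho] ([spectral_proj_cutoff]), and
    from then on only coordinates matter.

    The feedback [G = B K P] is bounded and sees only [P x]. Hence [A + G] is block triangular: its
    compression [M] to the range of [P] is [A_cr + B_cr K_cr], the rest of the space is invariant,
    and there [A + G] is just [A], which decays like [exp (- rho t)]. The only coupling is from the
    low modes into the high ones.

    The semigroup is not obtained from a general generation theorem but written down. A second
    threshold [Lm], at least [|M| + 1], is chosen. On the modes below [- Lm] the Sylvester equation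
    for [A] and [M] with right-hand side [G] is solved by a geometric series [Y] ([sylv]). Since [Y]
    maps low modes to very high ones and vanishes on the latter, [Y^2 = 0] and [1 - Y] inverts
    [1 + Y]. Conjugating by [1 + Y] makes the operator block diagonal: a bounded operator [N] on the
    modes above [- Lm], whose exponential is a power series, and a diagonal operator below. The
    candidate is therefore [sgr z = (1 - Y) exp(zN) evol z (1 + Y)], defined for all [z] with
    [Re z >= 0]. The semigroup law, strong continuity, the generator ([sgr_generator]) and
    holomorphy on the open half-plane ([sgr_analytic]) are read off this formula.

    For the decay, [P T(t) = exp(tM) P] decays at rate [omega_cr] by hypothesis, and the kernel of
    [P] decays at rate [rho]. Comparing times [t] and [t + 1] gives a recursion for the part of
    [T(t) x] outside the range of [P], whose solution is at most a multiple of [(t + 2) exp(- w0 t)]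
    with [w0 = min rho omega_cr] ([sgr_decay_linear]). The linear factor is absorbed by any smaller
    rate, whence the strict inequality on [omega]. *)

(** * Complex scalars *)

Section complex_scalars.
Context (R : realType).
Implicit Types z w : R[i].

Lemma ReD z w : Re (z + w) = Re z + Re w.
Proof. by case: z; case: w. Qed.

Lemma ReN z : Re (- z) = - Re z.
Proof. by case: z. Qed.

Lemma ReC (a : R) : Re a%:C = a.
Proof. by []. Qed.

Lemma ReCM (a : R) z : Re (a%:C * z) = a * Re z.
Proof. by case: z => b c /=; rewrite mul0r subr0. Qed.

Lemma ReJ z : Re z^* = Re z.
Proof. by case: z. Qed.

Lemma realcD (a b : R) : (a + b)%:C = a%:C + b%:C :> R[i].
Proof. exact: rmorphD. Qed.

Lemma realcM (a b : R) : (a * b)%:C = a%:C * b%:C :> R[i].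
Proof. exact: rmorphM. Qed.

Lemma mulconj z : z * z^* = (normc z ^+ 2)%:C.
Proof. by rewrite -sqr_normc -[`|z|]/((normc z)%:C) -rmorphXn. Qed.

Lemma sqr_normcE z : normc z ^+ 2 = Re z ^+ 2 + Im z ^+ 2.
Proof. by case: z => a b /=; rewrite sqr_sqrtr// addr_ge0// sqr_ge0. Qed.

Lemma normc_Re z : `|Re z| <= normc z.
Proof.
by rewrite -lecR; have := normc_ge_Re z; rewrite -[`|z|]/((normc z)%:C).
Qed.

Lemma normc_Im z : `|Im z| <= normc z.
Proof.
rewrite -(@ler_pXn2r _ 2)// ?nnegrE ?normr_ge0 ?Defs.normc_ge0//.
by rewrite sqr_normcE real_normK ?num_real// lerDr sqr_ge0.
Qed.

Lemma normcJ z : normc z^* = normc z.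
Proof. by case: z => a b /=; rewrite sqrrN. Qed.

Lemma normcR (a : R) : normc a%:C = `|a|.
Proof. by rewrite /= expr0n/= addr0 sqrtr_sqr. Qed.

Lemma normcB z w : normc (z - w) = normc (w - z).
Proof. by rewrite -opprB normcN. Qed.

Lemma normcX z n : normc (z ^+ n) = normc z ^+ n.
Proof. by elim: n => [|n IH]; rewrite ?expr0 ?normc1// !exprS normcM IH. Qed.

Lemma normc_gt0 z : z != 0 -> 0 < normc z.
Proof.
move=> z0; rewrite lt_neqAle Defs.normc_ge0 andbT eq_sym.
by apply: contra z0 => /eqP /eq0_normc ->.
Qed.

(** The discriminant of a nonnegative quadratic expression in one complex variable, tested along the
    multiples of [b^*]. The degenerate cases are included on purpose: it gives Cauchy-Schwarz, and
    with [A = 0] it shows that a minimiser of a semidefinite form lies in the kernel of the form. *)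
Lemma psd_discriminant (A B : R) (b : R[i]) : 0 <= B ->
  (forall c : R[i], 0 <= A + Re (c * b) *+ 2 + normc c ^+ 2 * B) ->
  normc b ^+ 2 <= A * B.
Proof.
move=> B0 H.
have key (t : R) : 0 <= A - t * normc b ^+ 2 *+ 2 + t ^+ 2 * normc b ^+ 2 * B.
  have := H (- t%:C * b^*).
  have -> : - t%:C * b^* * b = (- t)%:C * (b * b^*) by rewrite rmorphN/=; ring.
  rewrite mulconj ReCM ReC normcM normcN normcR normcJ exprMn real_normK ?num_real//.
  by rewrite mulNr mulNrn.
have [B0'|Bn0] := eqVneq B 0; last first.
  have Bp : 0 < B by rewrite lt_neqAle eq_sym Bn0.
  have := key B^-1.
  have -> : A - B^-1 * normc b ^+ 2 *+ 2 + B^-1 ^+ 2 * normc b ^+ 2 * B =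
    A - normc b ^+ 2 / B by field.
  by rewrite subr_ge0 ler_pdivrMr.
(* With [B = 0] and [b] nonzero this value of [t] turns [key] into [0 <= A - 2 (A + 1)], against
   [0 <= A], which is the case [c = 0]. *)
subst B; have := key ((A + 1) / (normc b ^+ 2)); rewrite !mulr0 addr0.
have [->|b0] := eqVneq (normc b ^+ 2) 0; first by [].
have := H 0; rewrite mul0r normc0 expr0n/= mul0rn !addr0 => A0.
rewrite divfK// mulr2n => A1; exfalso; lra.
Qed.

End complex_scalars.

(** * The norm as a real number, so that order and limit arguments run in [R] and not in the
    partially ordered [R[i]] *)

Definition nrm (R : realType) (X : normedModType R[i]) (x : X) : R := Re `|x|.

Lemma squeeze0 (R : realType) (I : Type) (F : set_system I) {FF : Filter F}
    (f g : I -> R) : (\forall i \near F, 0 <= f i <= g i) ->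
  g i @[i --> F] --> (0 : R) -> f i @[i --> F] --> (0 : R).
Proof. by move=> fg; apply: (@squeeze_cvgr _ _ _ _ (cst 0)) => //; exact: cvg_cst. Qed.

Lemma cvg0_sum (R : realType) (I : Type) (F : set_system I) {FF : Filter F}
    (f : nat -> I -> R) n : (forall k, f k i @[i --> F] --> (0 : R)) ->
  \sum_(k < n) f k i @[i --> F] --> (0 : R).
Proof.
move=> f0; elim: n => [|n IH].
  rewrite (_ : (fun i => _) = cst 0); last by apply/funext => i; rewrite big_ord0.
  exact: cvg_cst.
rewrite (_ : (fun i => _) = (fun i => \sum_(k < n) f k i) \+ f n).
  by have h := cvgD IH (f0 n); rewrite addr0 in h; exact: h.
by apply/funext => i; rewrite big_ord_recr.
Qed.

Lemma cvgMr0 (R : realType) (I : Type) (F : set_system I) {FF : Filter F}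
    (f : I -> R) (c : R) : f i @[i --> F] --> (0 : R) ->
  f i * c @[i --> F] --> (0 : R).
Proof. by move=> f0; rewrite -(mul0r c); apply: cvgM f0 _; exact: cvg_cst. Qed.

Section nrm.
Context (R : realType) (X : normedModType R[i]).
Implicit Types x y : X.
Local Notation nrm := (@nrm R X).

Lemma nrmE x : `|x| = (nrm x)%:C.
Proof. by rewrite /nrm RRe_real// ger0_real. Qed.

Lemma nrm_ge0 x : 0 <= nrm x.
Proof. by rewrite -ler0c -nrmE normr_ge0. Qed.

Lemma nrmD x y : nrm (x + y) <= nrm x + nrm y.
Proof. by rewrite -lecR rmorphD/= -!nrmE ler_normD. Qed.

Lemma nrmZ a x : nrm (a *: x) = normc a * nrm x.
Proof. by apply: complexI; rewrite rmorphM/= -!nrmE normrZ. Qed.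

Lemma nrmN x : nrm (- x) = nrm x.
Proof. by rewrite /nrm normrN. Qed.

Lemma nrm0 : nrm 0 = 0.
Proof. by rewrite /nrm normr0. Qed.

Lemma nrmB x y : nrm (x - y) = nrm (y - x).
Proof. by rewrite -opprB nrmN. Qed.

Lemma nrm_eq0 x : nrm x = 0 -> x = 0.
Proof. by move=> x0; apply/eqP; rewrite -normr_eq0 nrmE x0. Qed.

Lemma nrm_le0 x : nrm x <= 0 -> x = 0.
Proof. by move=> x0; apply: nrm_eq0; apply/eqP; rewrite eq_le x0 nrm_ge0. Qed.

Lemma nrm_sum (I : Type) (r : seq I) (P : pred I) (u : I -> X) :
  nrm (\sum_(i <- r | P i) u i) <= \sum_(i <- r | P i) nrm (u i).
Proof.
by rewrite -lecR -nrmE rmorph_sum/= (le_trans (ler_norm_sum _ _ _))//;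
  apply: ler_sum => i _; rewrite nrmE.
Qed.

Lemma nrm_distD z x y : nrm (x - y) <= nrm (x - z) + nrm (z - y).
Proof. by rewrite -[x in leLHS](subrK z) -addrA; exact: nrmD. Qed.

Lemma ler_nrmB x y : nrm x - nrm y <= nrm (x - y).
Proof. by rewrite lerBlDr -[x in leLHS](subrK y) nrmD. Qed.

Lemma cvg_nrmP (I : Type) (F : set_system I) {FF : Filter F} (u : I -> X) x :
  u i @[i --> F] --> x <->
  forall e : R, 0 < e -> \forall i \near F, nrm (u i - x) < e.
Proof.
split=> [/cvgr_distC_lt H e e0|H].
  have := H e%:C; rewrite ltcR => /(_ e0); apply: filterS => i.
  by rewrite nrmE ltcR.
apply/cvgrPdistC_lt => e e0.
have eR : e = (Re e)%:C by rewrite RRe_real// gtr0_real.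
have /H : 0 < Re e by rewrite -ltcR -eR.
by apply: filterS => i; rewrite nrmE [e in _ -> _ < e]eR ltcR.
Qed.

Lemma cvg_nrm0 (I : Type) (F : set_system I) {FF : Filter F} (u : I -> X) x :
  u i @[i --> F] --> x <-> nrm (u i - x) @[i --> F] --> (0 : R).
Proof.
rewrite cvg_nrmP; split => [H|/cvgrPdist_lt H e /H].
  apply/cvgrPdist_lt => e /H; apply: filterS => i.
  by rewrite sub0r normrN ger0_norm// nrm_ge0.
by apply: filterS => i; rewrite sub0r normrN ger0_norm// nrm_ge0.
Qed.

Lemma cvg_nrm_le (I : Type) (F : set_system I) {FF : Filter F} (u : I -> X) x
    (v : I -> R) : (\forall i \near F, nrm (u i - x) <= v i) ->
  v i @[i --> F] --> (0 : R) -> u i @[i --> F] --> x.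
Proof.
move=> uv v0; apply/cvg_nrm0; apply: squeeze0 v0.
by apply: filterS uv => i ->; rewrite nrm_ge0.
Qed.

Lemma nrm_cvg (I : Type) (F : set_system I) {FF : ProperFilter F} (u : I -> X) x :
  u i @[i --> F] --> x -> nrm (u i) @[i --> F] --> nrm x.
Proof.
move/cvg_nrmP => H; apply/cvgrPdistC_lt => e /H; apply: filterS => i.
apply: le_lt_trans; rewrite ler_norml ler_nrmB andbT.
by rewrite lerNl opprB nrmB ler_nrmB.
Qed.

Lemma cvgn_nrmP (u : nat -> X) x : u n @[n --> \oo] --> x <->
  forall e : R, 0 < e -> exists N, forall n, (N <= n)%N -> nrm (u n - x) < e.
Proof.
rewrite cvg_nrmP; split=> H e /H; first by case=> N _ HN; exists N.
by case=> N HN; exists N.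
Qed.

End nrm.

(** * Hilbert spaces *)

Definition cauchy_nrm (R : realType) (X : normedModType R[i]) (u : nat -> X) :=
  forall e : R, 0 < e -> exists N, forall m n, (N <= m)%N -> (N <= n)%N ->
    nrm (u m - u n) < e.

(** A predicate over an existing normed module: the spectral and semigroup arguments are carried out
    for any such space and reach [L2] through the single lemma [L2dot_hilbert]. *)
Record hilbert (R : realType) (X : normedModType R[i]) (dot : X -> X -> R[i]) :
  Prop := Hilbert {
  hdotDZl : forall a x y z, dot (a *: x + y) z = a * dot x z + dot y z;
  hdotC : forall x y, dot y x = (dot x y)^*;
  hdotxx : forall x, dot x x = (nrm x ^+ 2)%:C;
  hcomplete : forall u : nat -> X, cauchy_nrm u -> exists x : X, u n @[n --> \oo] --> x }.

Section hilbert_theory.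
Context (R : realType) (X : normedModType R[i]) (dot : X -> X -> R[i]).
Hypothesis H : hilbert dot.
Implicit Types x y z : X.

Lemma dot0l z : dot 0 z = 0.
Proof.
have := hdotDZl H (-1) 0 0 z; rewrite scaler0 addr0 => /eqP.
by rewrite mulN1r addNr => /eqP.
Qed.

Lemma dotDl x y z : dot (x + y) z = dot x z + dot y z.
Proof. by rewrite -[x]scale1r (hdotDZl H) mul1r scale1r. Qed.

Lemma dotZl a x z : dot (a *: x) z = a * dot x z.
Proof. by rewrite -[_ *: _]addr0 (hdotDZl H) dot0l addr0. Qed.

Lemma dotNl x z : dot (- x) z = - dot x z.
Proof. by rewrite -scaleN1r dotZl mulN1r. Qed.

Lemma dotBl x y z : dot (x - y) z = dot x z - dot y z.
Proof. by rewrite dotDl dotNl. Qed.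

Lemma dot_suml (I : Type) (r : seq I) (P : pred I) (u : I -> X) z :
  dot (\sum_(i <- r | P i) u i) z = \sum_(i <- r | P i) dot (u i) z.
Proof. by apply: (big_morph (dot^~ z)) => [x y|]; rewrite ?dot0l ?dotDl. Qed.

Lemma dotDr x y z : dot z (x + y) = dot z x + dot z y.
Proof. by rewrite (hdotC H) dotDl rmorphD/= -!(hdotC H). Qed.

Lemma dotZr a x z : dot z (a *: x) = a^* * dot z x.
Proof. by rewrite (hdotC H) dotZl rmorphM/= -!(hdotC H). Qed.

Lemma dot0r z : dot z 0 = 0.
Proof. by rewrite (hdotC H) dot0l conjc0. Qed.

Lemma dotNr x z : dot z (- x) = - dot z x.
Proof. by rewrite (hdotC H) dotNl rmorphN/= -!(hdotC H). Qed.

Lemma dotBr x y z : dot z (x - y) = dot z x - dot z y.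
Proof. by rewrite dotDr dotNr. Qed.

Lemma dot_sumr (I : Type) (r : seq I) (P : pred I) (u : I -> X) z :
  dot z (\sum_(i <- r | P i) u i) = \sum_(i <- r | P i) dot z (u i).
Proof. by apply: (big_morph (dot z)) => [x y|]; rewrite ?dot0r ?dotDr. Qed.

Lemma nrm_sqrD x y :
  nrm (x + y) ^+ 2 = nrm x ^+ 2 + Re (dot x y) *+ 2 + nrm y ^+ 2.
Proof.
apply: complexI; rewrite -(hdotxx H) dotDl !dotDr mulr2n !rmorphD/= -!(hdotxx H).
rewrite [dot y x](hdotC H) ReJ_add.
by set a := dot x x; set b := dot y y; set c := dot x y; set c' := c^*; field.
Qed.

Lemma CauchySchwarz x y : normc (dot x y) <= nrm x * nrm y.
Proof.
rewrite -(@ler_pXn2r _ 2)// ?nnegrE ?mulr_ge0 ?nrm_ge0 ?Defs.normc_ge0//.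
rewrite exprMn -normcJ -(hdotC H) mulrC [leRHS]mulrC; apply: psd_discriminant.
  exact: sqr_ge0.
move=> c; have := sqr_ge0 (nrm (x + c *: y)).
by rewrite nrm_sqrD nrmZ exprMn dotZr -ReJ rmorphM/= conjcK -(hdotC H).
Qed.

Lemma pythagoras x y : dot x y = 0 -> nrm (x + y) ^+ 2 = nrm x ^+ 2 + nrm y ^+ 2.
Proof. by move=> xy; rewrite nrm_sqrD xy mul0rn addr0. Qed.

Lemma parallelogram x y :
  nrm (x - y) ^+ 2 = nrm x ^+ 2 *+ 2 + nrm y ^+ 2 *+ 2 - nrm (x + y) ^+ 2.
Proof. by rewrite !nrm_sqrD nrmN dotNr ReN; ring. Qed.

Lemma dot_cvg0 (I : Type) (F : set_system I) {FF : Filter F} (u : I -> X) x y :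
  u i @[i --> F] --> x -> normc (dot (u i) y - dot x y) @[i --> F] --> (0 : R).
Proof.
move=> /cvg_nrm0 ux; apply: (@squeeze0 _ _ _ _ _ (fun i => nrm (u i - x) * nrm y)).
  by apply: nearW => i; rewrite Defs.normc_ge0 -dotBl CauchySchwarz.
by rewrite -(mul0r (nrm y)); apply: cvgM ux _; exact: cvg_cst.
Qed.

Lemma dot_cvgl (I : Type) (F : set_system I) {FF : ProperFilter F} (u : I -> X) x y c :
  u i @[i --> F] --> x -> (\forall i \near F, dot (u i) y = c) -> dot x y = c.
Proof.
move=> ux uc; apply/eqP; rewrite -subr_eq0; apply/eqP/eq0_normc.
apply/eqP; rewrite eq_le Defs.normc_ge0 andbT.
apply: (cvgr_to_ge (dot_cvg0 y ux)).
by apply: filterS uc => i <-; rewrite normcB.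
Qed.

End hilbert_theory.

(* Some [e k] may be 0, so that the same notion covers a finite basis. *)
Record orthosys (R : realType) (X : normedModType R[i]) (dot : X -> X -> R[i])
  (e : nat -> X) : Prop := OrthoSys {
  ortho_neq : forall i j, i != j -> dot (e i) (e j) = 0;
  ortho_eq : forall i, e i = 0 \/ dot (e i) (e i) = 1 }.

(** * Fourier sums and the Riesz-Fischer theorem *)

Section fourier.
Context (R : realType) (X : normedModType R[i]) (dot : X -> X -> R[i]).
Context (e : nat -> X).
Hypotheses (H : hilbert dot) (He : orthosys dot e).
Implicit Types (x y z : X) (n k : nat) (c : nat -> R[i]).

Definition csum c n : X := \sum_(k < n) c k *: e k.

Definition fsum n x : X := csum (fun k => dot x (e k)) n.

Lemma dot_ortho i j x :
  dot x (e i) * dot (e i) (e j) = if i == j then dot x (e j) else 0.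
Proof.
case: eqVneq => [->|ij]; last by rewrite (ortho_neq He)// mulr0.
by case: (ortho_eq He j) => ->; rewrite ?mulr1// !(dot0r H) mul0r.
Qed.

Lemma ortho_le1 i : nrm (e i) <= 1.
Proof.
case: (ortho_eq He i) => [->|]; first by rewrite nrm0.
by rewrite (hdotxx H) => -[] /eqP; rewrite sqrf_eq1 => /orP[/eqP->//|/eqP ->]; lra.
Qed.

Lemma dot_csum c n k : dot (csum c n) (e k) =
  if (k < n)%N then c k * dot (e k) (e k) else 0.
Proof.
rewrite (dot_suml H); under eq_bigr do rewrite (dotZl H).
case: ifP => kn; last first.
  rewrite big1// => i _; rewrite (ortho_neq He) ?mulr0//.
  by apply: contraFneq kn => <-.
rewrite (bigD1 (Ordinal kn))//= big1 ?addr0// => i ik.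
rewrite (ortho_neq He) ?mulr0//.
Qed.

Lemma dot_fsum n x k : dot (fsum n x) (e k) = if (k < n)%N then dot x (e k) else 0.
Proof. by rewrite dot_csum dot_ortho eqxx. Qed.

Lemma nrm_csum c n : nrm (csum c n) ^+ 2 =
  \sum_(k < n) normc (c k) ^+ 2 * nrm (e k) ^+ 2.
Proof.
apply: complexI; rewrite -(hdotxx H) [X in dot _ X]/csum (dot_sumr H) rmorph_sum/=.
apply: eq_bigr => k _; rewrite (dotZr H) dot_csum ltn_ord mulrA.
by rewrite [_^* * _]mulrC mulconj (hdotxx H) -rmorphM.
Qed.

Lemma nrm_fsum n x : nrm (fsum n x) ^+ 2 = \sum_(k < n) normc (dot x (e k)) ^+ 2.
Proof.
rewrite nrm_csum; apply: eq_bigr => k _; rewrite -exprMn -[nrm _]ger0_norm ?nrm_ge0//.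
case: (ortho_eq He k) => [->|ek]; first by rewrite (dot0r H) normc0 mul0r.
have : nrm (e k) ^+ 2 = 1 by apply: complexI; rewrite -(hdotxx H) ek.
by rewrite exprMn => h; rewrite real_normK ?num_real// h mulr1.
Qed.

Lemma fsum_orth n x k : (k < n)%N -> dot (x - fsum n x) (e k) = 0.
Proof. by move=> kn; rewrite (dotBl H) dot_fsum kn subrr. Qed.

Lemma fsum_orth_csum n x c : dot (x - fsum n x) (csum c n) = 0.
Proof.
rewrite (dot_sumr H) big1// => k _.
by rewrite (dotZr H) fsum_orth ?mulr0.
Qed.

Lemma fsum_best n x c : nrm (x - csum c n) ^+ 2 =
  nrm (x - fsum n x) ^+ 2 + nrm (fsum n x - csum c n) ^+ 2.
Proof.
rewrite -(pythagoras H) ?addrA ?subrK//.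
by rewrite (dotBr H) !fsum_orth_csum subrr.
Qed.

Lemma nrm_fsum_le n x : nrm (fsum n x) <= nrm x.
Proof.
rewrite -(@ler_pXn2r _ 2)// ?nnegrE ?nrm_ge0//.
have h y : nrm (y - csum (fun=> 0) n) = nrm y.
  by rewrite /csum big1 ?subr0// => i _; rewrite scale0r.
by rewrite -(h x) fsum_best h lerDr sqr_ge0.
Qed.

Lemma csumB c n m : (n <= m)%N ->
  csum c m - csum c n = csum (fun k => if (n <= k)%N then c k else 0) m.
Proof.
move=> nm; rewrite /csum -!(big_mkord xpredT (fun k => c k *: e k)).
rewrite (big_cat_nat (leq0n n) nm)//= addrAC subrr add0r.
rewrite -(big_mkord xpredT (fun k => (if (n <= k)%N then c k else 0) *: e k)).
rewrite (big_cat_nat (leq0n n) nm)//= [X in _ = X + _]big_nat [X in _ = X + _]big1 ?add0r; last first.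
  by move=> i /andP[_ ni]; rewrite leqNgt ni scale0r.
by rewrite !big_nat; apply: eq_bigr => i /andP[-> _].
Qed.

(** By Pythagoras the squared distance of two partial sums is the difference of two terms of a
    nondecreasing real sequence, which is bounded by [M ^+ 2] and hence convergent. *)
Lemma csum_cauchy c M : (forall n, nrm (csum c n) <= M) -> cauchy_nrm (csum c).
Proof.
move=> cM.
pose s n : R := \sum_(k < n) normc (c k) ^+ 2 * nrm (e k) ^+ 2.
have sE n m : (n <= m)%N -> nrm (csum c m - csum c n) ^+ 2 = s m - s n.
  move=> nm; rewrite csumB// nrm_csum /s -!(big_mkord xpredT (fun k => normc (c k) ^+ 2 * nrm (e k) ^+ 2)).
  rewrite [X in _ = X - _](big_cat_nat (leq0n n) nm)//= addrAC subrr add0r.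
  rewrite -(big_mkord xpredT (fun k => normc (if (n <= k)%N then c k else 0) ^+ 2 * nrm (e k) ^+ 2)).
  rewrite (big_cat_nat (leq0n n) nm)//= [X in X + _ = _]big_nat [X in X + _ = _]big1 ?add0r; last first.
    by move=> i /andP[_ ni]; rewrite leqNgt ni normc0 expr0n/= mul0r.
  by rewrite !big_nat; apply: eq_bigr => i /andP[-> _].
have snd : nondecreasing_seq s.
  by move=> n m nm; rewrite -subr_ge0 -sE// sqr_ge0.
have scv : cvgn s.
  apply: nondecreasing_is_cvgn => //; exists (M ^+ 2) => _ [n _ <-].
  have := cM n; rewrite -(@ler_pXn2r _ 2)// ?nnegrE ?nrm_ge0//; last first.
    exact: le_trans (nrm_ge0 _) (cM 0%N).
  by rewrite nrm_csum.
move=> d d0; have /cvgrPdist_lt/(_ (d ^+ 2 / 2)) := scv.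
rewrite divr_gt0 ?exprn_gt0// => /(_ isT) [N _ HN].
have hN n m : (N <= n)%N -> (n <= m)%N -> nrm (csum c m - csum c n) < d.
  move=> Nn nm; rewrite -(@ltr_pXn2r _ 2)// ?nnegrE ?nrm_ge0 ?(ltW d0)// sE//.
  have := HN _ Nn; have := HN _ (leq_trans Nn nm).
  by rewrite /= !ltr_norml => /andP[? ?] /andP[? ?]; lra.
exists N => m n Nm Nn; case: (leqP n m) => [|/ltnW] nm; first exact: hN.
by rewrite nrmB hN.
Qed.

Lemma csum_cvg c M : (forall n, nrm (csum c n) <= M) ->
  exists2 x : X, csum c n @[n --> \oo] --> x &
  forall k, dot x (e k) = c k * dot (e k) (e k).
Proof.
move=> /csum_cauchy/(hcomplete H)[x xc]; exists x => // k.
apply: (dot_cvgl H xc); exists k.+1 => // n /= kn.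
by rewrite dot_csum kn.
Qed.

Lemma fsum_bounded_cvg x : exists2 y : X, fsum n x @[n --> \oo] --> y &
  forall k, dot y (e k) = dot x (e k).
Proof.
have [y xy h] := @csum_cvg (fun k => dot x (e k)) (nrm x) (nrm_fsum_le^~ x).
by exists y => // k; rewrite h dot_ortho eqxx.
Qed.

End fourier.

(** * Diagonal operators in a total orthogonal system *)

Section total.
Context (R : realType) (X : normedModType R[i]) (dot : X -> X -> R[i]).
Context (e : nat -> X).
Hypotheses (H : hilbert dot) (He : orthosys dot e).
Hypothesis tot : forall x : X, fsum dot e n x @[n --> \oo] --> x.
Implicit Types (x y z : X) (n k : nat) (a b : nat -> R[i]).

Local Notation S := (fsum dot e).

Lemma coord_inj x y : (forall k, dot x (e k) = dot y (e k)) -> x = y.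
Proof.
move=> xy; have := @tot y; have := @tot x.
have -> : S^~ y = S^~ x.
  by apply/funext => n; apply: eq_bigr => k _; rewrite xy.
by move=> tx ty; apply: cvg_unique tx ty.
Qed.

Lemma coord_nrm_le x y (c : R) : 0 <= c ->
  (forall k, normc (dot y (e k)) <= c * normc (dot x (e k))) ->
  nrm y <= c * nrm x.
Proof.
move=> c0 yx; apply: (cvgr_to_le (nrm_cvg (@tot y))); apply: nearW => n.
apply: le_trans (_ : c * nrm (S n x) <= _); last first.
  by rewrite ler_wpM2l// (nrm_fsum_le H He).
rewrite -(@ler_pXn2r _ 2)// ?nnegrE ?mulr_ge0 ?nrm_ge0//.
rewrite exprMn !(nrm_fsum H He) mulr_sumr; apply: ler_sum => k _.
by rewrite -exprMn ler_pXn2r ?nnegrE ?mulr_ge0 ?Defs.normc_ge0.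
Qed.

Definition bounded_seq a := exists M : R, forall k, normc (a k) <= M.

(** Riesz-Fischer: multiplying the coordinates of [x] by a bounded sequence keeps the partial sums
    bounded, so they converge to the required element. *)
Lemma diag_ex a x : bounded_seq a ->
  exists y, forall k, dot y (e k) = a k * dot x (e k).
Proof.
move=> [M aM].
have M0 : 0 <= M by apply: le_trans (aM 0%N); exact: Defs.normc_ge0.
have [n|y _ yE] := @csum_cvg _ _ _ _ H He (fun k => a k * dot x (e k)) (M * nrm x); last first.
  by exists y => k; rewrite yE -mulrA (dot_ortho H He) eqxx.
apply: le_trans (_ : M * nrm (S n x) <= _); last first.
  by rewrite ler_wpM2l// (nrm_fsum_le H He).
rewrite -(@ler_pXn2r _ 2)// ?nnegrE ?mulr_ge0 ?nrm_ge0//.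
rewrite exprMn !(nrm_csum H He) mulr_sumr; apply: ler_sum => k _.
rewrite [leRHS]mulrA ler_wpM2r ?sqr_ge0// -exprMn ler_pXn2r ?nnegrE ?mulr_ge0 ?Defs.normc_ge0//.
by rewrite normcM ler_wpM2r ?Defs.normc_ge0.
Qed.

(* Junk value 0 when [a] is unbounded and no such element exists. *)
Definition diag a x : X := xget 0 [set y | forall k, dot y (e k) = a k * dot x (e k)].

Lemma diagE a x k : bounded_seq a -> dot (diag a x) (e k) = a k * dot x (e k).
Proof. by move=> /(diag_ex x)[y hy]; rewrite /diag; case: xgetP => [z _ ->//|/(_ y)]. Qed.

Lemma diag_eq a x y : bounded_seq a ->
  (forall k, dot y (e k) = a k * dot x (e k)) -> diag a x = y.
Proof. by move=> ba h; apply: coord_inj => k; rewrite diagE. Qed.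

Lemma nrm_diag_le a x (M : R) : (forall k, normc (a k) <= M) ->
  nrm (diag a x) <= M * nrm x.
Proof.
move=> aM; have M0 : 0 <= M by apply: le_trans (aM 0%N); exact: Defs.normc_ge0.
apply: coord_nrm_le => // k; rewrite diagE; last by exists M.
by rewrite normcM ler_wpM2r ?Defs.normc_ge0.
Qed.

Lemma diag_linear a (c : R[i]) x y : bounded_seq a ->
  diag a (c *: x + y) = c *: diag a x + diag a y.
Proof.
move=> ba; apply: diag_eq => // k.
by rewrite !(hdotDZl H) !diagE// mulrDr mulrCA.
Qed.

Lemma diagD a x y : bounded_seq a -> diag a (x + y) = diag a x + diag a y.
Proof. by move=> ba; rewrite -[x]scale1r diag_linear// !scale1r. Qed.

(** Dominated convergence for multipliers: the tail of [x] is small uniformly in [i] thanks to the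
    bound [M], and on the remaining finitely many coordinates pointwise convergence suffices. It
    gives both the strong continuity of the semigroup at 0 and the convergence of its difference
    quotients. *)
Lemma diag_strong0 (I : Type) (F : set_system I) {FF : Filter F}
    (a : I -> nat -> R[i]) (M : R) x :
  (\forall i \near F, forall k, normc (a i k) <= M) ->
  (forall k, normc (a i k) @[i --> F] --> (0 : R)) ->
  diag (a i) x @[i --> F] --> (0 : X).
Proof.
move=> aM a0.
have [FN|FP] := pselect (F set0).
  by move=> A _; exact: filterS (@sub0set _ _) FN.
have M0 : 0 <= M.
  apply: contrapT => Mn; apply: FP; apply: filterS aM => i /(_ 0%N) h.
  by apply: Mn; apply: le_trans h; exact: Defs.normc_ge0.
apply/cvg_nrmP => d d0.
have d2 : 0 < d / (M + 1) / 2 by rewrite !divr_gt0// ltr_wpDl.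
have [N HN] := (cvgn_nrmP _ _).1 (@tot x) _ d2.
have {}HN : nrm (x - S N x) < d / (M + 1) / 2 by rewrite nrmB; exact: HN.
have sum0 : \sum_(k < N) normc (a i k) * normc (dot x (e k)) @[i --> F] --> (0 : R).
  by apply: (cvg0_sum (f := fun k i => normc (a i k) * normc (dot x (e k)))) => k; exact: cvgMr0.
have /cvgrPdist_lt/(_ (d / 2)) := sum0; rewrite divr_gt0// => /(_ isT) sumd.
apply: filterS2 aM sumd => i aMi; rewrite sub0r normrN => hs.
have ba : bounded_seq (a i) by exists M.
rewrite subr0 -[X in diag _ X](subrK (S N x)) diagD//.
apply: le_lt_trans (nrmD _ _) _.
have -> : d = M * (d / (M + 1) / 2) + (d / (M + 1) / 2 + d / 2) by field; lra.
apply: ler_ltD.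
  apply: le_trans (nrm_diag_le _ aMi) _.
  by rewrite ler_wpM2l// ltW.
rewrite ltr_wpDl ?(ltW d2)//; apply: le_lt_trans hs; rewrite ger0_norm; last first.
  by apply: sumr_ge0 => k _; rewrite mulr_ge0 ?Defs.normc_ge0.
have -> : diag (a i) (S N x) = csum e (fun k => a i k * dot x (e k)) N.
  apply: diag_eq => // k; rewrite (dot_fsum H He) (dot_csum H He).
  by case: ifP => _; rewrite ?mulr0// -mulrA (dot_ortho H He) eqxx.
apply: le_trans (nrm_sum _ _ _) _; apply: ler_sum => k _.
rewrite nrmZ normcM -[leRHS]mulr1 ler_wpM2l ?mulr_ge0 ?Defs.normc_ge0//.
exact: (ortho_le1 H He).
Qed.

End total.

(** * Complex integrals and the inner product of [L2] *)

Section complex_integral.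
Context d (T : measurableType d) (R : realType).
Variable mu : {measure set T -> \bar R}.
Implicit Types f g : T -> R[i].

Definition cintegrable f :=
  mu.-integrable setT (EFin \o (Re \o f)) /\ mu.-integrable setT (EFin \o (Im \o f)).

Lemma cintegrable_measurable f : cintegrable f ->
  measurable_fun setT (Re \o f) /\ measurable_fun setT (Im \o f).
Proof. by move=> [/integrableP[/measurable_EFinP ? _] /integrableP[/measurable_EFinP ? _]]. Qed.

Lemma cintegralD f g : cintegrable f -> cintegrable g ->
  cintegral mu (fun x => f x + g x) = cintegral mu f + cintegral mu g.
Proof.
move=> [f1 f2] [g1 g2]; apply/eqP; rewrite eq_complex /=; apply/andP; split; apply/eqP.
  by rewrite -RintegralD//; apply: eq_Rintegral => x _; case: (f x) (g x) => [? ?] [? ?].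
by rewrite -RintegralD//; apply: eq_Rintegral => x _; case: (f x) (g x) => [? ?] [? ?].
Qed.

Lemma integrableZlR (r : R) (h : T -> R) : mu.-integrable setT (EFin \o h) ->
  mu.-integrable setT (EFin \o (fun x => r * h x)).
Proof. by move=> hi; apply: eq_integrable (integrableZl measurableT r hi). Qed.

Lemma cintegrableZ a f : cintegrable f -> cintegrable (fun x => a * f x).
Proof.
case: a => a b [f1 f2]; split.
  apply: eq_integrable (integrableD measurableT (integrableZlR a f1) (integrableZlR (- b) f2)) => // x _ /=.
  by case: (f x) => [? ?]; rewrite /= -EFinD mulNr.
apply: eq_integrable (integrableD measurableT (integrableZlR a f2) (integrableZlR b f1)) => // x _ /=.
by case: (f x) => [? ?]; rewrite /= -EFinD.
Qed.

Lemma cintegralZ a f : cintegrable f ->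
  cintegral mu (fun x => a * f x) = a * cintegral mu f.
Proof.
case: a => a b [f1 f2]; apply/eqP; rewrite eq_complex /=; apply/andP; split; apply/eqP.
  rewrite -!RintegralZl// -RintegralB//; [|exact: integrableZlR..].
  by apply: eq_Rintegral => x _; case: (f x).
rewrite -!RintegralZl// -RintegralD//; [|exact: integrableZlR..].
by apply: eq_Rintegral => x _; case: (f x).
Qed.

Lemma cintegralJ f : cintegrable f -> cintegral mu (fun x => (f x)^*) = (cintegral mu f)^*.
Proof.
move=> [f1 f2]; apply/eqP; rewrite eq_complex /=; apply/andP; split; apply/eqP.
  by apply: eq_Rintegral => x _; case: (f x).
rewrite -mulN1r -RintegralZl//.
by apply: eq_Rintegral => x _; case: (f x) => [? ?]; rewrite mulN1r.
Qed.

Lemma ae_eq_cintegral f g : cintegrable f -> cintegrable g ->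
  {ae mu, forall x, f x = g x} -> cintegral mu f = cintegral mu g.
Proof.
move=> /cintegrable_measurable[f1 f2] /cintegrable_measurable[g1 g2] fg.
apply/eqP; rewrite eq_complex /=; apply/andP; split; apply/eqP.
  congr fine; apply: ae_eq_integral => //; try exact/measurable_EFinP.
  by apply: filterS fg => x fgx _; rewrite fgx.
congr fine; apply: ae_eq_integral => //; try exact/measurable_EFinP.
by apply: filterS fg => x fgx _; rewrite fgx.
Qed.

End complex_integral.

Section L2_hilbert.
Context d (T : measurableType d) (R : realType).
Variable mu : {measure set T -> \bar R}.
Local Notation L2 := (L2 mu).
Local Notation L2fun := (L2fun mu).

Local Open Scope quotient_scope.

Lemma Lfun2_mul_integrable (f g : T -> R) : f \in Lfun mu 2%:E -> g \in Lfun mu 2%:E ->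
  mu.-integrable setT (EFin \o (fun x => f x * g x)).
Proof. by move=> f2 g2; apply/Lfun1_integrable; exact: Lfun2_mul_Lfun1. Qed.

Lemma cL2_mul_cintegrable (f g : T -> R[i]) : f \in cL2 mu -> g \in cL2 mu ->
  cintegrable mu (fun x => f x * g x).
Proof.
move=> /andP[f1 f2] /andP[g1 g2]; split.
  apply: eq_integrable (integrableB measurableT (Lfun2_mul_integrable f1 g1) (Lfun2_mul_integrable f2 g2)) => // x _ /=.
  by case: (f x) (g x) => [? ?] [? ?]; rewrite /= EFinB.
apply: eq_integrable (integrableD measurableT (Lfun2_mul_integrable f1 g2) (Lfun2_mul_integrable f2 g1)) => // x _ /=.
by case: (f x) (g x) => [? ?] [? ?]; rewrite /= EFinD.
Qed.

Lemma cL2J (f : T -> R[i]) : f \in cL2 mu -> (fun x => (f x)^*) \in cL2 mu.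
Proof.
move=> /andP[/= f1 f2]; apply/andP; split => /=.
  by rewrite (_ : _ \o _ = Re \o f)//; apply/funext => x /=; case: (f x).
rewrite (_ : _ \o _ = (-1) \*o (Im \o f)); first exact: Lfun2Z.
by apply/funext => x /=; case: (f x) => [? ?]; rewrite /= mulN1r.
Qed.

Lemma L2dot_cintegrable (f g : L2fun) : cintegrable mu (fun t => f t * (g t)^*).
Proof. by apply: cL2_mul_cintegrable; [exact: L2funP|apply/cL2J/L2funP]. Qed.

Lemma cintegral_pi (f : L2fun) (h : T -> R[i]) : h \in cL2 mu ->
  cintegral mu (fun t => repr (\pi_L2 f) t * h t) = cintegral mu (fun t => f t * h t).
Proof.
move=> h2; apply: ae_eq_cintegral.
- by apply: cL2_mul_cintegrable => //; exact: L2funP.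
- by apply: cL2_mul_cintegrable => //; exact: L2funP.
- by apply: filterS (L2_reprK f) => t ->.
Qed.

Lemma L2dotE (f g : L2fun) :
  L2dot (\pi_L2 f) (\pi_L2 g) = cintegral mu (fun t => f t * (g t)^*).
Proof.
rewrite /L2dot cintegral_pi; last by apply/cL2J/L2funP.
apply: ae_eq_cintegral; [exact: L2dot_cintegrable..|].
by apply: filterS (L2_reprK g) => t ->.
Qed.

Lemma L2_nrmE (x : L2) : nrm x = L2norm x.
Proof. by []. Qed.

Lemma L2norm_sqr (f : L2fun) :
  (nrm (\pi_L2 f : L2) ^+ 2)%:E = (\int[mu]_t (normc (f t) ^+ 2)%:E)%E.
Proof.
have := congr1 (fun x => poweR x 2) (L2normE f).
rewrite powR_Lnorm// => /esym.
rewrite -L2_nrmE poweR_EFin powR_mulrn ?nrm_ge0// => <-.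
by apply: eq_integral => t _ /=; rewrite powR_mulrn// ger0_norm// Defs.normc_ge0.
Qed.

Lemma L2_hilbert_dot : [/\ forall (a : R[i]) (x y z : L2),
    L2dot (a *: x + y) z = a * L2dot x z + L2dot y z,
  forall x y : L2, L2dot y x = (L2dot x y)^* &
  forall x : L2, L2dot x x = (nrm x ^+ 2)%:C].
Proof.
split=> [a x y z|x y|x].
- rewrite -[x]reprK -[y]reprK -[z]reprK -[_ *: _]/(L2scale a _) L2scale_pi -L2_piD !L2dotE.
  rewrite -cintegralZ; last exact: L2dot_cintegrable.
  rewrite -cintegralD; [|exact: cintegrableZ (L2dot_cintegrable _ _)|exact: L2dot_cintegrable].
  congr (cintegral mu _); apply/funext => t.
  by rewrite [X in X * _ = _](_ : _ = a * repr x t + repr y t)//; ring.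
- rewrite -cintegralJ; last exact: L2dot_cintegrable.
  by congr (cintegral mu _); apply/funext => t; rewrite rmorphM/= conjcK mulrC.
- rewrite -[x]reprK L2dotE; apply/eqP; rewrite eq_complex /=; apply/andP; split; apply/eqP.
    apply: EFin_inj; rewrite L2norm_sqr /Rintegral; set g := repr x.
    have -> : (\int[mu]_t (normc (g t) ^+ 2)%:E = \int[mu]_t (Re (g t * (g t)^*))%:E)%E.
      by apply: eq_integral => t _; rewrite mulconj.
    by rewrite fineK//; apply: integrable_fin_num => //; case: (L2dot_cintegrable g g).
  rewrite -[RHS](Rintegral_set0 mu (fun=> 0)) [RHS]Rintegral_mkcond.
  by apply: eq_Rintegral => t _; rewrite mulconj /= patchE in_set0.
Qed.

End L2_hilbert.

(** * Completeness of [L2] *)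

Section L2_complete.
Context d (T : measurableType d) (R : realType).
Variable mu : {measure set T -> \bar R}.
Local Notation L2 := (L2 mu).
Local Notation L2fun := (L2fun mu).

Local Open Scope quotient_scope.

Lemma Lfun2_of_sqr (h : T -> R) (q : T -> R) : measurable_fun setT h ->
  measurable_fun setT q -> (forall t, h t ^+ 2 <= q t) ->
  (\int[mu]_t (q t)%:E < +oo)%E -> h \in Lfun mu 2%:E.
Proof.
move=> mh mq hq ioo; rewrite !inE/=; apply/andP; rewrite !inE; split => //.
rewrite /finite_norm unlock/=; apply: poweR_lty; apply: le_lt_trans ioo.
apply: ge0_le_integral => //.
- apply/measurable_EFinP; apply: (@measurableT_comp _ _ _ _ _ _ (fun x : R => x `^ 2)%R) => //.
  exact: measurableT_comp.
- exact/measurable_EFinP.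
- by move=> t _; rewrite /= lee_fin powR_mulrn// real_normK ?num_real.
Qed.

Lemma measurable_sqr_normc (f : T -> R[i]) : measurable_fun setT (Re \o f) ->
  measurable_fun setT (Im \o f) -> measurable_fun setT (fun t => normc (f t) ^+ 2).
Proof.
move=> mr mi; under eq_fun do rewrite sqr_normcE.
by apply: measurable_funD; apply: measurable_funX.
Qed.

Lemma cL2_of_sqr (f : T -> R[i]) : measurable_fun setT (Re \o f) ->
  measurable_fun setT (Im \o f) ->
  (\int[mu]_t (normc (f t) ^+ 2)%:E < +oo)%E -> f \in cL2 mu.
Proof.
move=> mr mi ioo; have mq := measurable_sqr_normc mr mi.
apply/andP; split => /=; apply: Lfun2_of_sqr mq _ ioo => // t.
  by rewrite sqr_normcE lerDl sqr_ge0.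
by rewrite sqr_normcE lerDr sqr_ge0.
Qed.

Lemma cL2_measurable (f : T -> R[i]) : f \in cL2 mu ->
  measurable_fun setT (Re \o f) /\ measurable_fun setT (Im \o f).
Proof. by move=> /andP[/andP[+ _] /andP[+ _]]; rewrite !inE. Qed.

Lemma limn_einf_le (u : (\bar R)^nat) (c : \bar R) :
  (\forall n \near \oo, u n <= c)%E -> (limn_einf u <= c)%E.
Proof.
move=> uc; rewrite limn_einf_lim; apply: lime_le; first exact: is_cvg_einfs.
apply: filterS uc => n; apply: le_trans.
by apply: ereal_inf_lbound; exists n => /=.
Qed.

Lemma fast_subsequence (u : nat -> L2) : cauchy_nrm u -> exists p : nat -> nat,
  forall k, (forall n, (p k <= n)%N -> nrm (u n - u (p k)) < 2 ^- k) /\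
            (p k <= p k.+1)%N.
Proof.
move=> uC.
have h k : exists N, forall m n, (N <= m)%N -> (N <= n)%N -> nrm (u m - u n) < 2 ^- k.
  by apply: uC; rewrite invr_gt0 exprn_gt0.
have [N hN] := choice h.
exists (fun k => \max_(j < k.+1) N j)%N => k; split.
  move=> n pn; have Nk : (N k <= \max_(j < k.+1) N j)%N.
    exact: (@leq_bigmax _ (fun j : 'I_k.+1 => N j) ord_max).
  by apply: hN => //; exact: leq_trans pn.
by rewrite [leqRHS]big_ord_recr/= leq_maxl.
Qed.

(** Both [G] and [a + G] are nondecreasing and bounded above, so [a] is a difference of convergent
    sequences. *)
Lemma monotone_dominates_cvg (a G : nat -> R) (C : R) :
  (forall k, `|a k.+1 - a k| <= G k.+1 - G k) -> (forall k, G k <= C) -> cvgn a.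
Proof.
move=> aG GC.
have Gnd : nondecreasing_seq G.
  by apply/nondecreasing_seqP => k; rewrite -subr_ge0; exact: le_trans (aG k).
have aGnd : nondecreasing_seq (a \+ G).
  apply/nondecreasing_seqP => k; have := aG k; rewrite ler_norml => /andP[h _] /=; lra.
have Gcv : cvgn G by apply: nondecreasing_is_cvgn => //; exists C => _ [k _ <-].
have ab k : a k <= a 0%N + (C - G 0%N).
  suff : a k <= a 0%N + (G k - G 0%N) by have := GC k; lra.
  elim: k => [|k IH]; first by lra.
  by have := aG k; rewrite ler_norml => /andP[_ h]; lra.
have aGcv : cvgn (a \+ G).
  apply: nondecreasing_is_cvgn => //.
  by exists (a 0%N + (C - G 0%N) + C) => _ [k _ <-] /=; apply: lerD.
have -> : a = (a \+ G) \- G by apply/funext => k /=; rewrite addrK.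
exact: is_cvgB.
Qed.

Section fast.
Variable (f : nat -> L2fun).
Hypothesis fD : forall k, nrm (\pi_L2 (f k.+1) - \pi_L2 (f k) : L2) <= 2 ^- k.

Lemma L2_piN (h : L2fun) : \pi_L2 (- h) = - (\pi_L2 h : L2).
Proof. exact: (Quotient.pi_opp (null_L2fun (mu:=mu)) h). Qed.

Lemma L2_piB (h1 h2 : L2fun) : \pi_L2 (h1 - h2) = \pi_L2 h1 - \pi_L2 h2 :> L2.
Proof. by rewrite L2_piD L2_piN. Qed.

Lemma L2_pi_sum (h : nat -> L2fun) n :
  \pi_L2 (\sum_(k < n) h k) = \sum_(k < n) \pi_L2 (h k) :> L2.
Proof.
elim: n => [|n IH]; last by rewrite !big_ord_recr/= L2_piD IH.
by rewrite !big_ord0; apply: (addrI (\pi_L2 0 : L2)); rewrite -L2_piD !addr0.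
Qed.

Lemma normc_cL2 (h : L2fun) : (fun t => (normc (h t))%:C) \in cL2 mu.
Proof.
have m1 : measurable_fun setT (fun t => normc (h t)) by exact: measurable_normc.
apply: cL2_of_sqr; [exact: m1|exact: measurable_cst|].
under eq_integral do rewrite normcR real_normK ?num_real//.
by rewrite -L2norm_sqr ltry.
Qed.

(** The total variation [G] of the sequence has [L2] norm at most 2 by the triangle inequality and
    the geometric series. Monotone convergence makes its limit integrable after squaring, hence
    finite almost everywhere, and there [G] dominates the increments of both parts. *)
Lemma fast_ae_cvg : {ae mu, forall t, cvgn (fun k => Re (f k t)) /\
  cvgn (fun k => Im (f k t))}.
Proof.
pose D k := MkL2fun (normc_cL2 (f k.+1 - f k)).
have DE k t : D k t = (normc (f k.+1 t - f k t))%:C by [].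
pose G k t := \sum_(j < k) normc (f j.+1 t - f j t).
have GE k t : (\sum_(j < k) D j : L2fun) t = (G k t)%:C.
  elim: k => [|k IH]; first by rewrite /G !big_ord0.
  by rewrite big_ord_recr [LHS]/= /G big_ord_recr/= rmorphD/= -IH.
have G0 k t : 0 <= G k t by apply: sumr_ge0 => j _; exact: Defs.normc_ge0.
have Gnd t : nondecreasing_seq (G^~ t).
  by apply/nondecreasing_seqP => k; rewrite /G big_ord_recr/= lerDl Defs.normc_ge0.
have Dn k : nrm (\pi_L2 (D k) : L2) <= 2 ^- k.
  apply: le_trans (fD k); rewrite -L2_piB.
  rewrite -(@ler_pXn2r _ 2)// ?nnegrE ?nrm_ge0// -lee_fin !L2norm_sqr.
  rewrite le_eqVlt; apply/orP; left; apply/eqP; apply: eq_integral => t _.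
  by rewrite DE normcR real_normK ?num_real.
have Gn k : nrm (\pi_L2 (\sum_(j < k) D j) : L2) <= 2.
  rewrite L2_pi_sum; apply: le_trans (nrm_sum _ _ _) _.
  apply: le_trans (_ : \sum_(j < k) (2 ^- j : R) <= _); first by apply: ler_sum => j _; exact: Dn.
  suff -> : \sum_(j < k) (2 ^- j : R) = 2 - 2 * 2 ^- k by rewrite gerBl mulr_ge0// invr_ge0 exprn_ge0.
  elim: k => [|k IH]; first by rewrite big_ord0 expr0 invr1 mulr1 subrr.
  rewrite big_ord_recr/= IH exprS invfM.
  by set z := 2 ^- k; field.
have Gi k : (\int[mu]_t (G k t ^+ 2)%:E <= 4)%E.
  apply: le_trans (_ : (nrm (\pi_L2 (\sum_(j < k) D j) : L2) ^+ 2)%:E <= _)%E.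
    rewrite L2norm_sqr le_eqVlt; apply/orP; left; apply/eqP; apply: eq_integral => t _.
    by rewrite GE normcR real_normK ?num_real.
  rewrite lee_fin (_ : 4 = 2 ^+ 2); last by rewrite expr2; lra.
  by rewrite ler_pXn2r ?nnegrE ?nrm_ge0.
have mG k : measurable_fun setT (G k).
  have [+ _] := cL2_measurable (L2funP (\sum_(j < k) D j)).
  by apply: eq_measurable_fun => t _ /=; rewrite GE.
pose h k t : \bar R := (G k t ^+ 2)%:E.
have mh k : measurable_fun setT (h k) by apply/measurable_EFinP; exact: measurable_funX.
have h0 k t : setT t -> (0 <= h k t)%E by move=> _; rewrite lee_fin sqr_ge0.
have hnd t : setT t -> nondecreasing_seq (h^~ t).
  by move=> _ j k jk; rewrite lee_fin ler_pXn2r ?nnegrE//; exact: Gnd.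
have hcv t : cvgn (h^~ t) by apply: ereal_nondecreasing_is_cvgn; exact: hnd.
have hi : mu.-integrable setT (fun t => limn (h^~ t)).
  apply/integrableP; split.
    by apply: (emeasurable_fun_cvg h) => // t _; exact: hcv.
  have lim0 t : (0 <= limn (h^~ t))%E by apply: lime_ge => //; apply: nearW => k; exact: h0.
  under eq_integral do rewrite gee0_abs//.
  rewrite (monotone_convergence _ _ mh h0 hnd)//.
  apply: le_lt_trans (_ : 4 < _)%E; last by rewrite ltry.
  apply: lime_le; last by apply: nearW => k; exact: Gi.
  apply: ereal_nondecreasing_is_cvgn => j k jk; apply: ge0_le_integral => //.
    exact: h0.
  by move=> t Tt; exact: (hnd t Tt _ _ jk).
apply: filterS (integrable_ae measurableT hi) => t /(_ I) fin.
pose C := fine (limn (h^~ t)).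
(* [C] bounds the squares, and [G <= G ^+ 2 + 1] turns this into a bound on [G] itself. *)
have GC k : G k t <= C + 1.
  have : (h k t <= limn (h^~ t))%E.
    by apply: lime_ge => //; exists k => // j /= kj; exact: hnd.
  rewrite -(fineK fin) lee_fin -/C => hC.
  have : 0 <= (G k t - 1) ^+ 2 by exact: sqr_ge0.
  by have := G0 k t; nra.
split; apply: (monotone_dominates_cvg (G := G^~ t) (C := C + 1)) => // k.
  rewrite /G big_ord_recr/= addrAC subrr add0r; apply: le_trans (normc_Re _).
  by rewrite ReD ReN.
rewrite /G big_ord_recr/= addrAC subrr add0r; apply: le_trans (normc_Im _).
by case: (f k.+1 t) (f k t) => [? ?] [? ?].
Qed.

Lemma normc_cvg_sqr (z w : nat -> R) (a b : R) (c : R[i]) :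
  z k @[k --> \oo] --> a -> w k @[k --> \oo] --> b ->
  normc (z k +i* w k - c) ^+ 2 @[k --> \oo] --> normc (a +i* b - c) ^+ 2.
Proof.
case: c => c1 c2 za wb; rewrite sqr_normcE.
have -> : (fun k => normc (z k +i* w k - c1 +i* c2) ^+ 2) =
    (fun k => (z k - c1) * (z k - c1) + (w k - c2) * (w k - c2)).
  by apply/funext => k; rewrite sqr_normcE.
by rewrite !expr2; apply: cvgD; apply: cvgM; apply: cvgB => //; exact: cvg_cst.
Qed.

(** The limit function is defined everywhere through upper limits, which keeps it measurable and
    agrees with the limit almost everywhere. Fatou's lemma applied to [|f m - f k| ^ 2] gives the
    rate. *)
Lemma fast_limit : (forall j k, (j <= k)%N ->
    nrm (\pi_L2 (f k) - \pi_L2 (f j) : L2) <= 2 ^- j) ->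
  exists x : L2, forall k, nrm (x - \pi_L2 (f k)) <= 2 ^- k.
Proof.
move=> fjk.
pose g t : R[i] := fine (limn_esup (fun k => (Re (f k t))%:E)) +i*
                   fine (limn_esup (fun k => (Im (f k t))%:E)).
have mf k : measurable_fun setT (Re \o f k) /\ measurable_fun setT (Im \o f k).
  exact: cL2_measurable (L2funP (f k)).
have mgr : measurable_fun setT (Re \o g).
  apply: (@measurableT_comp _ _ _ _ _ _ (fine : \bar R -> R)) => //.
  by apply: measurable_fun_limn_esup => k; apply/measurable_EFinP; exact: (mf k).1.
have mgi : measurable_fun setT (Im \o g).
  apply: (@measurableT_comp _ _ _ _ _ _ (fine : \bar R -> R)) => //.
  by apply: measurable_fun_limn_esup => k; apply/measurable_EFinP; exact: (mf k).2.
have gE : {ae mu, forall t, Re (f k t) @[k --> \oo] --> Re (g t) /\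
                            Im (f k t) @[k --> \oo] --> Im (g t)}.
  apply: filterS fast_ae_cvg => t [/cvg_ex[a ha] /cvg_ex[b hb]].
  have ea : limn_esup (fun k => (Re (f k t))%:E) = a%:E.
    by apply: (cvg_limn_einf_sup _).2; apply/fine_cvgP; split => //; exact: nearW.
  have eb : limn_esup (fun k => (Im (f k t))%:E) = b%:E.
    by apply: (cvg_limn_einf_sup _).2; apply/fine_cvgP; split => //; exact: nearW.
  by rewrite /g /= ea eb.
have msub k : measurable_fun setT (Re \o (fun t => g t - f k t)) /\
              measurable_fun setT (Im \o (fun t => g t - f k t)).
  split.
    rewrite (_ : _ \o _ = (Re \o g) \- (Re \o f k)); last first.
      by apply/funext => t /=; case: (f k t).
    by apply: measurable_funB => //; exact: (mf k).1.
  rewrite (_ : _ \o _ = (Im \o g) \- (Im \o f k)); last first.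
    by apply/funext => t /=; case: (f k t).
  by apply: measurable_funB => //; exact: (mf k).2.
have gi k : (\int[mu]_t (normc (g t - f k t) ^+ 2)%:E <= ((2 ^- k) ^+ 2)%:E)%E.
  pose h m t := (normc (f m t - f k t) ^+ 2)%:E.
  have mh m : measurable_fun setT (h m).
    apply/measurable_EFinP.
    have [] := cL2_measurable (L2funP (f m - f k)); exact: measurable_sqr_normc.
  have h0 m t : setT t -> (0 <= h m t)%E by rewrite lee_fin sqr_ge0.
  have := fatou mu measurableT mh h0.
  have <- : (\int[mu]_t (normc (g t - f k t) ^+ 2)%:E =
      \int[mu]_t limn_einf (h^~ t))%E.
    apply: ge0_ae_eq_integral => //.
    - by apply/measurable_EFinP; apply: measurable_sqr_normc; case: (msub k).
    - apply: (@measurableT_comp _ _ _ _ _ _ (@oppe R)) => //.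
      apply: measurable_fun_limn_esup => m.
      exact: (@measurableT_comp _ _ _ _ _ _ (@oppe R)).
    - by move=> t _; rewrite lee_fin sqr_ge0.
    - by move=> t _; rewrite limn_einf_lim; apply: lime_ge;
        [exact: is_cvg_einfs|apply: nearW => m; apply: le_ereal_inf_tmp => _ [n _ <-]; exact: h0].
    - apply: filterS gE => t [gr gim] _; apply/esym.
      apply: (cvg_limn_einf_sup _).1; apply/fine_cvgP; split; first exact: nearW.
      have := normc_cvg_sqr (c := f k t) gr gim.
      by case: (g t) => ? ?; apply: cvg_trans; apply: near_eq_cvg; apply: nearW => m /=; case: (f m t).
  move=> /le_trans; apply; apply: limn_einf_le.
  exists k => // m /= km; rewrite /h -(L2norm_sqr (f m - f k)) lee_fin L2_piB.
  by rewrite ler_pXn2r ?nnegrE ?nrm_ge0 ?invr_ge0 ?exprn_ge0// fjk.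
have gfL k : (fun t => g t - f k t) \in cL2 mu.
  case: (msub k) => ? ?; apply: cL2_of_sqr => //.
  by apply: le_lt_trans (gi k) _; rewrite ltry.
(* Only the differences [g - f k] are known to be square-integrable, so [g] enters as
   [f 0 + (g - f 0)]. *)
exists (\pi_L2 (f 0%N + MkL2fun (gfL 0%N))) => k.
rewrite -L2_piB; have -> : f 0%N + MkL2fun (gfL 0%N) - f k = MkL2fun (gfL k).
  apply: val_inj; apply/funext => t.
  by rewrite [LHS](_ : _ = f 0%N t + (g t - f 0%N t) - f k t)// addrC [_ + (_ - _)]addrC subrK addrC.
rewrite -(@ler_pXn2r _ 2)// ?nnegrE ?nrm_ge0 ?invr_ge0 ?exprn_ge0//.
by rewrite -lee_fin L2norm_sqr; exact: gi.
Qed.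

End fast.

Lemma cvg_2N : (2 ^- k : R) @[k --> \oo] --> (0 : R).
Proof. by under eq_fun do rewrite -exprVn; apply: cvg_expr; rewrite ger0_norm ?invr_ge0// invf_lt1// ltr1n. Qed.

Lemma L2_complete (u : nat -> L2) : cauchy_nrm u -> exists x : L2, u n @[n --> \oo] --> x.
Proof.
move=> uC; have [p hp] := fast_subsequence uC.
have pnd j k : (j <= k)%N -> (p j <= p k)%N.
  apply: (homo_leq (r := fun a b => (a <= b)%N)) => [//|? ? ?|i]; first exact: leq_trans.
  by case: (hp i).
pose f k : L2fun := repr (u (p k)).
have fjk j k : (j <= k)%N -> nrm (\pi_L2 (f k) - \pi_L2 (f j) : L2) <= 2 ^- j.
  by move=> jk; rewrite !reprK ltW//; apply: (hp j).1; exact: pnd.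
have [|x hx] := @fast_limit f _ fjk; first by move=> k; exact: fjk.
exists x; apply/cvgn_nrmP => e e0.
have /cvgrPdist_lt/(_ (e / 2)) := cvg_2N; rewrite divr_gt0// => /(_ isT)[k _ /(_ k (leqnn k))].
rewrite sub0r normrN ger0_norm ?invr_ge0 ?exprn_ge0// => ke.
exists (p k) => n pn; apply: le_lt_trans (nrm_distD (u (p k)) _ _) _.
rewrite (splitr e); apply: ltrD.
  exact: lt_trans ((hp k).1 _ pn) ke.
by rewrite nrmB; apply: le_lt_trans ke; have := hx k; rewrite reprK.
Qed.

Lemma L2dot_hilbert : hilbert (@L2dot d T R mu : L2 -> L2 -> R[i]).
Proof.
have [h1 h2 h3] := L2_hilbert_dot mu.
by split => //; exact: L2_complete.
Qed.

End L2_complete.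

(** * Lebesgue measure restricted to the interval *)

Section interval_measure.
Context (R : realType) (l : R).
Hypothesis l0 : 0 < l.
Local Notation mu := (@lebesgue_measure R).
Local Notation muI := (@muI R l).
Local Notation D := (`]0, l[%classic : set (measurableTypeR R)).
Local Notation mT := (measurableTypeR R).

Lemma muIE (A : set R) : muI A = mu (A `&` D).
Proof. by []. Qed.

Lemma muI_itvE (a b : R) : 0 <= a -> a <= b -> b <= l ->
  muI (`]a, b]%classic : set R) = (b - a)%:E.
Proof.
(* Intersecting with the open interval removes the endpoint [b] exactly when [b = l], which does not
   change the measure. *)
move=> a0 ab bl; transitivity (mu ([set` Interval (BRight a)
    (if b == l then BLeft b else BRight b)] : set R)); last first.
  rewrite lebesgue_measure_itv/=; case: (b == l) => /=.
    by rewrite lte_fin; case: ltgtP ab => [//|//|->]; rewrite subrr.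
  by rewrite lte_fin; case: ltgtP ab => [//|//|->]; rewrite subrr.
rewrite muIE; congr (mu _).
apply/seteqP; split => x /=; rewrite !in_itv/=.
  by move=> [/andP[ax xb] /andP[x0 xl]]; case: eqVneq => [->|_]; rewrite /= ax.
  case: eqVneq => [bl'|bl'] /= /andP[ax xb].
    rewrite ax (ltW xb)//=; split => //; rewrite (le_lt_trans a0 ax)/=.
    by rewrite -bl'.
  rewrite ax xb (le_lt_trans a0 ax)/=; split => //.
  by rewrite (le_lt_trans xb)// lt_neqAle bl' bl.
Qed.

Lemma muI_ae (P : R -> Prop) : (forall x, 0 < x < l -> P x) -> {ae muI, forall x, P x}.
Proof.
move=> hP; exists (~` D); split.
- by apply: measurableC; exact: measurable_itv.
- by rewrite muIE setICl measure0.
- by move=> x /= nP; rewrite in_itv/= => xD; apply: nP; exact: hP.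
Qed.

Lemma muI_aeP (P : R -> Prop) : {ae mu, forall x, 0 < x < l -> P x} ->
  {ae muI, forall x, P x}.
Proof.
move=> [N [mN N0 PN]]; exists (N `|` ~` D); split.
- by apply: measurableU => //; apply: measurableC; exact: measurable_itv.
- rewrite muIE setIUl setICl setU0.
  by apply: subset_measure0 N0 => //; exact: measurableI.
- move=> x /= nP; have [xD|] := pselect (0 < x < l); last by move=> ?; right; rewrite in_itv.
  by left; apply: PN => /=; apply: contra_not nP; exact.
Qed.

Lemma integral_muI (f : mT -> \bar R) : measurable_fun setT f ->
  (\int[muI]_x f x = \int[mu]_(x in D) f x)%E.
Proof.
move=> mf.
have mD : measurable (D : set mT) by exact: measurable_itv.
rewrite (ae_eq_integral (f \_ D)) //.
- rewrite -integral_mkcond; apply: eq_measure_integral => A mA AD.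
  by rewrite muIE setIidl.
- by apply/(measurable_restrict _ mD) => //; exact: measurable_funS mf.
- apply: muI_ae => x xD _; rewrite patchE mem_set//= in_itv/=.
Qed.

Lemma integrable_muI (f : mT -> \bar R) : measurable_fun setT f ->
  muI.-integrable setT f <-> mu.-integrable D f.
Proof.
move=> mf; have mf' : measurable_fun D f by exact: measurable_funS mf.
split=> /integrableP[_ h]; apply/integrableP; split => //.
  by rewrite -integral_muI//; exact: measurableT_comp.
by rewrite integral_muI//; exact: measurableT_comp.
Qed.

Lemma bounded_cL2 (f : mT -> R[i]) (M : R) : measurable_fun setT (Re \o f) ->
  measurable_fun setT (Im \o f) -> (forall x, 0 < x < l -> normc (f x) <= M) ->
  f \in cL2 muI.
Proof.
move=> mr mi fM; apply: cL2_of_sqr => //.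
rewrite integral_muI; last first.
  by apply/measurable_EFinP; exact: measurable_sqr_normc.
apply: le_lt_trans (_ : (\int[mu]_(x in D) (cst (M ^+ 2)%:E x))%E < _)%E.
  apply: ge0_le_integral => //.
  - by move=> x _; rewrite lee_fin sqr_ge0.
  - apply/measurable_EFinP; apply: measurable_funTS; exact: measurable_sqr_normc.
  - move=> x /=; rewrite in_itv/= => /fM fxM; rewrite lee_fin ler_pXn2r ?nnegrE ?Defs.normc_ge0//.
    exact: le_trans (Defs.normc_ge0 _) fxM.
rewrite integral_cst//= lebesgue_measure_itv/= lte_fin l0 -EFinB -EFinM ltry//.
Qed.

End interval_measure.

(** * Compactly supported functions of class [C^1] *)

Section C1c_theory.
Context (R : realType).
Implicit Types f g : R -> R.

Lemma is_derive_quadratic f (c C x : R) : 0 <= C ->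
  (forall h, `|f (x + h) - f x - c * h| <= C * h ^+ 2) -> is_derive x (1 : R) f c.
Proof.
move=> C0 hf.
have lim : h^-1 *: (f (h *: 1 + x) - f x) @[h --> 0^'] --> c.
  apply/cvgrPdist_le => e e0; near=> h.
  have h0 : h != 0 by near: h; exact: nbhs_dnbhs_neq.
  have -> : c - h^-1 *: (f (h *: 1 + x) - f x) = - (h^-1 * (f (x + h) - f x - c * h)).
    by rewrite [h *: 1]mulr1 [h + x]addrC [_ *: _](_ : _ = h^-1 * (f (x + h) - f x))//; field.
  rewrite normrN normrM normfV ler_pdivrMl ?normr_gt0//.
  apply: le_trans (hf h) _; rewrite -(real_normK (num_real h)) expr2 mulrA mulrC.
  rewrite ler_wpM2l//.
  have he : `|h| <= e / (C + 1).
    near: h; apply: dnbhs0_le; rewrite divr_gt0// ltr_wpDl//.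
  apply: le_trans (ler_wpM2l C0 he) _.
  by rewrite mulrA ler_pdivrMr ?ltr_wpDl// mulrC ler_wpM2l ?(ltW e0)// lerDl.
by apply: DeriveDef; [apply/cvg_ex; exists c|exact: cvg_lim lim].
Unshelve. all: end_near. Qed.

Definition C1_der f f' := (forall x, is_derive x (1 : R) f (f' x)) /\ continuous f'.

Definition supp_in (a b : R) f := forall x, ~~ (a <= x <= b) -> f x = 0.

Lemma C1_derE f f' : C1_der f f' -> derive1 f = f'.
Proof. by move=> [df _]; apply/funext => x; rewrite derive1E; apply: derive_val. Qed.

Lemma C1cP l f : C1c l f <-> exists2 f', C1_der f f' &
  exists a b, [/\ 0 < a, b < l & supp_in a b f].
Proof.
split=> [[df cf sf]|[f' ff' sf]].
  exists (derive1 f) => //; split => // x; rewrite derive1E; exact: derivableP.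
split => //; first by move=> x; case: ff' => + _ => /(_ x) h; exact: ex_derive.
by rewrite (C1_derE ff'); case: ff'.
Qed.

Lemma C1_der_continuous f f' : C1_der f f' -> continuous f.
Proof.
move=> [df _] x; apply: differentiable_continuous; apply/derivable1_diffP.
by have h := df x; exact: ex_derive.
Qed.

Lemma C1_derD f f' g g' : C1_der f f' -> C1_der g g' ->
  C1_der (fun x => f x + g x) (fun x => f' x + g' x).
Proof.
move=> [df cf] [dg cg]; split => [x|x]; last by apply: cvgD; [exact: cf|exact: cg].
by have := df x; have := dg x => ? ?; exact: is_deriveD.
Qed.

Lemma C1_derB f f' g g' : C1_der f f' -> C1_der g g' ->
  C1_der (fun x => f x - g x) (fun x => f' x - g' x).
Proof.
move=> [df cf] [dg cg]; split => [x|x]; last by apply: cvgB; [exact: cf|exact: cg].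
by have := df x; have := dg x => ? ?; exact: is_deriveB.
Qed.

Lemma C1_derM f f' g g' : C1_der f f' -> C1_der g g' ->
  C1_der (fun x => f x * g x) (fun x => f x * g' x + g x * f' x).
Proof.
move=> fD gD; have [df cf] := fD; have [dg cg] := gD; split => x.
  by have := df x; have := dg x => ? ?; exact: is_deriveM.
have cf0 := C1_der_continuous fD; have cg0 := C1_der_continuous gD.
by apply: cvgD; apply: cvgM; [exact: cf0|exact: cg|exact: cg0|exact: cf].
Qed.

Lemma C1c_ex2 l f g : C1c l f -> C1c l g -> exists f' g' a b,
  [/\ C1_der f f', C1_der g g', 0 < a, b < l & supp_in a b f /\ supp_in a b g].
Proof.
move=> /C1cP[f' ff' [a [b [a0 bl sf]]]] /C1cP[g' gg' [c [d [c0 dl sg]]]].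
exists f', g', (Num.min a c), (Num.max b d); split => //.
- by rewrite lt_min a0.
- by rewrite gt_max bl.
- split=> x nx; [apply: sf|apply: sg]; apply: contra nx => /andP[h1 h2];
  by rewrite ge_min le_max h1 h2 ?orbT.
Qed.

Lemma C1cD l f g : C1c l f -> C1c l g -> C1c l (fun x => f x + g x) /\
  forall x, derive1 (fun x => f x + g x) x = derive1 f x + derive1 g x.
Proof.
move=> cf cg; have [f' [g' [a [b [ff' gg' a0 bl [sf sg]]]]]] := C1c_ex2 cf cg.
have h := C1_derD ff' gg'.
split; last by move=> x; rewrite (C1_derE h) (C1_derE ff') (C1_derE gg').
apply/C1cP; eexists; first exact: h.
by exists a, b; split => // x nx; rewrite sf// sg// addr0.
Qed.

Lemma C1cB l f g : C1c l f -> C1c l g -> C1c l (fun x => f x - g x) /\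
  forall x, derive1 (fun x => f x - g x) x = derive1 f x - derive1 g x.
Proof.
move=> cf cg; have [f' [g' [a [b [ff' gg' a0 bl [sf sg]]]]]] := C1c_ex2 cf cg.
have h := C1_derB ff' gg'.
split; last by move=> x; rewrite (C1_derE h) (C1_derE ff') (C1_derE gg').
apply/C1cP; eexists; first exact: h.
by exists a, b; split => // x nx; rewrite sf// sg// subr0.
Qed.

Lemma C1cM l f g : C1c l f -> C1c l g -> C1c l (fun x => f x * g x) /\
  forall x, derive1 (fun x => f x * g x) x = f x * derive1 g x + g x * derive1 f x.
Proof.
move=> cf cg; have [f' [g' [a [b [ff' gg' a0 bl [sf sg]]]]]] := C1c_ex2 cf cg.
have h := C1_derM ff' gg'.
split; last by move=> x; rewrite (C1_derE h) (C1_derE ff') (C1_derE gg').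
apply/C1cP; eexists; first exact: h.
by exists a, b; split => // x nx; rewrite sf// mul0r.
Qed.

Lemma C1cZ l (k : R) f : C1c l f -> C1c l (fun x => k * f x) /\
  forall x, derive1 (fun x => k * f x) x = k * derive1 f x.
Proof.
move=> /C1cP[f' ff' [a [b [a0 bl sf]]]].
have h : C1_der (fun x => k * f x) (fun x => k * f' x).
  case: ff' => df cf; split => x; first by have := df x => ?; exact: is_deriveZ.
  by apply: cvgM; [exact: cvg_cst|exact: cf].
split; last by move=> x; rewrite (C1_derE h) (C1_derE ff').
apply/C1cP; eexists; first exact: h.
by exists a, b; split => // x nx; rewrite sf// mulr0.
Qed.

Lemma C1c0 l : 0 < l -> C1c l (fun=> 0 : R) /\ forall x : R, derive1 (fun=> 0 : R) x = 0.
Proof.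
move=> l0; have h : C1_der (fun=> 0 : R) (fun=> 0 : R).
  by split => x; [exact: is_derive_cst|exact: cvg_cst].
split; last by move=> x; rewrite (C1_derE h).
apply/C1cP; eexists; first exact: h.
by exists (l / 2), (l / 2); split => //; lra.
Qed.

Lemma continuous_itv_bounded f (a b : R) : continuous f ->
  exists M, forall x, a <= x <= b -> `|f x| <= M.
Proof.
move=> cf; have cK : compact (f @` `[a, b]%classic).
  apply: continuous_compact; last exact: segment_compact.
  exact: continuous_subspaceT.
have /(@compact_bounded _ R^o)[M [_ hM]] := cK.
exists (M + 1) => x xab; apply: (hM (M + 1)); first by rewrite ltrDl.
by exists x => //=; rewrite in_itv.
Qed.

End C1c_theory.

(** * Bump functions increasing to the indicator of an initial interval *)

Section bump.
Context (R : realType).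
Implicit Types f g : R -> R.

(** Squaring the positive part is the simplest way of vanishing on a half-line while staying [C^1];
    no smoother profile is needed since test functions are only [C^1]. *)
Definition sqpos (s : R) : R := Num.max 0 s ^+ 2.

Lemma C1_der_sqpos : C1_der sqpos (fun s => 2 * Num.max 0 s).
Proof.
split=> s; last first.
  apply: cvgM; first exact: cvg_cst.
  by apply: continuous_max; [exact: cvg_cst|exact: cvg_id].
apply: (is_derive_quadratic (C := 1)) => // h; rewrite /sqpos mul1r ler_norml.
have [s0|s0] := lerP s 0; have [h0|h0] := lerP (s + h) 0; apply/andP; split; nra.
Qed.

Lemma C1_der_comp f f' g g' : C1_der f f' -> C1_der g g' ->
  C1_der (fun x => f (g x)) (fun x => g' x * f' (g x)).
Proof.
move=> [df cf] gD; have [dg cg] := gD; split => x.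
  have h1 := dg x; have h2 := df (g x).
  have := @is_derive1_comp _ f g x (f' (g x)) (g' x) h2 h1.
  by rewrite mulrC.
apply: cvgM; first exact: cg.
apply: (@continuous_comp _ _ _ g f'); first exact: (C1_der_continuous gD).
exact: cf.
Qed.

Lemma C1_der_ratio f f' : (forall x, 0 <= f x) -> C1_der f f' ->
  C1_der (fun x => f x / (1 + f x)) (fun x => f' x / (1 + f x) ^+ 2).
Proof.
move=> f0 fD; have [df cf] := fD; have cf0 := C1_der_continuous fD.
have f1 x : 1 + f x != 0 by rewrite gt_eqF// ltr_pwDl.
have c1 : continuous (fun x => 1 + f x).
  by move=> x; apply: cvgD; [exact: cvg_cst|exact: cf0].
split => x.
  have h := df x.
  have h1 : is_derive x (1 : R) (fun x => 1 + f x) (f' x).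
    by have := is_deriveD (is_derive_cst (1 : R) x (1 : R)) h; rewrite add0r.
  have h2 := @is_deriveV _ (fun x => 1 + f x) x (f' x) 1 (f1 x) h1.
  have := is_deriveM h h2.
  rewrite (_ : _ *: _ + _ = f' x / (1 + f x) ^+ 2); first by [].
  rewrite [LHS](_ : _ = f x * (- (1 + f x) ^- 2 * f' x) + (1 + f x)^-1 * f' x)//.
  by field; exact: f1.
apply: cvgM; first exact: cf.
by apply: cvgV; [rewrite expf_neq0|rewrite !expr2; apply: cvgM; exact: c1].
Qed.

(** The quadratic is positive exactly between [1/(n+1)] and [d] when these are in order, which fixes
    the support; the factor [(n+1)^2] sends [s] to infinity at each point of []0, d[], and
    [s / (1 + s)] then tends to 1 while staying in [[0, 1]]. *)
Definition bump (d : R) (n : nat) (x : R) : R :=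
  let s := sqpos (n.+1%:R ^+ 2 * ((x - n.+1%:R^-1) * (d - x))) in s / (1 + s).

Lemma bump_ge0 d n x : 0 <= bump d n x.
Proof. by rewrite divr_ge0// ?addr_ge0// sqr_ge0. Qed.

Lemma bump_le1 d n x : bump d n x <= 1.
Proof.
rewrite /bump; set s := sqpos _; have s0 : 0 <= s by exact: sqr_ge0.
by rewrite ler_pdivrMr ?ltr_pwDl// mul1r lerDr.
Qed.

Lemma bump_supp d n x : n.+1%:R^-1 <= d -> ~~ (n.+1%:R^-1 <= x <= d) -> bump d n x = 0.
Proof.
move=> nd nx; rewrite /bump /sqpos (_ : Num.max _ _ = 0) ?expr0n/= ?mul0r//.
apply/max_idPl; rewrite pmulr_rle0 ?exprn_gt0//; move: nx; rewrite negb_and -!ltNge => /orP[] h.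
  by rewrite nmulr_rle0 ?subr_lt0// subr_ge0 (le_trans (ltW h)).
by rewrite nmulr_lle0 ?subr_lt0// subr_ge0 (le_trans nd)// ltW.
Qed.

Lemma bump_C1 d n : exists f', C1_der (bump d n) f'.
Proof.
eexists; apply: C1_der_ratio; first by move=> x; exact: sqr_ge0.
apply: C1_der_comp C1_der_sqpos _.
have h (a : R) : C1_der (fun x => x - a) (fun=> 1).
  split => x; last exact: cvg_cst.
  by have := is_deriveB (is_derive_id x (1 : R)) (is_derive_cst a x (1 : R)); rewrite subr0.
have h' (a : R) : C1_der (fun x => a - x) (fun=> -1).
  split => x; last exact: cvg_cst.
  by have := is_deriveB (is_derive_cst a x (1 : R)) (is_derive_id x (1 : R)); rewrite sub0r.
have hc (a : R) : C1_der (fun=> a) (fun=> 0).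
  by split => x; [exact: is_derive_cst|exact: cvg_cst].
exact: C1_derM (hc _) (C1_derM (h _) (h' _)).
Qed.

Lemma C1c_bump l d n : n.+1%:R^-1 <= d -> d < l -> C1c l (bump d n).
Proof.
move=> nd dl; have [f' hf'] := bump_C1 d n; apply/C1cP; exists f' => //.
by exists n.+1%:R^-1, d; split => // x; exact: bump_supp.
Qed.

Lemma bump_cvg d x : 0 < x < d -> bump d n x @[n --> \oo] --> (1 : R).
Proof.
move=> /andP[x0 xd]; apply/cvgrPdist_le => e e0.
pose c := (x / 2 * (d - x)) ^+ 2.
have c0 : 0 < c by rewrite exprn_gt0// !mulr_gt0// subr_gt0.
have [N _ HN] : \forall n \near \oo, (n.+1%:R : R)^-1 <= Num.min (x / 2) (e * c).
  have := @cvg_harmonic R; move/cvgrPdist_le => /(_ (Num.min (x / 2) (e * c))).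
  rewrite lt_min divr_gt0//= mulr_gt0// => /(_ isT); apply: filterS => n.
  by rewrite sub0r normrN ger0_norm.
exists N => // n /= Nn; have := HN n Nn; rewrite le_min => /andP[n1 n2].
rewrite /bump; set s := sqpos _.
have s0 : 0 <= s by exact: sqr_ge0.
have n0 : 0 < (n.+1%:R : R) by [].
have n1' : 1 <= (n.+1%:R : R) by rewrite ler1n.
(* Once [1/(n+1) <= x/2], the argument of [sqpos] is at least [(n+1) (x/2) (d-x)], whose square is
   [(n+1)^2 c]. *)
have sc : n.+1%:R * c <= s.
  rewrite /s /sqpos.
  have h : n.+1%:R * (x / 2 * (d - x)) <= n.+1%:R ^+ 2 * ((x - n.+1%:R^-1) * (d - x)).
    rewrite expr2 -[leRHS]mulrA ler_wpM2l// mulrA.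
    rewrite ler_wpM2r ?subr_ge0 ?(ltW xd)//.
    have h1 : x / 2 <= x - n.+1%:R^-1 by move: n1; move: (_^-1 : R) => a ?; lra.
    by rewrite (le_trans h1)// ler_peMl// (le_trans _ h1)// divr_ge0// ltW.
  have h0 : 0 <= n.+1%:R * (x / 2 * (d - x)) by rewrite !mulr_ge0 ?subr_ge0 ?ltW// divr_ge0// ltW.
  rewrite (max_idPr (le_trans h0 h)); apply: le_trans (_ : (n.+1%:R * (x / 2 * (d - x))) ^+ 2 <= _).
    by rewrite exprMn -/c expr2 -[leRHS]mulrA ler_wpM2l// ler_peMl// ltW.
  by rewrite ler_pXn2r ?nnegrE// (le_trans h0 h).
have s1 : 0 < 1 + s by rewrite ltr_pwDl.
have -> : 1 - s / (1 + s) = (1 + s)^-1 by field; rewrite gt_eqF.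
rewrite ger0_norm ?invr_ge0 ?(ltW s1)//.
apply: le_trans (_ : (n.+1%:R * c)^-1 <= _).
  have nc0 : 0 < n.+1%:R * c by rewrite mulr_gt0.
  by rewrite lef_pV2 ?posrE//; apply: le_trans sc _; rewrite lerDr.
by rewrite invfM ler_pdivrMr.
Qed.

End bump.

Section L2cls.
Context d (T : measurableType d) (R : realType).
Variable mu : {measure set T -> \bar R}.
Local Open Scope quotient_scope.

Lemma L2clsE (f : T -> R[i]) (fL : f \in cL2 mu) : L2cls mu f = \pi_(L2 mu) (MkL2fun fL).
Proof.
rewrite /L2cls; congr (\pi_(L2 mu) _); apply: val_inj.
by rewrite val_insubd fL.
Qed.

Lemma L2cls_repr (x : L2 mu) : L2cls mu (repr x) = x.
Proof. by rewrite (L2clsE (L2funP _)) -[RHS]reprK; congr (\pi_(L2 mu) _); exact: val_inj. Qed.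

Lemma L2cls_lin (a : R[i]) (f g : T -> R[i]) : f \in cL2 mu -> g \in cL2 mu ->
  L2cls mu (fun t => a * f t + g t) = (a *: L2cls mu f + L2cls mu g : L2 mu).
Proof.
move=> fL gL; have hL : (fun t => a * f t + g t) \in cL2 mu.
  exact: (cL2_submod_closed mu).2.
rewrite (L2clsE fL) (L2clsE gL) (L2clsE hL) -[_ *: _]/(L2scale a _) L2scale_pi -L2_piD.
by congr (\pi_(L2 mu) _); apply: val_inj.
Qed.

Lemma L2dot_cls (f g : T -> R[i]) : f \in cL2 mu -> g \in cL2 mu ->
  L2dot (L2cls mu f) (L2cls mu g) = cintegral mu (fun t => f t * (g t)^*).
Proof. by move=> fL gL; rewrite (L2clsE fL) (L2clsE gL) L2dotE. Qed.

Lemma L2dot_clsr (x : L2 mu) (g : T -> R[i]) : g \in cL2 mu ->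
  L2dot x (L2cls mu g) = cintegral mu (fun t => repr x t * (g t)^*).
Proof. by move=> gL; rewrite -[in LHS](L2cls_repr x) L2dot_cls// L2funP. Qed.

Lemma nrm_cls (f : T -> R[i]) : f \in cL2 mu ->
  (nrm (L2cls mu f : L2 mu) ^+ 2)%:E = (\int[mu]_t (normc (f t) ^+ 2)%:E)%E.
Proof. by move=> fL; rewrite (L2clsE fL) L2norm_sqr. Qed.

End L2cls.

(** * Test functions: point evaluation and integration by parts *)

Section test_functions.
Context (R : realType) (l : R).
Hypothesis l0 : 0 < l.
Local Notation mu := (@lebesgue_measure R).
Local Notation muI := (@muI R l).
Local Notation D := (`]0, l[%classic : set (measurableTypeR R)).
Local Notation mT := (measurableTypeR R).
Implicit Types (f g : R -> R) (phi psi : R -> R[i]).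

Lemma C1c_continuous f : C1c l f -> continuous f /\ continuous (derive1 f).
Proof.
by move=> /C1cP[f' ff' _]; rewrite (C1_derE ff'); split; [exact: C1_der_continuous ff'|case: ff'].
Qed.

Lemma C1c_measurable f : C1c l f ->
  measurable_fun setT (f : mT -> R) /\ measurable_fun setT (derive1 f : mT -> R).
Proof. by move=> /C1c_continuous[? ?]; split; exact: continuous_measurable_fun. Qed.

Lemma C1c_bounded f : C1c l f ->
  exists M, forall x, 0 < x < l -> `|f x| <= M /\ `|derive1 f x| <= M.
Proof.
move=> /C1c_continuous[cf cf'].
have [M hM] := continuous_itv_bounded 0 l cf.
have [M' hM'] := continuous_itv_bounded 0 l cf'.
exists (Num.max M M') => x /andP[x0 xl]; rewrite !le_max hM ?hM' ?orbT//; by rewrite !ltW.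
Qed.

Lemma test_cL2 phi : test_fun l phi -> phi \in cL2 muI /\ cderiv phi \in cL2 muI.
Proof.
move=> [pr pi]; have [mr mr'] := C1c_measurable pr; have [mi mi'] := C1c_measurable pi.
have [M hM] := C1c_bounded pr; have [M' hM'] := C1c_bounded pi.
split; apply: (bounded_cL2 l0 (M := M + M')) => // x xI; apply: le_trans (normc_le_ReIm _) _.
  by apply: lerD; [case: (hM x xI)|case: (hM' x xI)].
by apply: lerD; [case: (hM x xI)|case: (hM' x xI)].
Qed.

(** The fundamental theorem of calculus, with [f 0 = 0] because the support is compact in []0, l[].
    The range of integration is put into the integrand so that the formula reads as an inner product
    with an indicator; [x = l] is allowed since the right end of a grid is used later. *)
Lemma FTC_muI f x : C1c l f -> 0 < x <= l ->
  \int[muI]_y (if 0 < y <= x then derive1 f y else 0) = f x.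
Proof.
move=> fC /andP[x0 xl]; have [mf mf'] := C1c_measurable fC.
have [f' ff' [a [b [a0 bl sf]]]] := (C1cP _ _).1 fC.
rewrite (C1_derE ff') in mf' *.
have f00 : f 0 = 0 by apply: sf; rewrite negb_and -ltNge a0.
pose A : set mT := `]0, x]%classic; pose A0 : set mT := `[0, x]%classic.
have mA : measurable A by exact: measurable_itv.
have E y : (if 0 < y <= x then f' y else 0) = (f' \_ A) y.
  rewrite patchE; case: ifPn => xy; first by rewrite mem_set//= /A/= in_itv.
  by rewrite memNset//= /A/= in_itv/=; apply/negP.
rewrite (@eq_Rintegral _ _ _ _ _ (f' \_ A)); last by move=> y _; exact: E.
rewrite /Rintegral.
rewrite integral_muI; last first.
  apply/measurable_EFinP.
  by apply/(measurable_restrict _ mA) => //; apply: measurable_funTS.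
have -> : (\int[mu]_(y in D) ((f' \_ A) y)%:E =
    \int[mu]_(y in (D `&` A)) (f' y)%:E)%E.
  rewrite integral_mkcondr; apply: eq_integral => y _.
  by rewrite !patchE; case: ifP.
have -> : (\int[mu]_(y in (D `&` A)) (f' y)%:E =
    \int[mu]_(y in A0) (f' y)%:E)%E.
  have mE (i : interval R) : measurable_fun [set` i] (EFin \o f').
    by apply/measurable_EFinP; apply: measurable_funTS.
  rewrite /A0 -integral_itv_obnd_cbnd; last exact: mE.
  move: xl; rewrite le_eqVlt => /orP[/eqP xl|xl].
    rewrite /A xl -integral_itv_bndo_bndc; last exact: mE.
    congr (integral _ _ _); apply/seteqP; split => y /=; rewrite /A /= !in_itv/=; first by case.
    by move=> /andP[y0 yl]; rewrite y0 yl (ltW yl).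
  congr (integral _ _ _); apply/seteqP; split => y /=; rewrite /A /= !in_itv/=; first by case.
  by move=> /andP[y0 yx]; rewrite y0 yx (le_lt_trans yx xl).
rewrite (@continuous_FTC2 _ f' f)//.
- by rewrite /= f00 subr0.
- by case: ff' => _ cf'; exact: continuous_subspaceT.
- have cf := C1_der_continuous ff'; split.
  + by move=> y _; case: ff' => /(_ y) h _; exact: ex_derive.
  + by apply: cvg_at_right_filter; exact: cf.
  + by apply: cvg_at_left_filter; exact: cf.
- by move=> y _; rewrite (C1_derE ff').
Qed.

End test_functions.

Section test_pairings.
Context (R : realType) (l : R).
Hypothesis l0 : 0 < l.
Local Notation mu := (@lebesgue_measure R).
Local Notation muI := (@muI R l).
Local Notation D := (`]0, l[%classic : set (measurableTypeR R)).
Local Notation mT := (measurableTypeR R).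
Local Notation cls := (L2cls muI).
Implicit Types (f g : R -> R) (phi psi : R -> R[i]).

(** Its class represents evaluation at [x] as a bounded functional of the derivative, see
    [dot_chi]. *)
Definition chi (x y : R) : R[i] := if 0 < y <= x then 1 else 0.

Lemma measurable_ifitv (a b : R) f : measurable_fun setT (f : mT -> R) ->
  measurable_fun setT ((fun y => if a < y <= b then f y else 0) : mT -> R).
Proof.
move=> mf; pose A : set mT := `]a, b]%classic.
have mA : measurable A by exact: measurable_itv.
rewrite (_ : (fun y => _) = f \_ A).
  by apply/(measurable_restrict _ mA) => //; apply: measurable_funTS.
apply/funext => y; rewrite patchE; case: ifPn => xy; first by rewrite mem_set// /A/= in_itv.
by rewrite memNset// /A/= in_itv/=; apply/negP.
Qed.

Lemma chi_cL2 x : chi x \in cL2 muI.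
Proof.
apply: (bounded_cL2 l0 (M := 1)).
- rewrite (_ : _ \o _ = (fun y => if 0 < y <= x then cst 1 y else 0 : R)).
    by apply: measurable_ifitv.
  by apply/funext => y; rewrite /chi /=; case: ifP.
- rewrite (_ : _ \o _ = cst 0)//.
  by apply/funext => y; rewrite /chi /=; case: ifP.
- by move=> y _; rewrite /chi; case: ifP; rewrite ?normc1 ?normc0.
Qed.

Lemma dot_chi phi x : test_fun l phi -> 0 < x <= l ->
  L2dot (cls (cderiv phi)) (cls (chi x)) = phi x.
Proof.
move=> tphi xl; have [pr pi] := tphi.
rewrite L2dot_cls ?chi_cL2//; last by case: (test_cL2 l0 tphi).
apply/eqP; rewrite eq_complex /=; apply/andP; split; apply/eqP.
  apply: etrans (FTC_muI pr xl); apply: eq_Rintegral => y _.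
  by rewrite /chi; case: ifP => _; rewrite /= ?oppr0 !mulr0 ?mulr1 ?subr0.
apply: etrans (FTC_muI pi xl); apply: eq_Rintegral => y _.
by rewrite /chi; case: ifP => _; rewrite /= ?oppr0 !mulr0 ?mulr1 ?addr0 ?add0r.
Qed.

(** With Cauchy-Schwarz this is the Hölder estimate of exponent 1/2,
    [|phi y - phi x|^2 <= (y - x) |phi'|^2]. *)
Lemma nrm_chiB x y : 0 <= x -> x <= y -> y <= l ->
  nrm (cls (chi y) - cls (chi x) : L2I l) ^+ 2 = y - x.
Proof.
move=> x0 xy yl.
rewrite addrC -scaleN1r -L2cls_lin ?chi_cL2//.
have h : (fun t => -1 * chi x t + chi y t) \in cL2 muI.
  by apply: (cL2_submod_closed muI).2; exact: chi_cL2.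
apply: EFin_inj; rewrite nrm_cls//.
pose A : set mT := `]x, y]%classic.
transitivity (\int[muI]_t (\1_A t : R)%:E)%E.
  apply: eq_integral => t _; rewrite indicE /chi.
  have E0 : (normc (-1 * 0 + 0 : R[i]) ^+ 2) = 0 by rewrite mulr0 addr0 normc0 expr0n.
  have E1 : (normc (-1 * 0 + 1 : R[i]) ^+ 2) = 1 by rewrite mulr0 add0r normc1 expr1n.
  have E2 : (normc (-1 * 1 + 1 : R[i]) ^+ 2) = 0 by rewrite mulr1 addNr normc0 expr0n.
  have [t0|t0] := ltP 0 t; last first.
    rewrite memNset; first by rewrite !andFb E0.
    by rewrite /A /= in_itv/= => /andP[xt _]; have := le_lt_trans x0 xt; rewrite ltNge t0.
  have [tx|tx] := leP t x.
    rewrite (le_trans tx xy) memNset; last by rewrite /A /= in_itv/= ltNge tx.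
    by rewrite andTb E2.
  rewrite andTb; case: ifPn => ty.
    by rewrite mem_set ?E1// /A /= in_itv/= tx.
  by rewrite memNset ?E0// /A /= in_itv/= tx/=; exact/negP.
rewrite integral_indic//; last by exact: measurable_itv.
by rewrite setIT; exact: muI_itvE.
Qed.

Lemma C1c_integral0 f : C1c l f -> \int[muI]_y derive1 f y = 0.
Proof.
move=> fC; have [f' _ [a [b [a0 bl sf]]]] := (C1cP _ _).1 fC.
have fl : f l = 0 by apply: sf; rewrite negb_and -!ltNge bl orbT.
rewrite -fl -(FTC_muI fC); last by rewrite l0 lexx.
have [mf mf'] := C1c_measurable fC.
rewrite /Rintegral; congr fine; apply: ae_eq_integral => //.
- exact/measurable_EFinP.
- by apply/measurable_EFinP; exact: measurable_ifitv.
- by apply: muI_ae => y /andP[y0 yl] _; rewrite y0 (ltW yl).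
Qed.

(** The sum of the two sides is the integral of the derivative of [phi psi], and the real and
    imaginary parts of this product are again in [C1c]. *)
Lemma test_parts phi psi : test_fun l phi -> test_fun l psi ->
  cintegral muI (fun t => phi t * cderiv psi t) =
  - cintegral muI (fun t => cderiv phi t * psi t).
Proof.
move=> tphi tpsi.
have [phi2 dphi2] := test_cL2 l0 tphi; have [psi2 dpsi2] := test_cL2 l0 tpsi.
apply/eqP; rewrite -addr_eq0 -cintegralD; [|exact: cL2_mul_cintegrable..].
case: tphi tpsi => [pr pi] [qr qi].
have [rr rrE] := C1cM pr qr; have [ii iiE] := C1cM pi qi.
have [ri riE] := C1cM pr qi; have [ir irE] := C1cM pi qr.
have [h1 h1E] := C1cB rr ii; have [h2 h2E] := C1cD ri ir.
rewrite eq_complex /= -[X in _ == X](C1c_integral0 h1) -[X in _ && (_ == X)](C1c_integral0 h2).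
apply/andP; split; apply/eqP; apply: eq_Rintegral => t _.
  rewrite h1E rrE iiE /= /cderiv; case: (phi t) (psi t) => [? ?] [? ?] /=; ring.
rewrite h2E riE irE /= /cderiv; case: (phi t) (psi t) => [? ?] [? ?] /=; ring.
Qed.

Lemma testJ phi : test_fun l phi -> test_fun l (fun t => (phi t)^*) /\
  forall t, cderiv (fun t => (phi t)^*) t = (cderiv phi t)^*.
Proof.
move=> [pr pi]; have [ni niE] := C1cZ (-1) pi.
have E1 : Re \o (fun t => (phi t)^*) = Re \o phi by apply/funext => t /=; case: (phi t).
have E2 : Im \o (fun t => (phi t)^*) = (fun t => -1 * (Im \o phi) t).
  by apply/funext => t /=; case: (phi t) => ? ?; rewrite /= mulN1r.
split; first by split; rewrite ?E1 ?E2.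
by move=> t; rewrite /cderiv E1 E2 niE mulN1r.
Qed.

Lemma testZD a phi psi : test_fun l phi -> test_fun l psi ->
  test_fun l (fun t => a * phi t + psi t) /\
  forall t, cderiv (fun t => a * phi t + psi t) t = a * cderiv phi t + cderiv psi t.
Proof.
case: a => a b [pr pi] [qr qi].
have [h1 h1E] := C1cZ a pr; have [h2 h2E] := C1cZ b pi.
have [h3 h3E] := C1cB h1 h2; have [h4 h4E] := C1cD h3 qr.
have [k1 k1E] := C1cZ a pi; have [k2 k2E] := C1cZ b pr.
have [k3 k3E] := C1cD k1 k2; have [k4 k4E] := C1cD k3 qi.
have E1 : Re \o (fun t => (a +i* b) * phi t + psi t) =
    (fun t => a * (Re \o phi) t - b * (Im \o phi) t + (Re \o psi) t).
  by apply/funext => t /=; case: (phi t) (psi t) => [? ?] [? ?].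
have E2 : Im \o (fun t => (a +i* b) * phi t + psi t) =
    (fun t => a * (Im \o phi) t + b * (Re \o phi) t + (Im \o psi) t).
  by apply/funext => t /=; case: (phi t) (psi t) => [? ?] [? ?].
split; first by split; rewrite ?E1 ?E2.
by move=> t; rewrite /cderiv E1 E2 h4E h3E h2E h1E k4E k3E k2E k1E.
Qed.

End test_pairings.

(** * The fundamental lemma of the calculus of variations *)

Section fundamental_lemma.
Context (R : realType) (l : R).
Hypothesis l0 : 0 < l.
Local Notation mu := (@lebesgue_measure R).
Local Notation muI := (@muI R l).
Local Notation D := (`]0, l[%classic : set (measurableTypeR R)).
Local Notation mT := (measurableTypeR R).
Local Notation cls := (L2cls muI).
Implicit Types (f g : R -> R) (phi psi : R -> R[i]).

Lemma bump_pointwise d x : 0 < d -> 0 < x ->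
  bump d n x @[n --> \oo] --> (if x < d then 1 else 0 : R).
Proof.
move=> d0 x0; case: ifPn => xd; first by apply: bump_cvg; rewrite x0.
apply: cvg_near_cst.
have := @cvg_harmonic R; move/cvgrPdist_le => /(_ d d0); apply: filterS => n.
rewrite sub0r normrN /harmonic ger0_norm ?invr_ge0// => nd.
move: xd; rewrite -leNgt le_eqVlt => /orP[/eqP <-|dx].
  by rewrite /bump /sqpos subrr !mulr0 maxxx expr0n/= mul0r.
by apply: bump_supp nd _; rewrite negb_and -!ltNge dx orbT.
Qed.

(** Dominated convergence along the bumps, which are bounded by 1 and tend to the indicator of []0,
    d[]. The result is stated on a half-line of the whole line, the form needed for differentiating
    the primitive. *)
Lemma integral_initial0 (w : R -> R) : measurable_fun setT (w : mT -> R) ->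
  muI.-integrable setT (EFin \o w) ->
  (forall d n, n.+1%:R^-1 <= d -> d < l -> \int[muI]_x (w x * bump d n x) = 0) ->
  forall d, 0 < d < l -> (\int[mu]_(x in `]-oo, d]) ((w \_ D) x)%:E = 0)%E.
Proof.
move=> mw iw H d /andP[d0 dl].
pose f n x := (w x * bump d n x)%:E; pose h x := (w x * (if x < d then 1 else 0))%:E.
have mlt : measurable_fun setT ((fun x => if x < d then 1 else 0) : mT -> R).
  rewrite (_ : (fun x => _) = \1_(`]-oo, d[%classic : set mT)).
    by apply: measurable_indic; exact: measurable_itv.
  apply/funext => x; rewrite indicE; case: ifPn => xd; first by rewrite mem_set//= in_itv.
  by rewrite memNset//= in_itv/=; exact/negP.
have mb n : measurable_fun setT (bump d n : mT -> R).
  have [f' hf'] := bump_C1 d n.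
  by apply: continuous_measurable_fun; exact: C1_der_continuous hf'.
have [|||||_ _ lim] := @dominated_convergence _ _ _ muI setT measurableT f h (EFin \o (fun x => `|w x|)).
- by move=> n; apply/measurable_EFinP; exact: measurable_funM.
- by apply/measurable_EFinP; exact: measurable_funM.
- apply: muI_ae => x /andP[x0 _] _; apply/fine_cvgP; split; first exact: nearW.
  by apply: cvgM; [exact: cvg_cst|exact: bump_pointwise].
- by apply: integrable_abse iw.
- apply: aeW => x n _; rewrite lee_fin normrM ler_piMr// ger0_norm ?bump_ge0//.
  exact: bump_le1.
have {lim} h0 : (\int[muI]_x h x = 0)%E.
  rewrite -(cvg_lim _ lim)//; apply/cvg_lim => //.
  apply: cvg_near_cst; have := @cvg_harmonic R; move/cvgrPdist_le => /(_ d d0); apply: filterS => n.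
  rewrite sub0r normrN /harmonic ger0_norm ?invr_ge0// => nd; have := H d n nd dl.
  rewrite /Rintegral => /eqP; rewrite fine_eq0 ?[in X in X -> _]/f; first by move/eqP.
  apply: integrable_fin_num => //.
  apply: le_integrable iw => //; first by apply/measurable_EFinP; exact: measurable_funM.
  by move=> x _; rewrite /= lee_fin normrM ler_piMr// ger0_norm ?bump_ge0// bump_le1.
have mA : measurable (`]-oo, d] : set mT) by exact: measurable_itv.
have mwE (A : set mT) : measurable A -> measurable_fun A (EFin \o w).
  by move=> mA'; apply/measurable_EFinP; exact: measurable_funTS.
have iE (A B : set mT) : A `&` B = `]0%R, d[%classic ->
    (\int[mu]_(x in A) ((w \_ B) x)%:E = \int[mu]_(x in `]0%R, d[) (w x)%:E)%E.
  move=> AB; rewrite -AB integral_mkcondr; apply: eq_integral => x _.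
  by rewrite !patchE; case: ifP.
rewrite -integral_itv_bndo_bndc; last first.
  apply/measurable_EFinP; apply: measurable_funTS.
  have mD : measurable D by exact: measurable_itv.
  by apply/(measurable_restrict _ mD) => //; exact: measurable_funTS.
rewrite iE; last first.
  apply/seteqP; split => x /=; rewrite !in_itv/=; first by move=> [xd /andP[-> _]].
  by move=> /andP[x0 xd]; rewrite x0 xd (lt_trans xd dl).
rewrite -h0 integral_muI; last by apply/measurable_EFinP; exact: measurable_funM.
rewrite -(iE D `]0%R, d[%classic); last first.
  apply/seteqP; split => x /=; rewrite !in_itv/=; first by move=> [].
  by move=> /andP[x0 xd]; rewrite x0 xd (lt_trans xd dl).
apply: eq_integral => x; rewrite inE/= in_itv/= => /andP[x0 _].
rewrite patchE /h; have [xd|xd] := ltP x d.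
  by rewrite mem_set ?mulr1//= in_itv/= x0.
by rewrite memNset ?mulr0//= in_itv/= x0/= ltNge xd.
Qed.

(** By Lebesgue's differentiation theorem [w] is almost everywhere the derivative of its primitive,
    and the primitive vanishes on []0, l[]. *)
Lemma ae0_of_bumps (w : R -> R) : measurable_fun setT (w : mT -> R) ->
  muI.-integrable setT (EFin \o w) ->
  (forall d n, n.+1%:R^-1 <= d -> d < l -> \int[muI]_x (w x * bump d n x) = 0) ->
  {ae muI, forall x, w x = 0}.
Proof.
move=> mw iw H; have I0 := integral_initial0 mw iw H.
have mD : measurable D by exact: measurable_itv.
have iD : mu.-integrable D (EFin \o w) by apply/integrable_muI => //; exact/measurable_EFinP.
have loc : locally_integrable [set: R] (w \_ D) by exact: integrable_locally.
have iT : mu.-integrable setT (EFin \o (w \_ D)).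
  by rewrite -restrict_EFin; apply/(integrable_mkcond _ mD).
have ii y : mu.-integrable `]-oo, y] (EFin \o (w \_ D)).
  by apply: integrableS iT => //; exact: measurable_itv.
pose F y := \int[mu]_(t in `]-oo, y]) (w \_ D) t.
have dF : {ae mu, forall x, derivable F x 1 /\ derive1 F x = (w \_ D) x} := FTC1Ny ii loc.
apply: muI_aeP.
move: dF; apply: filterS; first exact: (ae_filter_ringOfSetsType mu).
move=> x [_ /= dF] /andP[x0 xl].
have : (w \_ D) x = w x by rewrite patchE mem_set//= in_itv/= x0.
move=> <-; rewrite -dF /derive1.
have F0 y : 0 < y < l -> F y = 0 by move=> yI; rewrite /F /Rintegral I0.
apply/cvg_lim => //; apply: cvg_near_cst; near=> h.
rewrite !F0 ?subrr ?scaler0 ?x0//.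
have : `|h| < Num.min x (l - x).
  by near: h; apply: dnbhs0_lt; rewrite lt_min x0 subr_gt0.
by rewrite lt_min !ltr_norml => /andP[/andP[? ?] /andP[? ?]]; apply/andP; split; lra.
Unshelve. all: end_near. Qed.

Lemma test_bump d n : n.+1%:R^-1 <= d -> d < l -> test_fun l (fun t => (bump d n t)%:C).
Proof.
move=> nd dl; split.
  by rewrite (_ : _ \o _ = bump d n)//; exact: C1c_bump.
by rewrite (_ : _ \o _ = (fun=> 0))//; exact: (C1c0 l0).1.
Qed.

Lemma measurable_indic_cst : (fun=> 1 : R[i]) \in cL2 muI.
Proof. by apply: (bounded_cL2 l0 (M := 1)) => [||x _]; [exact: measurable_cst|exact: measurable_cst|rewrite normc1]. Qed.

Lemma fundamental_lemma (x : L2I l) :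
  (forall phi, test_fun l phi -> cintegral muI (fun t => repr x t * phi t) = 0) -> x = 0.
Proof.
move=> H.
have [mr mi] := cL2_measurable (L2funP (repr x)).
have [ir ii] : cintegrable muI (repr x).
  have := cL2_mul_cintegrable (L2funP (repr x)) measurable_indic_cst.
  by under eq_fun do rewrite mulr1.
have r0 : {ae muI, forall t, Re (repr x t) = 0}.
  apply: ae0_of_bumps => // d n nd dl.
  have := H _ (test_bump nd dl) => /(congr1 Re) /= h.
  rewrite -[RHS]h; apply: eq_Rintegral => t _.
  by case: (repr x t) => ? ?; rewrite /= mulr0 subr0.
have i0 : {ae muI, forall t, Im (repr x t) = 0}.
  apply: ae0_of_bumps => // d n nd dl.
  have := H _ (test_bump nd dl) => /(congr1 Im) /= h.
  rewrite -[RHS]h; apply: eq_Rintegral => t _.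
  by case: (repr x t) => ? ?; rewrite /= mulr0 add0r.
have pi0 : (\pi_(L2 muI) 0)%qT = 0 :> L2 muI.
  by apply: (addrI ((\pi_(L2 muI) 0)%qT : L2 muI)); rewrite -L2_piD !addr0.
rewrite -[x]reprK -pi0; apply/L2_piP; apply: filterS2 r0 i0 => t.
by case: (repr x t) => a b /= -> ->.
Qed.

Lemma dot_test_eq (x y : L2I l) : (forall phi, test_fun l phi ->
  L2dot x (cls phi) = L2dot y (cls phi)) -> x = y.
Proof.
move=> H; have HL := L2dot_hilbert muI.
apply/eqP; rewrite -subr_eq0; apply/eqP; apply: fundamental_lemma => phi tphi.
have [tJ _] := testJ tphi; have [JL _] := test_cL2 l0 tJ.
transitivity (L2dot (x - y) (cls (fun t => (phi t)^*))).
  rewrite L2dot_clsr//; congr (cintegral muI _); apply/funext => t; congr (_ * _).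
  exact: (esym (conjcK (phi t))).
by rewrite (dotBl HL) H// subrr.
Qed.

End fundamental_lemma.

Lemma ler_normcB (R : realType) (z w : R[i]) : `|normc z - normc w| <= normc (z - w).
Proof.
have h (a b : R[i]) : normc a <= normc (a - b) + normc b.
  by rewrite -[a in leLHS](subrK b); exact: Defs.normcD.
have h1 := h z w; have h2 := h w z; rewrite normcB in h2.
by rewrite ler_norml; apply/andP; split; lra.
Qed.

Lemma cvg_sumR (R : realType) (I : Type) (F : set_system I) {FF : Filter F}
    (f : nat -> I -> R) (a : nat -> R) n : (forall k, f k i @[i --> F] --> a k) ->
  \sum_(k < n) f k i @[i --> F] --> \sum_(k < n) a k.
Proof.
move=> fa; elim: n => [|n IH].
  rewrite big_ord0 (_ : (fun i => _) = cst 0); last by apply/funext => i; rewrite big_ord0.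
  exact: cvg_cst.
rewrite (_ : (fun i => _) = (fun i => \sum_(k < n) f k i) \+ f n).
  by rewrite big_ord_recr/=; exact: cvgD IH (fa n).
by apply/funext => i; rewrite big_ord_recr.
Qed.

(** * Weak derivatives, the space [H10] and Ehrling's inequality *)

Section weak_derivative.
Context (R : realType) (l : R).
Hypothesis l0 : 0 < l.
Local Notation mu := (@lebesgue_measure R).
Local Notation muI := (@muI R l).
Local Notation mT := (measurableTypeR R).
Local Notation cls := (fun f : R -> R[i] => (L2cls muI f : L2I l)).
Local Notation dot := (@L2dot _ _ R muI).
Local Notation HL := (L2dot_hilbert muI).
Implicit Types (u v w z : L2I l) (phi psi : R -> R[i]).

(* [W u w]: [u] is in the closure of the test functions for the norm of [H^1]
   and [w] is its derivative. *)
Definition W u w := forall e : R, 0 < e -> exists phi,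
  [/\ test_fun l phi, nrm (cls phi - u) < e & nrm (cls (cderiv phi) - w) < e].

Lemma W_test phi : test_fun l phi -> W (cls phi) (cls (cderiv phi)).
Proof. by move=> tphi e e0; exists phi; split => //; rewrite subrr nrm0. Qed.

Lemma cls_testZD a phi psi : test_fun l phi -> test_fun l psi ->
  cls (fun t => a * phi t + psi t) = a *: cls phi + cls psi /\
  cls (cderiv (fun t => a * phi t + psi t)) = a *: cls (cderiv phi) + cls (cderiv psi).
Proof.
move=> tphi tpsi; have [p1 p2] := test_cL2 l0 tphi; have [q1 q2] := test_cL2 l0 tpsi.
have [_ E] := testZD a tphi tpsi.
rewrite (_ : cderiv _ = (fun t => a * cderiv phi t + cderiv psi t)); last exact/funext.
by split; exact: L2cls_lin.
Qed.

Lemma W_lin a u w v z : W u w -> W v z -> W (a *: u + v) (a *: w + z).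
Proof.
move=> uw vz e e0.
have c0 : 0 < 2 * (normc a + 1) by rewrite mulr_gt0// ltr_wpDl ?Defs.normc_ge0.
have [phi [tphi p1 p2]] := uw (e / (2 * (normc a + 1))) (divr_gt0 e0 c0).
have [psi [tpsi q1 q2]] := vz (e / 2) (divr_gt0 e0 (ltr0n _ 2)).
exists (fun t => a * phi t + psi t).
have [-> ->] := cls_testZD a tphi tpsi.
have key (x y x' y' : L2I l) : nrm (x - x') < e / (2 * (normc a + 1)) ->
    nrm (y - y') < e / 2 -> nrm (a *: x + y - (a *: x' + y')) < e.
  move=> h1 h2; rewrite opprD addrACA -scalerBr.
  apply: le_lt_trans (nrmD _ _) _; rewrite nrmZ (splitr e); apply: ler_ltD => //.
  apply: le_trans (_ : normc a * (e / (2 * (normc a + 1))) <= _).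
    by rewrite ler_wpM2l ?Defs.normc_ge0// ltW.
  rewrite mulrA ler_pdivrMr// -mulrA [e * _]mulrC mulrC.
  have := Defs.normc_ge0 a; nra.
split; [by case: (testZD a tphi tpsi)|exact: key|exact: key].
Qed.

Lemma W_closed u w : (forall e : R, 0 < e -> exists u' w',
  [/\ W u' w', nrm (u' - u) < e & nrm (w' - w) < e]) -> W u w.
Proof.
move=> H e e0; have e2 : 0 < e / 2 by rewrite divr_gt0.
have [u' [w' [uw h1 h2]]] := H _ e2.
have [phi [tphi p1 p2]] := uw _ e2; exists phi; split => //.
  by apply: le_lt_trans (nrm_distD u' _ _) _; rewrite (splitr e) ltrD.
by apply: le_lt_trans (nrm_distD w' _ _) _; rewrite (splitr e) ltrD.
Qed.

Lemma W_seq u w : W u w -> exists phi : nat -> R -> R[i],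
  [/\ forall n, test_fun l (phi n), cls (phi n) @[n --> \oo] --> u &
      cls (cderiv (phi n)) @[n --> \oo] --> w].
Proof.
move=> uw; have h n : exists phi, [/\ test_fun l phi, nrm (cls phi - u) < n.+1%:R^-1 &
    nrm (cls (cderiv phi) - w) < n.+1%:R^-1] by apply: uw; rewrite invr_gt0.
have [phi hphi] := choice h; exists phi; split.
- by move=> n; case: (hphi n).
- apply: (cvg_nrm_le _ (@cvg_harmonic R)).
  by apply: nearW => n; apply: ltW; case: (hphi n).
- apply: (cvg_nrm_le _ (@cvg_harmonic R)).
  by apply: nearW => n; apply: ltW; case: (hphi n).
Qed.

Lemma W_of_seq u w (phi : nat -> R -> R[i]) : (forall n, test_fun l (phi n)) ->
  cls (phi n) @[n --> \oo] --> u -> cls (cderiv (phi n)) @[n --> \oo] --> w -> W u w.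
Proof.
move=> tphi /cvgn_nrmP hu /cvgn_nrmP hw e e0.
have [N hN] := hu e e0; have [M hM] := hw e e0.
by exists (phi (maxn N M)); split => //; [apply: hN|apply: hM]; rewrite ?leq_maxl ?leq_maxr.
Qed.

Lemma weak_derivP u w : weak_deriv u w <->
  forall phi, test_fun l phi -> dot u (cls (cderiv phi)) = - dot w (cls phi).
Proof.
split=> H phi tphi.
  have [tJ EJ] := testJ tphi; have [p1 p2] := test_cL2 l0 tphi.
  rewrite !L2dot_clsr//.
  have := H _ tJ; rewrite (_ : cderiv _ = (fun t => (cderiv phi t)^*)) //; exact/funext.
have [tJ EJ] := testJ tphi; have [p1 p2] := test_cL2 l0 tJ.
have := H _ tJ; rewrite !L2dot_clsr//.
rewrite (_ : cderiv (fun t => (phi t)^*) = (fun t => (cderiv phi t)^*)); last exact/funext.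
rewrite (_ : (fun t => _ * _) = (fun t => repr u t * cderiv phi t)); last first.
  by apply/funext => t; congr (_ * _); exact: conjcK.
rewrite (_ : (fun t => _ * _^*^*) = (fun t => repr w t * phi t))//.
by apply/funext => t; congr (_ * _); exact: conjcK.
Qed.

Lemma weak_deriv_uniq u w w' : weak_deriv u w -> weak_deriv u w' -> w = w'.
Proof.
move=> /weak_derivP h /weak_derivP h'; apply: (dot_test_eq l0) => phi tphi.
by apply: oppr_inj; rewrite -h// h'.
Qed.

Lemma wderivE u w : weak_deriv u w -> wderiv u = w.
Proof.
move=> h; rewrite /wderiv; case: xgetP => [w' _ h'|/(_ w)//].
exact: weak_deriv_uniq h' h.
Qed.

Lemma test_weak phi psi : test_fun l phi -> test_fun l psi ->
  dot (cls phi) (cls (cderiv psi)) = - dot (cls (cderiv phi)) (cls psi).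
Proof.
move=> tphi tpsi; have [p1 p2] := test_cL2 l0 tphi; have [q1 q2] := test_cL2 l0 tpsi.
have [tJ EJ] := testJ tpsi.
rewrite !L2dot_cls//; have := test_parts l0 tphi tJ.
by rewrite (_ : cderiv (fun t => (psi t)^*) = (fun t => (cderiv psi t)^*))//; exact/funext.
Qed.

Lemma dot_cvg_eq (a b : nat -> L2I l) x y x' y' : a n @[n --> \oo] --> x ->
  b n @[n --> \oo] --> y -> (forall n, dot (a n) x' = - dot (b n) y') ->
  dot x x' = - dot y y'.
Proof.
move=> ax bY E; apply/eqP; rewrite -addr_eq0; apply/eqP/eq0_normc.
apply/eqP; rewrite eq_le Defs.normc_ge0 andbT.
have h : (normc (dot (a n) x' - dot x x') + normc (dot (b n) y' - dot y y'))
    @[n --> \oo] --> (0 + 0 : R).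
  by apply: cvgD; [exact: (dot_cvg0 HL x' ax)|exact: (dot_cvg0 HL y' bY)].
rewrite addr0 in h; apply: (cvgr_to_ge h).
apply: nearW => n.
have -> : dot x x' + dot y y' = - (dot (a n) x' - dot x x') - (dot (b n) y' - dot y y').
  by rewrite E; ring.
by rewrite -[normc (dot (a n) x' - _)]normcN -[normc (dot (b n) y' - _)]normcN Defs.normcD.
Qed.

Lemma W_weak u w : W u w -> weak_deriv u w.
Proof.
move=> /W_seq[phi [tphi hu hw]]; apply/weak_derivP => psi tpsi.
by apply: (dot_cvg_eq hu hw) => n; exact: test_weak.
Qed.

(** Integration by parts without boundary terms: the defining identity of the weak derivative passes
    from test functions to their [H^1] limits by continuity of the inner product. This is what turns
    the differential operator into its form. *)
Lemma W_weak_dot v v' w z : W v v' -> weak_deriv w z -> dot w v' = - dot z v.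
Proof.
move=> /W_seq[phi [tphi hv hv']] /weak_derivP H.
rewrite (hdotC HL) [dot z v](hdotC HL) -rmorphN; apply: (congr1 (@conjc R)).
apply: (dot_cvg_eq hv' hv) => n.
by rewrite [LHS](hdotC HL) H// [in RHS](hdotC HL) rmorphN.
Qed.

Lemma H10P u : @H10 R l u <-> exists w, W u w.
Proof.
split=> [[_ [phi [tphi h1 h2]]]|[w uw]].
  by exists (wderiv u); exact: W_of_seq tphi h1 h2.
have h := W_weak uw; split; first by exists w.
by rewrite (wderivE h); exact: W_seq.
Qed.

(** On a grid of step [l / (n+1)], [phi x] differs from the value at the right end of its cell by at
    most [(l / (n+1))^(1/2) |phi'|], and the grid values are pairings of the derivative with [chi].
    Thus finitely many functionals and a small multiple of the energy control [phi]; this is the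
    quantitative form of the compact embedding of [H10] into [L2]. *)
Lemma ehrling_test n phi : test_fun l phi -> nrm (cls phi) ^+ 2 <=
  2 * l * (\sum_(i < n.+1) normc (dot (cls (cderiv phi)) (cls (chi (l * i.+1%:R / n.+1%:R)))) ^+ 2
    + l / n.+1%:R * nrm (cls (cderiv phi)) ^+ 2).
Proof.
move=> tphi; have [p1 p2] := test_cL2 l0 tphi.
set c := \sum_(i < _) _ + _; have n0 : 0 < (n.+1%:R : R) by [].
have s0 : 0 <= \sum_(i < n.+1) normc (dot (cls (cderiv phi)) (cls (chi (l * i.+1%:R / n.+1%:R)))) ^+ 2.
  by apply: sumr_ge0 => i _; exact: sqr_ge0.
have pw x : 0 < x < l -> normc (phi x) ^+ 2 <= 2 * c.
  (* [i] is the cell containing [x] and [y] below is its right end; it is positive and possibly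
     equal to [l], as [dot_chi] allows. *)
  move=> /andP[x0 xl]; pose i := Num.truncn (n.+1%:R * x / l).
  have r0 : 0 <= n.+1%:R * x / l by rewrite divr_ge0 ?mulr_ge0 ?ltW.
  have /andP[i1 i2] := truncn_itv r0; rewrite -/i in i1 i2.
  have iN : (i < n.+1)%N.
    by rewrite -(ltr_nat R); apply: le_lt_trans i1 _; rewrite ltr_pdivrMr// ltr_pM2l.
  pose y := l * i.+1%:R / n.+1%:R.
  have xy : x <= y.
    by rewrite /y ler_pdivlMr// mulrC [leRHS]mulrC -ler_pdivrMr// ltW.
  have yl : y <= l.
    by rewrite /y ler_pdivrMr// ler_pM2l// ler_nat.
  have yx : y - x <= l / n.+1%:R.
    have -> : y = l * i%:R / n.+1%:R + l / n.+1%:R.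
      by rewrite /y -[i.+1]addn1 natrD mulrDr mulr1 mulrDl.
    rewrite addrAC gerDr subr_le0 ler_pdivrMr// mulrC [leRHS]mulrC.
    by rewrite -ler_pdivlMr.
  have y0 : 0 < y by exact: lt_le_trans xy.
  have E : phi x - phi y = - dot (cls (cderiv phi)) (cls (chi y) - cls (chi x)).
    by rewrite (dotBr HL) !(dot_chi l0 tphi) ?x0 ?y0 ?(ltW xl)//; ring.
  have b1 : normc (phi x - phi y) ^+ 2 <= l / n.+1%:R * nrm (cls (cderiv phi)) ^+ 2.
    rewrite E normcN; apply: le_trans (_ : (nrm (cls (cderiv phi)) * nrm (cls (chi y) - cls (chi x))) ^+ 2 <= _).
      by rewrite ler_pXn2r ?nnegrE ?mulr_ge0 ?nrm_ge0 ?Defs.normc_ge0//; exact: (CauchySchwarz HL).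
    by rewrite exprMn (nrm_chiB l0) ?(ltW x0)// mulrC ler_wpM2r ?sqr_ge0.
  have b2 : normc (phi y) ^+ 2 <= \sum_(i < n.+1) normc (dot (cls (cderiv phi)) (cls (chi (l * i.+1%:R / n.+1%:R)))) ^+ 2.
    rewrite (bigD1 (Ordinal iN))// (dot_chi l0 tphi) ?y0//.
    by rewrite lerDl; apply: sumr_ge0 => j _; exact: sqr_ge0.
  have b3 : normc (phi x) <= normc (phi x - phi y) + normc (phi y).
    by rewrite -[phi x in leLHS](subrK (phi y)); exact: Defs.normcD.
  apply: le_trans (_ : (normc (phi x - phi y) + normc (phi y)) ^+ 2 <= _).
    by rewrite ler_pXn2r ?nnegrE ?addr_ge0 ?Defs.normc_ge0.
  (* This is [(Z + Y)^2 <= 2 (Z^2 + Y^2)], the origin of the factor 2 in the bound. *)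
  have := sqr_ge0 (normc (phi x - phi y) - normc (phi y)).
  rewrite sqrrB sqrrD /c; move: b1 b2.
  move: (l / _ * _) (\sum_(_ < _) _) (normc (phi x - phi y)) (normc (phi y)) => A B Z Y b1 b2.
  by rewrite !mulr2n; lra.
rewrite -lee_fin nrm_cls//.
rewrite integral_muI; last first.
  by apply/measurable_EFinP; case: (cL2_measurable p1); exact: measurable_sqr_normc.
pose D := (`]0, l[%classic : set mT).
apply: le_trans (_ : (\int[mu]_(x in D) (cst (2 * c)%:E x))%E <= _)%E.
  apply: ge0_le_integral => //.
  - by move=> x _; rewrite lee_fin sqr_ge0.
  - apply/measurable_EFinP; apply: measurable_funTS.
    by case: (cL2_measurable p1); exact: measurable_sqr_normc.
rewrite /D integral_cst//= lebesgue_measure_itv/= lte_fin l0 -EFinB -EFinM lee_fin subr0.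
by rewrite mulrAC.
Qed.

Lemma ehrling n u w : W u w -> nrm u ^+ 2 <=
  2 * l * (\sum_(i < n.+1) normc (dot w (cls (chi (l * i.+1%:R / n.+1%:R)))) ^+ 2
    + l / n.+1%:R * nrm w ^+ 2).
Proof.
move=> /W_seq[phi [tphi hu hw]].
have sq (f : nat -> R) (a : R) : f k @[k --> \oo] --> a -> f k ^+ 2 @[k --> \oo] --> a ^+ 2.
  by move=> fa; rewrite expr2; apply: cvgM.
have dc (x : L2I l) : normc (dot (cls (cderiv (phi k))) x) @[k --> \oo] --> normc (dot w x).
  apply/cvgrPdist_lt => e e0; 
  have hd : normc (dot (cls (cderiv (phi k))) x - dot w x) @[k --> \oo] --> (0 : R).
    exact: (dot_cvg0 HL x hw).
  have /cvgrPdist_lt/(_ e e0) := hd; apply: filterS => k; rewrite sub0r normrN => h; apply: le_lt_trans (ler_normcB _ _) _.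
  by rewrite normcB; exact: le_lt_trans (ler_norm _) h.
apply: (ler_cvg_to (sq _ _ (nrm_cvg hu)) (_ : _ --> _) (nearW _ (fun k => ehrling_test n (tphi k)))).
apply: cvgM; first exact: cvg_cst.
apply: cvgD; last by apply: cvgM; [exact: cvg_cst|exact: sq (nrm_cvg hw)].
apply: (@cvg_sumR _ _ _ _ (fun i k => normc (dot (cls (cderiv (phi k))) (cls (chi (l * i.+1%:R / n.+1%:R)))) ^+ 2)
  (fun i => normc (dot w (cls (chi (l * i.+1%:R / n.+1%:R)))) ^+ 2)) => i.
by apply: sq; exact: dc.
Qed.

End weak_derivative.

(** A bounded real sequence has a limit along any ultrafilter, by compactness of [[-M, M]]. Working
    with one ultrafilter avoids extracting a new subsequence for each functional in Ehrling's
    inequality. *)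
Lemma ultra_real_cauchy (R : realType) (U : set_system nat) (UU : UltraFilter U)
    (r : nat -> R) (M : R) : (forall n, `|r n| <= M) -> forall e : R, 0 < e ->
  exists2 A, U A & forall m n, A m -> A n -> `|r m - r n| < e.
Proof.
move=> rM e e0.
have PF : ProperFilter U := @ultra_proper _ _ UU.
have [p [_ clp]] : `[- M, M]%classic `&` cluster (r n @[n --> U]) !=set0.
  apply: segment_compact; rewrite /= /nbhs/= ; apply: filterS filterT => n _ /=.
  by rewrite in_itv/= -ler_norml.
pose A := r @^-1` (ball p (e / 2)).
have e2 : 0 < e / 2 by rewrite divr_gt0.
exists A; last first.
  move=> m n; rewrite /A /= /ball /= => h1 h2.
  rewrite (splitr e) -(subrK p (r m)) -addrA; apply: le_lt_trans (ler_normD _ _) _.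
  by rewrite ltrD// distrC.
have [//|UA] := in_ultra_setVsetC A UU.
have FA : U (r @^-1` (r @` (~` A))).
  by apply: filterS UA => n nA; exists n.
by have [x [[n nA <-] h]] := clp _ _ FA (nbhsx_ballx p _ e2).
Qed.

(** * Spectral theorem for a symmetric form with compact energy *)

Section spectral.
Context (R : realType) (X : normedModType R[i]) (dot : X -> X -> R[i]).
Hypothesis HL : hilbert dot.
Context (W : X -> X -> Prop) (al : X -> X) (eps c : R).
Hypotheses (eps0 : 0 < eps) (c0 : 0 <= c).
Hypothesis W_lin : forall a u w v z, W u w -> W v z -> W (a *: u + v) (a *: w + z).
Hypothesis W_closed : forall u w, (forall e : R, 0 < e -> exists u' w',
  [/\ W u' w', nrm (u' - u) < e & nrm (w' - w) < e]) -> W u w.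
Hypothesis W00 : W 0 0.
Hypothesis al_lin : forall a u v, al (a *: u + v) = a *: al u + al v.
Hypothesis al_le : forall u, nrm (al u) <= c * nrm u.
Hypothesis al_sym : forall u v, dot (al u) v = dot u (al v).
(** Ehrling's inequality in abstract form: it is the only compactness that the construction of
    eigenvectors requires. *)
Hypothesis W_compact : forall eta : R, 0 < eta -> exists (n : nat) (h : nat -> X) (C : R),
  0 <= C /\ forall u w, W u w ->
  nrm u ^+ 2 <= C * \sum_(i < n) normc (dot w (h i)) ^+ 2 + eta * nrm w ^+ 2.
Implicit Types (u v w z : X) (k : R).

Lemma WB u w v z : W u w -> W v z -> W (u - v) (w - z).
Proof. by move=> uw vz; rewrite ![_ - _]addrC -![- (_ : X)]scaleN1r; exact: W_lin. Qed.

Lemma WD u w v z : W u w -> W v z -> W (u + v) (w + z).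
Proof. by move=> uw vz; rewrite -[u]scale1r -[w]scale1r; exact: W_lin. Qed.

Lemma WZ a u w : W u w -> W (a *: u) (a *: w).
Proof. by move=> uw; rewrite -[a *: u]addr0 -[a *: w]addr0; exact: W_lin. Qed.

Lemma W_sum (I : Type) (r : seq I) (a : I -> R[i]) (f g : I -> X) :
  (forall i, W (f i) (g i)) -> W (\sum_(i <- r) a i *: f i) (\sum_(i <- r) a i *: g i).
Proof.
move=> fg; elim: r => [|i r IH]; first by rewrite !big_nil.
by rewrite !big_cons; exact: W_lin.
Qed.

Lemma W_limit (u w : nat -> X) x y : (forall n, W (u n) (w n)) ->
  u n @[n --> \oo] --> x -> w n @[n --> \oo] --> y -> W x y.
Proof.
move=> uw /cvgn_nrmP hu /cvgn_nrmP hw; apply: W_closed => e e0.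
have [N hN] := hu e e0; have [M hM] := hw e e0.
exists (u (maxn N M)), (w (maxn N M)).
by split => //; [apply: hN|apply: hM]; rewrite ?leq_maxl ?leq_maxr.
Qed.

(* The form [a - k<.,.>], where [a(u,v) = eps <u',v'> - <al u,v>]. *)
Definition bform k u w v z : R[i] := eps%:C * dot w z - dot (al u) v - k%:C * dot u v.

Definition qform k u w : R := eps * nrm w ^+ 2 - Re (dot (al u) u) - k * nrm u ^+ 2.

Lemma bform_linl k a u w u' w' v z :
  bform k (a *: u + u') (a *: w + w') v z = a * bform k u w v z + bform k u' w' v z.
Proof. by rewrite /bform al_lin !(hdotDZl HL); ring. Qed.

Lemma bform_conj k u w v z : bform k v z u w = (bform k u w v z)^*.
Proof.
transitivity (conjc eps%:C * conjc (dot w z) - conjc (dot (al u) v) -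
    conjc k%:C * conjc (dot u v)); last by rewrite /bform !rmorphB !rmorphM.
by rewrite !conjc_real -!(hdotC HL) /bform al_sym.
Qed.

Lemma qformE k u w : bform k u w u w = (qform k u w)%:C.
Proof.
have aR : dot (al u) u = (Re (dot (al u) u))%:C.
  have := al_sym u u; rewrite [RHS](hdotC HL).
  by case: (dot _ _) => a b [/eqP]; rewrite -addr_eq0 -mulr2n mulrn_eq0/= => /eqP ->.
by rewrite /bform !(hdotxx HL) aR /qform !rmorphB !rmorphM.
Qed.

Lemma bform_linr k a u w v z v' z' :
  bform k u w (a *: v + v') (a *: z + z') = a^* * bform k u w v z + bform k u w v' z'.
Proof.
rewrite bform_conj bform_linl [bform k u w v z]bform_conj [bform k u w v' z']bform_conj.
by rewrite rmorphD rmorphM.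
Qed.

Lemma qform_lin k a u w v z : qform k (a *: u + v) (a *: w + z) =
  normc a ^+ 2 * qform k u w + Re (a * bform k u w v z) *+ 2 + qform k v z.
Proof.
apply: complexI; rewrite -qformE bform_linl !bform_linr !qformE.
rewrite [bform k v z u w]bform_conj; set x := bform k u w v z.
move: (qform k u w) (qform k v z) => q1 q2.
rewrite mulr2n !realcD realcM.
rewrite -mulconj ReJ_add (_ : conjc (a * x) = conjc a * conjc x); last by rewrite rmorphM.
by field.
Qed.

Lemma qformZ k a u w : qform k (a *: u) (a *: w) = normc a ^+ 2 * qform k u w.
Proof. by rewrite -[a *: u]addr0 -[a *: w]addr0 qform_lin /bform /qform !(dot0r HL) !nrm0 !mulr0 !subrr !mulr0 mul0rn !addr0 expr0n/= !mulr0 !subr0 addr0. Qed.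

Lemma Re_al_le u : `|Re (dot (al u) u)| <= c * nrm u ^+ 2.
Proof.
apply: le_trans (normc_Re _) _; apply: le_trans (CauchySchwarz HL _ _) _.
by rewrite expr2 mulrA ler_wpM2r ?nrm_ge0.
Qed.

Lemma qform_lower u w : - c * nrm u ^+ 2 <= qform 0 u w.
Proof.
rewrite /qform mul0r subr0; have := Re_al_le u; rewrite ler_norml => /andP[_ h].
have : 0 <= eps * nrm w ^+ 2 by rewrite mulr_ge0 ?sqr_ge0// ltW.
by rewrite mulNr; lra.
Qed.

Lemma nrm_deriv_le u w : eps * nrm w ^+ 2 <= qform 0 u w + c * nrm u ^+ 2.
Proof. by rewrite /qform mul0r subr0; have := Re_al_le u; rewrite ler_norml => /andP[_ h]; lra. Qed.

(** The functionals [dot (w n) (h i)] are bounded, so each is nearly constant on a set of the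
    ultrafilter; intersecting finitely many such sets and applying [W_compact] to differences makes
    [u] nearly constant too. *)
Lemma W_ultra_cauchy (U : set_system nat) (UU : UltraFilter U) (u w : nat -> X) (M : R) :
  (forall n, W (u n) (w n)) -> (forall n, nrm (w n) <= M) ->
  forall e : R, 0 < e -> exists2 A, U A & forall m n, A m -> A n -> nrm (u m - u n) < e.
Proof.
move=> uw wM e e0.
have M0 : 0 <= M := le_trans (nrm_ge0 _) (wM 0%N).
have M1 : 0 < (M + M + 1) ^+ 2 by rewrite exprn_gt0//; lra.
(* Differences of the [w n] have norm at most [M + M], so the energy term costs at most half of
   [e ^+ 2]; the [+ 1] keeps the denominator positive. *)
pose eta := e ^+ 2 / 2 / (M + M + 1) ^+ 2.
have eta0 : 0 < eta by rewrite !divr_gt0// exprn_gt0.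
have [n [h [C [C0 HC]]]] := W_compact eta0.
(* The real and imaginary parts vary by less than [d] each, hence the functionals by less than
   [2 d]; [d <= 1] gives [d ^+ 2 <= d], and the second bound makes [C n (2 d)^2] smaller than half
   of [e ^+ 2]. *)
pose d := Num.min 1 (e ^+ 2 / 2 / ((C + 1) * (4 * n.+1%:R))).
have d0 : 0 < d.
  rewrite lt_min ltr01/= !divr_gt0 ?exprn_gt0// mulr_gt0 ?ltr_wpDl//.
have hj j : exists2 A, U A & forall p q, A p -> A q -> normc (dot (w p - w q) (h j)) < 2 * d.
  have b n' : normc (dot (w n') (h j)) <= M * nrm (h j).
    by apply: le_trans (CauchySchwarz HL _ _) _; rewrite ler_wpM2r ?nrm_ge0.
  have [A1 UA1 h1] := ultra_real_cauchy UU (fun n' => le_trans (normc_Re _) (b n')) d0.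
  have [A2 UA2 h2] := ultra_real_cauchy UU (fun n' => le_trans (normc_Im _) (b n')) d0.
  exists (A1 `&` A2); first exact: filterI.
  move=> p q [p1 p2] [q1 q2]; rewrite (dotBl HL).
  apply: le_lt_trans (normc_le_ReIm _) _.
  have -> : 2 * d = d + d by ring.
  have := h1 p q p1 q1; have := h2 p q p2 q2.
  by case: (dot _ _) (dot _ _) => [? ?] [? ?] /= ? ?; exact: ltrD.
have [A UA hA] : exists2 A, U A & forall j, (j < n)%N -> forall p q, A p -> A q ->
    normc (dot (w p - w q) (h j)) < 2 * d.
  elim: (n) => [|N [A UA IH]]; first by exists setT; [exact: filterT|].
  have [B UB hB] := hj N; exists (A `&` B); first exact: filterI.
  move=> j; rewrite ltnS leq_eqVlt => /orP[/eqP -> p q [_ ?] [_ ?]|jN p q [? _] [? _]].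
    exact: hB.
  exact: IH.
exists A => // p q Ap Aq.
rewrite -(@ltr_pXn2r _ 2)// ?nnegrE ?nrm_ge0 ?(ltW e0)//.
apply: le_lt_trans (HC _ _ (WB (uw p) (uw q))) _.
rewrite [ltRHS]splitr; apply: ltr_leD.
  apply: le_lt_trans (_ : C * \sum_(i < n) (2 * d) ^+ 2 < _).
    rewrite ler_wpM2l//; apply: ler_sum => i _.
    by rewrite ler_pXn2r ?nnegrE ?Defs.normc_ge0 ?mulr_ge0 ?(ltW d0)// ltW// hA.
  rewrite sumr_const card_ord -[_ *+ n]mulr_natr.
  have d1 : d <= 1 by rewrite ge_min lexx.
  have d2 : d * ((C + 1) * (4 * n.+1%:R)) <= e ^+ 2 / 2.
    by rewrite -ler_pdivlMr ?mulr_gt0 ?ltr_wpDl// ge_min lexx orbT.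
  apply: (lt_le_trans _ d2); rewrite -[n.+1%:R]natr1.
  have n0 : 0 <= (n%:R : R) by [].
  have dd : d ^+ 2 <= d by rewrite expr2 ler_piMr// ltW.
  have h1 : C * ((2 * d) ^+ 2 * n%:R) <= C * (4 * d * n%:R).
    by rewrite ler_wpM2l// ler_wpM2r// exprMn; nra.
  apply: le_lt_trans h1 _.
  have -> : d * ((C + 1) * (4 * (n%:R + 1))) = C * (4 * d * n%:R) + 4 * d * (C + n%:R + 1) by ring.
  by rewrite ltrDl mulr_gt0 ?mulr_gt0// ltr_wpDl// addr_ge0.
rewrite /eta mulrAC ler_pdivrMr// ler_wpM2l ?divr_ge0 ?sqr_ge0//.
rewrite ler_pXn2r ?nnegrE ?nrm_ge0//; last by lra.
by apply: le_trans (nrmD _ _) _; rewrite nrmN; have := wM p; have := wM q; lra.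
Qed.


(** Diagonal extraction: [p k] is taken in the intersection of the first [k + 1] sets of the
    ultrafilter on which [u] oscillates by less than [1/(j+1)], and at least [k]. *)
Lemma W_subseq_cauchy (u w : nat -> X) (M : R) :
  (forall n, W (u n) (w n)) -> (forall n, nrm (w n) <= M) ->
  exists2 p : nat -> nat, (forall j, (j <= p j)%N) & cauchy_nrm (fun j => u (p j)).
Proof.
move=> uw wM; have [U [UU evU]] := @ultraFilterLemma nat \oo _.
have PF : ProperFilter U := @ultra_proper _ _ UU.
have h j : exists A, U A /\ forall m n, A m -> A n -> nrm (u m - u n) < j.+1%:R^-1.
  have j0 : 0 < (j.+1%:R^-1 : R) by rewrite invr_gt0.
  by have [A ? ?] := W_ultra_cauchy UU uw wM j0; exists A.
have [A hA] := choice h.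
have UB (k : nat) : U [set n | forall j, (j <= k)%N -> A j n].
  elim: k => [|k IH]; first by apply: filterS (hA 0%N).1 => n An j; rewrite leqn0 => /eqP ->.
  apply: filterS2 IH (hA k.+1).1 => n hn An j; rewrite leq_eqVlt => /orP[/eqP -> //|].
  exact: hn.
have hp (k : nat) : exists n, (k <= n)%N /\ forall j, (j <= k)%N -> A j n.
  have Uk : U [set n | (k <= n)%N] by apply: evU; exists k.
  have UI : U ([set n | (k <= n)%N] `&` [set n | forall j, (j <= k)%N -> A j n]).
    exact: filterI.
  by have [n [? ?]] := filter_ex UI; exists n.
have [p hp'] := choice hp; exists p; first by move=> k; case: (hp' k).
move=> e e0; have /cvgrPdist_lt/(_ e e0)[N _ /(_ N (leqnn N))] := @cvg_harmonic R.
rewrite sub0r normrN /harmonic ger0_norm ?invr_ge0// => Ne.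
exists N => m n Nm Nn; apply: lt_trans Ne.
by apply: (hA N).2; apply: (hp' _).2.
Qed.

Lemma qform_cvg k (u w : nat -> X) x y : u n @[n --> \oo] --> x -> w n @[n --> \oo] --> y ->
  qform k (u n) (w n) @[n --> \oo] --> qform k x y.
Proof.
move=> ux wy.
have sq (f : nat -> X) (a : X) : f j @[j --> \oo] --> a -> nrm (f j) ^+ 2 @[j --> \oo] --> nrm a ^+ 2.
  by move=> /nrm_cvg fa; rewrite expr2; apply: cvgM.
apply: cvgB; last by apply: cvgM; [exact: cvg_cst|exact: sq].
apply: cvgB; first by apply: cvgM; [exact: cvg_cst|exact: sq].
have d0 : nrm (u n - x) * (c * nrm (u n) + c * nrm x) @[n --> \oo] --> (0 : R).
  rewrite -(mul0r (c * nrm x + c * nrm x)); apply: cvgM; first exact/cvg_nrm0.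
  apply: cvgD; last exact: cvg_cst.
  by apply: cvgM; [exact: cvg_cst|exact: nrm_cvg].
apply/cvgrPdist_lt => e e0; have /cvgrPdist_lt/(_ e e0) := d0.
apply: filterS => n; rewrite sub0r normrN => h; apply: le_lt_trans (le_lt_trans (ler_norm _) h).
rewrite distrC -ReN -ReD; apply: le_trans (normc_Re _) _.
have -> : dot (al (u n)) (u n) - dot (al x) x = dot (u n - x) (al (u n)) + dot (al x) (u n - x).
  by rewrite (dotBl HL) (dotBr HL) -!al_sym; ring.
apply: le_trans (Defs.normcD _ _) _; rewrite mulrDr; apply: lerD.
  by apply: le_trans (CauchySchwarz HL _ _) _; rewrite ler_wpM2l ?nrm_ge0.
by apply: le_trans (CauchySchwarz HL _ _) _; rewrite mulrC ler_wpM2l ?nrm_ge0.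
Qed.

(** A weak eigenvector of the form, so that the operator has the eigenvalue [- k]. The vector may be
    0, with any [k], in accordance with [orthosys]. *)
Definition eigv u w k := W u w /\ forall v z, W v z -> bform k u w v z = 0.

Lemma eigv0 k : eigv 0 0 k.
Proof.
split => // v z _; rewrite /bform.
have -> : al 0 = 0 by apply: nrm_le0; have := al_le 0; rewrite nrm0 mulr0.
by rewrite !(dot0l HL) !mulr0 !subr0.
Qed.

Section next_eigenvector.
Context (e : nat -> X) (N : nat).
Hypothesis He : orthosys dot e.
Hypothesis eigE : forall i, exists w k, eigv (e i) w k.
Hypothesis e0 : forall i, (N <= i)%N -> e i = 0.

Definition perp u := forall i, dot u (e i) = 0.

Lemma perp_lin a u v : perp u -> perp v -> perp (a *: u + v).
Proof. by move=> pu pv i; rewrite (hdotDZl HL) pu pv mulr0 addr0. Qed.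

(** [f] is the projection onto the eigenvectors found so far. Being a combination of eigenvectors,
    it stays in [W] and is orthogonal to [perp] for the form as well as for the inner product. *)
Lemma W_perp_part v z : W v z -> exists z' f, [/\ W f z', perp (v - f) &
  forall k u w, W u w -> perp u -> bform k u w f z' = 0].
Proof.
move=> vz; have [g hg] := choice eigE.
pose a i := dot v (e i).
pose z' := \sum_(i < N) a i *: g i; exists z', (fsum dot e N v); split.
- by apply: W_sum => i; have [k []] := hg i.
- move=> i; rewrite (dotBl HL) (dot_fsum HL He); case: ltnP => [_|/e0 ->]; first by rewrite subrr.
  by rewrite subr0 (dot0r HL).
- move=> k u w uw pu; rewrite bform_conj.
  have -> : bform k (fsum dot e N v) z' u w = \sum_(i < N) a i * bform k (e i) (g i) u w.
    rewrite /fsum /csum /z'; elim: (N) => [|n IH].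
      by rewrite !big_ord0; have [_ h] := eigv0 k; rewrite h.
    by rewrite !big_ord_recr/= addrC [X in bform _ _ X _ _]addrC bform_linl IH addrC.
  rewrite big1 ?conjc0// => i _; have [k' [_ h]] := hg i.
  have := h _ _ uw; rewrite /bform [dot (e i) u](hdotC HL) pu conjc0 !mulr0 !subr0 => ->.
  by rewrite mulr0.
Qed.

(** A form that is nonnegative on [perp] and vanishes at [u] satisfies Cauchy-Schwarz, so [u] is in
    its kernel; test vectors outside [perp] are reduced to it by [W_perp_part]. *)
Lemma minimizer_eigv u w k : W u w -> perp u -> qform k u w = 0 ->
  (forall v z, W v z -> perp v -> 0 <= qform k v z) -> eigv u w k.
Proof.
move=> uw pu q0 qp; split => // v z vz.
have [z' [f [fz' pf orth]]] := W_perp_part vz.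
have -> : bform k u w v z = bform k u w (v - f) (z - z').
  have E := bform_linr k 1 u w (v - f) (z - z') f z'.
  by rewrite !scale1r !subrK rmorph1 mul1r in E; rewrite E orth// addr0.
have vf := WB vz fz'; move: (v - f) (z - z') pf vf => {}v {}z pv {}vz.
apply: eq0_normc; apply/eqP; rewrite -sqrf_eq0 eq_le sqr_ge0 andbT.
rewrite -(mul0r (qform k v z)) -normcJ -bform_conj.
apply: psd_discriminant; first exact: qp.
move=> a; rewrite add0r.
have := qp _ _ (W_lin a vz uw) (perp_lin a pv pu).
by rewrite qform_lin q0 addr0 addrC.
Qed.

(** [k] is the infimum of the form on unit vectors of [perp]. A minimising sequence has bounded
    energy, hence a Cauchy subsequence in [X]; the parallelogram identity upgrades this to
    convergence in energy, and the limit is a minimiser. *)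
Lemma next_eigenvector : exists u w k, [/\ eigv u w k, perp u, u = 0 \/ dot u u = 1,
  forall v z, W v z -> perp v -> 0 <= qform k v z & u = 0 -> N%:R <= k].
Proof.
have [triv|/existsNP[u0 /existsNP[w0 /not_implyP[uw0 /not_implyP[pu0 nz0]]]]] :=
  pselect (forall u w, W u w -> perp u -> u = 0).
  (* When nothing is left the system is padded with 0, and the value [N] is recorded so that the
     sequence [k] still tends to infinity. *)
  exists 0, 0, N%:R; split.
  - exact: eigv0.
  - by move=> i; rewrite (dot0l HL).
  - by left.
  - move=> v z vz pv; rewrite (triv v z vz pv) /qform nrm0 (dot0r HL) expr0n/= mulr0 !subr0.
    by rewrite mulr_ge0 ?sqr_ge0// ltW.
  - by [].
pose E := [set r | exists u w, [/\ W u w, perp u, nrm u = 1 & r = qform 0 u w]].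
have unit u w : W u w -> perp u -> u != 0 -> exists a : R, [/\ 0 < a, a = nrm u,
    W (a^-1%:C *: u) (a^-1%:C *: w), perp (a^-1%:C *: u) & nrm (a^-1%:C *: u) = 1].
  move=> uw pu un; have a0 : 0 < nrm u.
    rewrite lt_neqAle nrm_ge0 andbT eq_sym; apply: contra un => /eqP h.
    by apply/eqP; exact: nrm_eq0.
  exists (nrm u); split => //; first exact: WZ.
    by move=> i; rewrite (dotZl HL) pu mulr0.
  by rewrite nrmZ normcR ger0_norm ?invr_ge0 ?(ltW a0)// mulVf// gt_eqF.
have En0 : E !=set0.
  have [|a [_ _ h1 h2 h3]] := unit _ _ uw0 pu0; first exact/eqP.
  by exists (qform 0 (a^-1%:C *: u0) (a^-1%:C *: w0)), (a^-1%:C *: u0), (a^-1%:C *: w0).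
have Elb : has_lbound E.
  exists (- c) => _ [u [w [uw _ u1 ->]]]; have := qform_lower u w.
  by rewrite u1 expr1n mulr1.
pose k := inf E.
have Einf : has_inf E by [].
have qk v z : W v z -> perp v -> 0 <= qform k v z.
  move=> vz pv; have [->|vn] := eqVneq v 0.
    by rewrite /qform nrm0 (dot0r HL) expr0n/= mulr0 !subr0 mulr_ge0 ?sqr_ge0// ltW.
  have [a [a0 aE h1 h2 h3]] := unit _ _ vz pv vn.
  have : k <= qform 0 (a^-1%:C *: v) (a^-1%:C *: z).
    by apply: ge_inf => //; exists (a^-1%:C *: v), (a^-1%:C *: z).
  rewrite qformZ normcR gtr0_norm ?invr_gt0// exprVn; have qq : qform k v z = qform 0 v z - k * a ^+ 2.
    by rewrite /qform mul0r subr0 aE.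
  by rewrite qq subr_ge0 mulrC ler_pdivlMr// exprn_gt0.
have seqE n : exists uw : X * X, [/\ W uw.1 uw.2, perp uw.1, nrm uw.1 = 1 &
    qform 0 uw.1 uw.2 < k + n.+1%:R^-1].
  have n0 : 0 < (n.+1%:R^-1 : R) by rewrite invr_gt0.
  have [_ [u [w [uw pu u1 ->]]] h] := inf_adherent n0 Einf.
  by exists (u, w).
have [s hs] := choice seqE.
pose u n := (s n).1; pose w n := (s n).2.
have uw n : W (u n) (w n) by case: (hs n).
have pu n : perp (u n) by case: (hs n).
have u1 n : nrm (u n) = 1 by case: (hs n).
have un n : qform 0 (u n) (w n) < k + n.+1%:R^-1 by case: (hs n).
have n1 n : (n.+1%:R^-1 : R) <= 1 by rewrite invf_le1// ler1n.
have un1 n : qform 0 (u n) (w n) < k + 1.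
  by apply: lt_le_trans (un n) _; rewrite lerD2l.
pose M2 := (k + 1 + c) / eps.
have M2E n : nrm (w n) ^+ 2 <= M2.
  rewrite /M2 ler_pdivlMr// mulrC; have := nrm_deriv_le (u n) (w n).
  by rewrite u1 expr1n mulr1; have := un1 n; lra.
(* A bound on the square gives this one without a square root, since [x <= x ^+ 2 + 1]. *)
have wM n : nrm (w n) <= M2 + 1.
  by move: (M2E n); move: (nrm _) (M2) => x m; nra.
have [p hp cu] := W_subseq_cauchy uw wM.
have pn n m : (n <= m)%N -> ((p m).+1%:R^-1 : R) <= n.+1%:R^-1.
  move=> nm; rewrite lef_pV2 ?posrE// ler_nat ltnS; exact: leq_trans nm (hp m).
(* The form of the difference equals twice the two nearly minimal values minus the form of the sum,
   which is at least [k |u m + u n|^2]; the parallelogram identity in [X] then cancels the multiples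
   of [k]. *)
have key m n : qform 0 (u m - u n) (w m - w n) <=
    m.+1%:R^-1 *+ 2 + n.+1%:R^-1 *+ 2 + k * nrm (u m - u n) ^+ 2.
  have hB := qform_lin 0 (-1) (u n) (w n) (u m) (w m).
  have hD := qform_lin 0 1 (u n) (w n) (u m) (w m).
  rewrite !scaleN1r ![- (_ : X) + _]addrC normcN normc1 expr1n mulN1r ReN in hB.
  rewrite !scale1r ![u n + _]addrC ![w n + _]addrC normc1 expr1n !mul1r in hD.
  have qd : 0 <= qform 0 (u m + u n) (w m + w n) - k * nrm (u m + u n) ^+ 2.
    have := qk _ _ (WD (uw m) (uw n)) (_ : perp _); rewrite /qform mul0r subr0; apply.
    by move=> i; rewrite (dotDl HL) !pu addr0.
  have pl := parallelogram HL (u m) (u n).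
  rewrite !u1 expr1n in pl.
  move: (un m) (un n) hB hD qd; rewrite pl.
  move: (qform 0 (u m - u n) _) (qform 0 (u m + u n) _) (qform 0 (u m) _) (qform 0 (u n) _).
  move: (Re _) (nrm (u m + u n) ^+ 2) (m.+1%:R^-1 : R) (n.+1%:R^-1 : R).
  move=> b r i1 i2 q1 q2 q3 q4 h1 h2 h3 h4 h5; rewrite !mulr2n in h3 h4 *.
  have -> : k * (1 + 1 + (1 + 1) - r) = 4 * k - k * r by ring.
  by move: h5; move: (k * r) => kr h5; lra.
have [x ux] := hcomplete HL cu.
have pcv : (n.+1%:R^-1 : R) @[n --> \oo] --> (0 : R) := @cvg_harmonic R.
(* By [nrm_deriv_le] the energy of a difference is bounded by its form, small by [key], and by its
   norm in [X], small by the choice of [p]. *)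
have cw : cauchy_nrm (fun j => w (p j)).
  move=> d d0.
  pose K := `|k| + c + 1.
  have K0 : 0 < K by rewrite ltr_wpDl// addr_ge0.
  pose d1 := eps * d ^+ 2 / 8; pose d2 := eps * d ^+ 2 / 2 / K.
  have d10 : 0 < d1 by rewrite divr_gt0// mulr_gt0// exprn_gt0.
  have d20 : 0 < d2 by rewrite !divr_gt0// mulr_gt0// exprn_gt0.
  have [N1 _ HN1] := (cvgrPdist_lt _ _).1 pcv _ d10.
  have s0 : 0 < Num.min 1 d2 by rewrite lt_min ltr01.
  have [N2 HN2] := cu _ s0.
  exists (maxn N1 N2) => m n; rewrite !geq_max => /andP[m1 m2] /andP[nn1 nn2].
  have t1 : (m.+1%:R^-1 : R) < d1.
    by have := HN1 m m1; rewrite /= sub0r normrN ger0_norm ?invr_ge0.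
  have t2 : (n.+1%:R^-1 : R) < d1.
    by have := HN1 n nn1; rewrite /= sub0r normrN ger0_norm ?invr_ge0.
  have := HN2 m n m2 nn2; set r := nrm (u (p m) - u (p n)); rewrite lt_min => /andP[r1 r2].
  have r0 : 0 <= r by exact: nrm_ge0.
  have rr : r ^+ 2 <= r by rewrite expr2 ler_piMr// ltW.
  have kr : (k + c) * r ^+ 2 <= K * r.
    apply: le_trans (_ : (`|k| + c) * r ^+ 2 <= _).
      by rewrite ler_wpM2r ?sqr_ge0// lerD2r ler_norm.
    apply: le_trans (_ : (`|k| + c) * r <= _); first by rewrite ler_wpM2l// addr_ge0.
    by rewrite ler_wpM2r// /K lerDl.
  have Kr : K * r < eps * d ^+ 2 / 2 by rewrite mulrC -ltr_pdivlMr.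
  have := nrm_deriv_le (u (p m) - u (p n)) (w (p m) - w (p n)).
  have := key (p m) (p n); rewrite -/r.
  have := le_lt_trans (pn m m (leqnn m)) t1; have := le_lt_trans (pn n n (leqnn n)) t2.
  move: ((p m).+1%:R^-1 : R) ((p n).+1%:R^-1 : R) (qform 0 _ _) => i1 i2 q h1 h2 h3 h4.
  rewrite -(@ltr_pXn2r _ 2)// ?nnegrE ?nrm_ge0 ?(ltW d0)// -(ltr_pM2l eps0).
  rewrite !mulr2n in h3; rewrite /d1 in h1 h2; rewrite mulrDl in kr.
  apply: le_lt_trans h4 _; lra.
have [y wy] := hcomplete HL cw.
have xy : W x y by apply: W_limit ux wy => n; exact: uw.
have px : perp x by move=> i; apply: (dot_cvgl HL ux); apply: nearW => n; exact: pu.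
have x1 : nrm x = 1.
  apply/eqP; rewrite eq_le; apply/andP; split.
    by apply: (cvgr_to_le (nrm_cvg ux)); apply: nearW => n; rewrite u1.
  by apply: (cvgr_to_ge (nrm_cvg ux)); apply: nearW => n; rewrite u1.
have q0 : qform k x y = 0.
  apply/eqP; rewrite eq_le qk// andbT.
  have qc : qform k (u (p n)) (w (p n)) @[n --> \oo] --> qform k x y.
    exact: (@qform_cvg k (fun j => u (p j)) (fun j => w (p j)) x y ux wy).
  apply: (ler_cvg_to qc pcv); apply: nearW => n.
  have := un (p n); have := pn n n (leqnn n).
  rewrite /qform u1 expr1n mul0r subr0 mulr1.
  move: (n.+1%:R^-1 : R) ((p n).+1%:R^-1 : R) => ? ? ? ?; lra.
exists x, y, k; split => //.
- exact: minimizer_eigv.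
- by right; rewrite (hdotxx HL) x1 expr1n.
- by move=> x0; move: x1; rewrite x0 nrm0 => /eqP; rewrite eq_sym oner_eq0.
Qed.


End next_eigenvector.

Definition perp_upto (e : nat -> X) n u := forall i, (i < n)%N -> dot u (e i) = 0.

(** Iteration of [next_eigenvector]. The minimality of each [k n] on the complement of its
    predecessors is kept because totality rests on it. *)
Lemma eigenbasis : exists (e w : nat -> X) (k : nat -> R), [/\ orthosys dot e,
  forall n, eigv (e n) (w n) (k n),
  forall n v z, W v z -> perp_upto e n v -> 0 <= qform (k n) v z &
  forall n, e n = 0 -> n%:R <= k n].
Proof.
pose good (eN : (nat -> X) * nat) := [/\ orthosys dot eN.1,
  forall i, exists w k, eigv (eN.1 i) w k & forall i, (eN.2 <= i)%N -> eN.1 i = 0].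
pose nextP (eN : (nat -> X) * nat) (t : X * X * R) := [/\ eigv t.1.1 t.1.2 t.2,
  perp eN.1 t.1.1, t.1.1 = 0 \/ dot t.1.1 t.1.1 = 1,
  forall v z, W v z -> perp eN.1 v -> 0 <= qform t.2 v z &
  t.1.1 = 0 -> eN.2%:R <= t.2].
have ex eN : exists t, good eN -> nextP eN t.
  have [g|ng] := pselect (good eN); last by exists (0, 0, 0).
  have [g1 g2 g3] := g; have [u [w [k h]]] := next_eigenvector g1 g2 g3.
  by exists (u, w, k).
have [F hF] := choice ex.
(* [st n] lists the first [n] vectors and is 0 beyond, so that orthogonality to the whole sequence
   [st n] means [perp_upto n]. *)
pose st := fix st n := if n is m.+1 then
  fun i => if i == m then (F (st m, m)).1.1 else st m i else fun=> 0.
pose e n := (F (st n, n)).1.1.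
have stE n i : st n i = if (i < n)%N then e i else 0.
  elim: n => [//|n IH] /=; rewrite ltnS leq_eqVlt.
  by case: eqVneq => [->|_] //; rewrite IH.
have gst n : good (st n, n).
  elim: n => [|n [g1 g2 g3]].
    split => //=; last by move=> i; exists 0, 0; exact: eigv0.
    by split => [i j _|i]; [rewrite (dot0l HL)|left].
  have [h1 h2 h3 _ _] := hF (st n, n) (And3 g1 g2 g3).
  split => /=; last first.
  - by move=> i ni; rewrite gtn_eqF//; apply: g3; exact: ltnW.
  - move=> i; case: eqVneq => _; last exact: g2.
    by exists (F (st n, n)).1.2, (F (st n, n)).2.
  - split => [i j ij|i]; last by case: eqVneq => _ //; exact: (ortho_eq g1).
    have [iE|iN] := eqVneq i n; have [jE|jN] := eqVneq j n.
    + by move: ij; rewrite iE jE eqxx.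
    + exact: h2.
    + by rewrite (hdotC HL) h2 conjc0.
    + exact: (ortho_neq g1).
have hN n := hF _ (gst n).
exists e, (fun n => (F (st n, n)).1.2), (fun n => (F (st n, n)).2); split.
- split => [i j ij|i]; last by case: (hN i).
  wlog ltij : i j ij / (i < j)%N => [hw|].
    case: (ltngtP i j) => [h|h|h]; [exact: hw| |by move: ij; rewrite h eqxx].
    by rewrite (hdotC HL) hw ?conjc0// eq_sym.
  case: (hN j) => _ pj _ _ _; rewrite (hdotC HL).
  by have := pj i; rewrite /= stE ltij => ->; rewrite conjc0.
- by move=> n; case: (hN n).
- move=> n v z vz pv; case: (hN n) => _ _ _ h _; apply: h => // i /=.
  by rewrite stE; case: ifP => [/pv//|_]; rewrite (dot0r HL).
- by move=> n e0; case: (hN n) => _ _ _ _; exact.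
Qed.

Section basis_properties.
Context (e w : nat -> X) (k : nat -> R).
Hypothesis He : orthosys dot e.
Hypothesis eigE : forall n, eigv (e n) (w n) (k n).
Hypothesis minE : forall n v z, W v z -> perp_upto e n v -> 0 <= qform (k n) v z.
Hypothesis zeroE : forall n, e n = 0 -> n%:R <= k n.

Lemma bform0E n v z : W v z -> bform 0 (e n) (w n) v z = (k n)%:C * dot (e n) v.
Proof.
move=> vz; have [_ h] := eigE n; have := h _ _ vz.
by rewrite /bform mul0r subr0 => /eqP; rewrite subr_eq0 => /eqP.
Qed.

(** Otherwise infinitely many unit eigenvectors have bounded energy and compactness gives a Cauchy
    subsequence, whereas orthonormal vectors are at mutual distance [sqrt 2]. *)
Lemma eigenvalues_unbounded (L : R) : exists N, forall n, (N <= n)%N -> L <= k n.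
Proof.
apply: contrapT => /forallNP nex.
have ex j : exists n, (j <= n)%N /\ k n < L.
  by have /existsNP[n /not_implyP[jn /negP]] := nex j; rewrite -ltNge => kL; exists n.
have [K /ltW LK] : exists K : nat, L < K%:R.
  exists (Num.truncn `|L|).+1; apply: le_lt_trans (ler_norm _) _.
  by have /andP[_] := truncn_itv (normr_ge0 L).
(* The shift by [K > L] excludes the padding: a zero vector of index at least [K] would have [k]
   above [L]. *)
have [n hn] := choice (fun j => ex (j + K)%N).
have n1 j : nrm (e (n j)) = 1.
  have [/zeroE h|h] := ortho_eq He (n j).
    have := (hn j).2; rewrite ltNge (le_trans LK)// (le_trans _ h)// ler_nat.
    by apply: leq_trans (hn j).1; rewrite leq_addl.
  have : nrm (e (n j)) ^+ 2 = 1 by apply: complexI; rewrite -(hdotxx HL) h.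
  by move=> /eqP; rewrite sqrf_eq1 => /orP[/eqP //|/eqP h']; have := nrm_ge0 (e (n j)); rewrite h'; lra.
have wb j : nrm (w (n j)) <= (L + c) / eps + 1.
  have := nrm_deriv_le (e (n j)) (w (n j)).
  have -> : qform 0 (e (n j)) (w (n j)) = k (n j).
    apply: complexI; rewrite -qformE bform0E; last by case: (eigE (n j)).
    by rewrite (hdotxx HL) n1 expr1n mulr1.
  rewrite n1 expr1n mulr1 => h; have h2 : nrm (w (n j)) ^+ 2 <= (L + c) / eps.
    by rewrite ler_pdivlMr// mulrC (le_trans h)// lerD2r ltW// (hn j).2.
  by move: h2; move: (nrm _) (_ / _) => x m; nra.
have [p hp cu] := W_subseq_cauchy (fun j => (eigE (n j)).1) wb.
have [N HN] := cu 1 ltr01.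
pose m := maxn N (n (p N)).+1.
have lt : (n (p N) < n (p m))%N.
  apply: leq_trans (leq_trans (leq_addr K _) (hn (p m)).1).
  by apply: leq_trans (hp m); rewrite leq_maxr.
have := HN N m (leqnn _) (leq_maxl _ _); apply/negP; rewrite -leNgt.
rewrite -(@ler_pXn2r _ 2)// ?nnegrE ?nrm_ge0// expr1n.
rewrite (nrm_sqrD HL) nrmN !n1 (dotNr HL) (ortho_neq He) ?ltn_eqF// oppr0 mul0rn addr0 expr1n.
by lra.
Qed.

(** The partial sum and the remainder are orthogonal for the form, so their forms add up to that of
    [v]; the form of the partial sum is at least [- c |v|^2]. *)
Lemma W_fsum_rest n v z : W v z -> exists z',
  W (v - fsum dot e n v) z' /\ qform 0 (v - fsum dot e n v) z' <= qform 0 v z + c * nrm v ^+ 2.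
Proof.
move=> vz; set f := fsum dot e n v.
pose g := \sum_(i < n) dot v (e i) *: w i.
have fg : W f g by apply: W_sum => i; case: (eigE i).
have rg := WB vz fg; exists (z - g); split => //.
have orth : bform 0 f g (v - f) (z - g) = 0.
  have -> : bform 0 f g (v - f) (z - g) =
      \sum_(i < n) dot v (e i) * bform 0 (e i) (w i) (v - f) (z - g).
    rewrite {1}/f /fsum /csum {1}/g; elim: (n) => [|m IH].
      by rewrite !big_ord0; have [_ h] := eigv0 0; rewrite h.
    by rewrite !big_ord_recr/= addrC [X in bform _ _ X _ _]addrC bform_linl IH addrC.
  rewrite big1// => i _; rewrite bform0E// [dot (e i) _](hdotC HL) /f (fsum_orth HL He) ?conjc0 ?mulr0//.
have := qform_lin 0 1 f g (v - f) (z - g).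
rewrite !scale1r mul1r orth mul0rn addr0 normc1 expr1n mul1r.
rewrite [f + _]addrC [g + _]addrC !subrK => ->.
have := qform_lower f g; have := nrm_fsum_le HL He n v; rewrite -/f => h1 h2.
have : c * nrm f ^+ 2 <= c * nrm v ^+ 2 by rewrite ler_wpM2l// ler_pXn2r// nnegrE nrm_ge0.
by move: h2; rewrite mulNr; move: (c * _) (c * _) (qform 0 f g) => a b d; lra.
Qed.

(** The remainder [r] is orthogonal to the first [n] vectors, so minimality gives
    [k n |r|^2 <= qform 0 r], which is bounded uniformly in [n], while [k n] tends to infinity. *)
Lemma W_fsum_cvg v z : W v z -> fsum dot e n v @[n --> \oo] --> v.
Proof.
move=> vz; apply/cvgn_nrmP => d d0.
pose C := qform 0 v z + c * nrm v ^+ 2.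
have [N HN] := eigenvalues_unbounded ((`|C| + 1) / d ^+ 2).
exists N => n Nn; rewrite nrmB.
have [z' [rz' hz']] := W_fsum_rest n vz.
have := minE rz' (_ : perp_upto e n _).
rewrite /qform -/(qform 0 _ _).
have h : perp_upto e n (v - fsum dot e n v) by move=> i ni; exact: (fsum_orth HL He).
move=> /(_ h).
have -> : eps * nrm z' ^+ 2 - Re (dot (al (v - fsum dot e n v)) (v - fsum dot e n v)) =
  qform 0 (v - fsum dot e n v) z' by rewrite /qform mul0r subr0.
rewrite subr_ge0 => h1.
have kn := HN n Nn; have d2 : 0 < d ^+ 2 by rewrite exprn_gt0.
have C1 : 0 < `|C| + 1 by rewrite ltr_wpDl.
rewrite -(@ltr_pXn2r _ 2)// ?nnegrE ?nrm_ge0 ?(ltW d0)//.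
rewrite -(ltr_pM2l (divr_gt0 C1 d2)) divfK ?gt_eqF//.
apply: le_lt_trans (_ : C < _); last by rewrite ltr_pwDr// ler_norm.
apply: le_trans hz'; apply: le_trans h1.
by rewrite ler_wpM2r ?sqr_ge0.
Qed.

Hypothesis W_dense : forall x, (forall v z, W v z -> dot x v = 0) -> x = 0.

(** The Fourier series has some sum [y]; [x - y] is orthogonal to every [e k], hence to all [v] in
    the form domain, which is dense. *)
Lemma eigenbasis_total x : fsum dot e n x @[n --> \oo] --> x.
Proof.
have [y xy yE] := fsum_bounded_cvg HL He x.
suff E : x = y by rewrite [X in _ --> X]E.
apply/eqP; rewrite -subr_eq0; apply/eqP; apply: W_dense => v z vz.
rewrite (hdotC HL) (dot_cvgl HL (W_fsum_cvg vz) (c := 0)) ?conjc0//.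
apply: nearW => n; rewrite (dot_suml HL) big1// => i _.
by rewrite (dotZl HL) [dot (e i) _](hdotC HL) (dotBl HL) yE subrr conjc0 mulr0.
Qed.

(** The graph of the operator associated with the form; the minus sign appears because the form is
    that of [- A]. *)
Definition form_graph u y :=
  exists2 w, W u w & forall v z, W v z -> bform 0 u w v z = - dot y v.

(** Testing against [e i] gives the coordinates. Conversely the Fourier sums of [u] satisfy the
    equation with those of [y] as right-hand side, and it passes to the limit once their derivatives
    converge. The domain is thus described exactly, with no condition other than the existence of
    [y]. *)
Lemma form_graphP u y : form_graph u y <->
  forall i, dot y (e i) = (- k i)%:C * dot u (e i).
Proof.
split=> [[g ug H] i|H].
  have [ew _] := eigE i; have := H _ _ ew.
  rewrite bform_conj bform0E// => /esym/eqP; rewrite eqr_oppLR => /eqP ->.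
  rewrite rmorphN mulNr; congr (- _).
  rewrite [dot u _](hdotC HL) rmorphM; congr (_ * _); exact: conjc_real.
pose g n := \sum_(i < n) dot u (e i) *: w i.
have Wg n : W (fsum dot e n u) (g n) by apply: W_sum => i; case: (eigE i).
have gE n v z : W v z -> bform 0 (fsum dot e n u) (g n) v z = - dot (fsum dot e n y) v.
  move=> vz; rewrite /fsum /csum /g; elim: n => [|n IH].
    by rewrite !big_ord0 (dot0l HL) oppr0; have [_ h] := eigv0 0; rewrite h.
  rewrite !big_ord_recr/= addrC [X in bform _ _ X _ _]addrC bform_linl IH bform0E//.
  by rewrite H (dotDl HL) (dotZl HL) rmorphN/=; ring.
have Su := @eigenbasis_total u; have Sy := @eigenbasis_total y.
(* The form of a difference is [- Re (dot dy du)], with both factors small, so [nrm_deriv_le] bounds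
   the energy of the difference. *)
have cg : cauchy_nrm g.
  move=> d d0; have Q0 : 0 < eps * d ^+ 2 by rewrite mulr_gt0// exprn_gt0.
  pose s := eps * d ^+ 2 / 2 / (c + 1).
  have c1 : 0 < c + 1 by rewrite ltr_wpDl.
  have s0 : 0 < s by rewrite !divr_gt0.
  pose t := Num.min 1 (Num.min s (eps * d ^+ 2 / 2)).
  have t0 : 0 < t / 2 by rewrite divr_gt0// !lt_min ltr01 s0 divr_gt0.
  have [N HN] := (cvgn_nrmP _ _).1 Su _ t0; have [M HM] := (cvgn_nrmP _ _).1 Sy _ t0.
  exists (maxn N M) => m n; rewrite !geq_max => /andP[m1 m2] /andP[n1 n2].
  pose du := fsum dot e m u - fsum dot e n u; pose dy := fsum dot e m y - fsum dot e n y.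
  have hu : nrm du < t.
    apply: le_lt_trans (nrm_distD u _ _) _; rewrite [nrm (u - _)]nrmB [ltRHS]splitr.
    by apply: ltrD; exact: HN.
  have hy : nrm dy < t.
    apply: le_lt_trans (nrm_distD y _ _) _; rewrite [nrm (y - _)]nrmB [ltRHS]splitr.
    by apply: ltrD; exact: HM.
  have Wd := WB (Wg m) (Wg n).
  have q : qform 0 du (g m - g n) <= nrm dy * nrm du.
    have -> : qform 0 du (g m - g n) = - Re (dot dy du).
      apply: complexI; rewrite -qformE -ReN [in RHS](_ : - dot dy du = bform 0 du (g m - g n) du (g m - g n)); first by rewrite qformE ReC.
      have := bform_linl 0 (-1) (fsum dot e n u) (g n) (fsum dot e m u) (g m) du (g m - g n).
      rewrite !scaleN1r ![- (_ : X) + _]addrC => ->.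
      by rewrite !gE// (dotBl HL); ring.
    apply: le_trans (CauchySchwarz HL dy du); apply: le_trans (normc_Re _).
    by rewrite -normrN ler_norm.
  have := nrm_deriv_le du (g m - g n) => h.
  rewrite -(@ltr_pXn2r _ 2)// ?nnegrE ?nrm_ge0 ?(ltW d0)// -(ltr_pM2l eps0).
  apply: le_lt_trans h _; apply: le_lt_trans (lerD q (lexx _)) _.
  move: hu hy; rewrite /t !lt_min => /and3P[hu1 hu2 hu3] /and3P[hy1 hy2 hy3].
  have b0 := nrm_ge0 du; have a0 := nrm_ge0 dy.
  have p1 : nrm dy * nrm du <= nrm dy by rewrite ler_piMr// ltW.
  have p2 : c * nrm du ^+ 2 <= nrm du * (c + 1).
    rewrite mulrC [leRHS]mulrDr mulr1 -[leLHS]addr0 lerD// ler_wpM2r//.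
    by rewrite expr2 ler_piMr// ltW.
  have p3 : nrm du * (c + 1) < eps * d ^+ 2 / 2 by rewrite -ltr_pdivlMr.
  by rewrite [ltRHS]splitr; apply: ltr_leD; [exact: le_lt_trans p1 hy3|exact: le_trans p2 (ltW p3)].
have [x gx] := hcomplete HL cg; exists x; first exact: W_limit Wg Su gx.
move=> v z vz; apply/eqP; rewrite -addr_eq0; apply/eqP/eq0_normc/eqP.
rewrite eq_le Defs.normc_ge0 andbT.
have lim0 (f : nat -> X) a (b : R) : f n @[n --> \oo] --> a ->
    nrm (f n - a) * b @[n --> \oo] --> (0 : R).
  by move=> fa; apply: cvgMr0; apply/cvg_nrm0.
have h : nrm (g n - x) * (eps * nrm z) + nrm (fsum dot e n u - u) * nrm (al v)
    + nrm (fsum dot e n y - y) * nrm v @[n --> \oo] --> (0 + 0 + 0 : R).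
  by apply: cvgD; [apply: cvgD|]; exact: lim0.
rewrite !addr0 in h; apply: (cvgr_to_ge h); apply: nearW => n.
have := gE n v z vz; rewrite /bform !mul0r !subr0 => gEn.
have -> : eps%:C * dot x z - dot (al u) v + dot y v =
   - (eps%:C * dot (g n - x) z) + dot (fsum dot e n u - u) (al v) - dot (fsum dot e n y - y) v.
  rewrite !(dotBl HL) -!al_sym; move: gEn => /eqP; rewrite subr_eq => /eqP.
  by move: (dot (g n) z) => G gEn; rewrite mulrBr gEn; ring.
apply: le_trans (Defs.normcD _ _) _; rewrite normcN; apply: lerD; last exact: CauchySchwarz.
apply: le_trans (Defs.normcD _ _) _; rewrite normcN; apply: lerD; last exact: CauchySchwarz.
rewrite normcM normcR gtr0_norm// mulrCA ler_wpM2l ?(ltW eps0)//; exact: CauchySchwarz.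
Qed.

End basis_properties.
End spectral.

(** * Multiplication operators on [L2] *)

Section multiplication.
Context d (T : measurableType d) (R : realType).
Variable mu : {measure set T -> \bar R}.
Local Notation dot := (@L2dot _ _ R mu).

Lemma Lfun_oo_ae (f : T -> R) : f \in Lfun mu +oo%E ->
  exists2 c : R, 0 <= c & {ae mu, forall t, `|f t| <= c}.
Proof.
move=> /andP[_]; rewrite inE/= /finite_norm unlock; case: ifPn => [_ lf|mu0 _]; last first.
  exists 0 => //; exists setT; split => //.
  by apply/eqP; rewrite eq_le measure_ge0 leNgt mu0.
set s := ess_sup _ _ in lf; exists (Num.max 0 (fine s)); first by rewrite le_max lexx.
apply: filterS (ess_sup_ge mu (abse \o (EFin \o f))) => t; rewrite -/s /=.
by case: s lf => [r _||] //=; rewrite lee_fin le_max => ->; rewrite orbT.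
Qed.

Lemma cLinfty_ae (g : T -> R[i]) : g \in cLinfty mu ->
  exists2 c : R, 0 <= c & {ae mu, forall t, normc (g t) <= c}.
Proof.
move=> /andP[/= /Lfun_oo_ae[c1 c10 h1] /Lfun_oo_ae[c2 c20 h2]].
exists (c1 + c2); first exact: addr_ge0.
by apply: filterS2 h1 h2 => t a b; apply: le_trans (normc_le_ReIm _) _; exact: lerD.
Qed.

Lemma realC_cLinfty (f : T -> R) : f \in Lfun mu +oo%E -> (fun x => (f x)%:C) \in cLinfty mu.
Proof.
move=> fL; apply/andP; split => /=; first by rewrite (_ : _ \o _ = f).
rewrite (_ : _ \o _ = 0)//; exact: (Lfun_submod_closed mu (leey 1)).1.
Qed.

Lemma L2mul_cls (g : T -> R[i]) (x : L2 mu) : L2mul mu g x = L2cls mu (fun t => g t * repr x t).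
Proof. by []. Qed.

Lemma L2mul_lin (g : T -> R[i]) : g \in cLinfty mu -> forall a (x y : L2 mu),
  L2mul mu g (a *: x + y) = a *: L2mul mu g x + L2mul mu g y.
Proof.
move=> gL a x y.
have mL (z : L2 mu) : (fun t => g t * repr z t) \in cL2 mu by apply: cL2_mul => //; exact: L2funP.
rewrite !L2mul_cls -L2cls_lin//.
have hL : (fun t => a * (g t * repr x t) + g t * repr y t) \in cL2 mu.
  by apply: (cL2_submod_closed mu).2.
rewrite (L2clsE (mL _)) (L2clsE hL); apply/L2_piP => /=.
have E : (a *: x + y : L2 mu) = L2cls mu (fun t => a * repr x t + repr y t).
  by rewrite L2cls_lin ?L2funP// !L2cls_repr.
have fL : (fun t => a * repr x t + repr y t) \in cL2 mu.
  by apply: (cL2_submod_closed mu).2; exact: L2funP.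
rewrite E (L2clsE fL); apply: filterS (L2_reprK (MkL2fun fL)) => t -> /=.
by ring.
Qed.

Lemma L2mul_le (g : T -> R[i]) : g \in cLinfty mu ->
  exists2 c : R, 0 <= c & forall x : L2 mu, nrm (L2mul mu g x : L2 mu) <= c * nrm x.
Proof.
move=> gL; have [c c0 gc] := cLinfty_ae gL; exists c => // x.
have mL : (fun t => g t * repr x t) \in cL2 mu by apply: cL2_mul => //; exact: L2funP.
have cL : (fun t => c%:C * repr x t) \in cL2 mu.
  have h := (cL2_submod_closed mu).2 c%:C (repr x) 0 (L2funP _) (L2funP (0 : L2fun mu)).
  by move: h; rewrite (_ : _ *: _ + _ = (fun t => c%:C * repr x t))//; apply/funext => t; rewrite addr0.
have cE : c * nrm x = nrm (L2cls mu (fun t => c%:C * repr x t) : L2 mu).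
  rewrite (_ : L2cls mu (fun t => c%:C * repr x t) = c%:C *: x).
    by rewrite nrmZ normcR ger0_norm.
  rewrite (L2clsE cL) -[RHS]/(\pi_(L2 mu)%qT (c%:C *: repr x)).
  by congr (\pi_(L2 mu)%qT _); apply: val_inj.
rewrite cE -(@ler_pXn2r _ 2)// ?nnegrE ?nrm_ge0// -lee_fin nrm_cls// nrm_cls//.
have [mr mi] := cL2_measurable mL; have [mr' mi'] := cL2_measurable cL.
apply: ae_ge0_le_integral => //.
- by move=> t _; rewrite lee_fin sqr_ge0.
- by apply/measurable_EFinP; exact: measurable_sqr_normc.
- by move=> t _; rewrite lee_fin sqr_ge0.
- by apply/measurable_EFinP; exact: measurable_sqr_normc.
- apply: filterS gc => t gct _; rewrite lee_fin ler_pXn2r ?nnegrE ?Defs.normc_ge0//.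
  by rewrite !normcM normcR ger0_norm// ler_wpM2r ?Defs.normc_ge0.
Qed.

Lemma L2mul_sym (f : T -> R) : f \in Lfun mu +oo%E -> forall x y : L2 mu,
  dot (L2mul mu (fun t => (f t)%:C) x) y = dot x (L2mul mu (fun t => (f t)%:C) y).
Proof.
move=> fL x y; have gL := realC_cLinfty fL.
have mL (z : L2 mu) : (fun t => (f t)%:C * repr z t) \in cL2 mu by apply: cL2_mul => //; exact: L2funP.
rewrite -[y in LHS]L2cls_repr -[x in RHS]L2cls_repr !L2mul_cls !L2dot_cls ?L2funP//.
congr (cintegral mu _); apply/funext => t.
rewrite [X in _ = _ * X](_ : _ = (f t)%:C * (repr y t)^*); first by ring.
by rewrite rmorphM; congr (_ * _); exact: conjc_real.
Qed.

End multiplication.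

(** * Diagonalisation of the Dirichlet operator *)

Section An_spectral.
Context (R : realType) (l eps : R) (alpha : R -> R).
Hypotheses (l0 : 0 < l) (eps0 : 0 < eps).
Hypothesis alphaL : alpha \in Lfun (muI l) +oo%E.
Local Notation muI := (@muI R l).
Local Notation dot := (@L2dot _ _ R muI).
Local Notation HL := (L2dot_hilbert muI).
Local Notation al := (L2mul muI (fun x => (alpha x)%:C) : L2I l -> L2I l).
Local Notation W := (@W R l).

(** One direction is integration by parts. In the other, the form identity on test functions says
    that [w] has the weak derivative [(y - al u) / eps], which is precisely the [H2] regularity of
    [u]. *)
Lemma An_graphP (u y : L2I l) : (dom (An l eps alpha) u /\ An l eps alpha u = y) <->
  form_graph dot W al eps u y.
Proof.
have ec0 : eps%:C != 0 by rewrite eq_complex /= eqxx andbT gt_eqF.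
split=> [[[[H1u [z wz]] /(H10P l0)[w uw]] <-]|[w uw H]].
  have ww := W_weak l0 uw; exists w => // v v' vv'.
  rewrite (wderivE l0 ww) in wz; rewrite /An /= (wderivE l0 ww) (wderivE l0 wz) /bform.
  rewrite (W_weak_dot l0 vv' wz) (dotDl HL) (dotZl HL) mul0r subr0; ring.
have ww := W_weak l0 uw.
have wz : weak_deriv w (eps^-1%:C *: (y - al u)).
  apply/(weak_derivP l0) => phi tphi; have := H _ _ (W_test tphi).
  rewrite /bform mul0r subr0 => /eqP; rewrite subr_eq => /eqP h.
  apply: (mulfI ec0); rewrite h (dotZl HL) (dotBl HL).
  have -> : eps^-1%:C = (eps%:C)^-1 by exact: fmorphV.
  by field.
split; last first.
  rewrite /An /= (wderivE l0 ww) (wderivE l0 wz) scalerA -realcM divff ?gt_eqF// scale1r.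
  by rewrite subrK.
split; first by split; [exists w|rewrite (wderivE l0 ww); exists (eps^-1%:C *: (y - al u))].
by apply/(H10P l0); exists w.
Qed.

(** The last clause determines the graph of the operator by coordinates, domain included, so the
    differential operator is not looked at again afterwards. *)
Lemma An_spectral : exists (e : nat -> L2I l) (lam : nat -> R), [/\ orthosys dot e,
  forall x : L2I l, fsum dot e n x @[n --> \oo] --> x,
  forall L : R, exists N, forall n, (N <= n)%N -> lam n <= L &
  forall u y, (dom (An l eps alpha) u /\ An l eps alpha u = y) <->
    forall i, dot y (e i) = (lam i)%:C * dot u (e i)].
Proof.
have [c c0 al_le] := L2mul_le (realC_cLinfty alphaL).
have al_lin := L2mul_lin (realC_cLinfty alphaL).
have al_sym := L2mul_sym alphaL.
have W00 : W 0 0.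
  have t0 : test_fun l (fun=> 0 : R[i]).
    by split; rewrite (_ : _ \o _ = fun=> 0)//; exact: (C1c0 l0).1.
  have := W_lin l0 (-1) (W_test t0) (W_test t0).
  by rewrite !scaleN1r !addNr.
have W_compact (eta : R) : 0 < eta -> exists (n : nat) (h : nat -> L2I l) (C : R),
  0 <= C /\ forall u w, W u w ->
  nrm u ^+ 2 <= C * \sum_(i < n) normc (dot w (h i)) ^+ 2 + eta * nrm w ^+ 2.
  (* With [n + 1 > r] cells the energy coefficient [2 l * l / (n + 1)] of [ehrling] is at most
     [eta]. *)
  move=> eta0; pose r := 2 * l * l / eta.
  have r0 : 0 <= r by rewrite divr_ge0 ?mulr_ge0// ltW.
  have /andP[_ hn] := truncn_itv r0; set n := Num.truncn r in hn.
  exists n.+1, (fun i => L2cls muI (chi (l * i.+1%:R / n.+1%:R))), (2 * l).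
  split; first by rewrite mulr_ge0// ltW.
  move=> u w uw; apply: le_trans (ehrling l0 n uw) _; rewrite mulrDr lerD2l mulrA.
  rewrite ler_wpM2r ?sqr_ge0// mulrA ler_pdivrMr// -ler_pdivrMl// mulrC.
  exact: ltW.
have W_dense (x : L2I l) : (forall v z, W v z -> dot x v = 0) -> x = 0.
  move=> h; apply: (dot_test_eq l0) => phi tphi.
  by rewrite (h _ _ (W_test tphi)) (dot0l HL).
have [e [w [k [He eigE minE zeroE]]]] := eigenbasis HL eps0 c0 (W_lin l0) (@W_closed R l) W00 al_lin al_le al_sym W_compact.
exists e, (fun n => - k n); split => //.
- move=> x; apply: (eigenbasis_total HL eps0 c0 (W_lin l0) W00 al_lin al_le al_sym W_compact He eigE minE zeroE W_dense).
- move=> L; have [N HN] := eigenvalues_unbounded HL eps0 (W_lin l0) al_le al_sym W_compact He eigE zeroE (- L).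
  by exists N => n /HN; rewrite lerNl.
- move=> u y; rewrite An_graphP.
  exact: (form_graphP HL eps0 c0 (W_lin l0) (@W_closed R l) W00 al_lin al_le al_sym W_compact He eigE minE zeroE W_dense).
Qed.

End An_spectral.

(** * The complex exponential and its Taylor remainders *)

Section complex_exponential.
Context (R : realType).
Implicit Types (a b : R) (z w : R[i]).

Definition cexp z : R[i] := (expR (Re z))%:C * (cos (Im z) +i* sin (Im z)).

Lemma cexpD z w : cexp (z + w) = cexp z * cexp w.
Proof.
case: z w => [a b] [c d]; rewrite /cexp /= expRD cosD sinD.
by apply/eqP; rewrite eq_complex /=; apply/andP; split; apply/eqP; ring.
Qed.

Lemma cexp_real a : cexp a%:C = (expR a)%:C.
Proof. by rewrite /cexp /= cos0 sin0; apply/eqP; rewrite eq_complex /=; apply/andP; split; apply/eqP; ring. Qed.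

Lemma cexp0 : cexp 0 = 1.
Proof. by rewrite -[0]/(0%:C) cexp_real expR0. Qed.

Lemma normc_cexp z : normc (cexp z) = expR (Re z).
Proof.
rewrite normcM normcR ger0_norm ?expR_ge0// [normc (_ +i* _)]/= cos2Dsin2 sqrtr1.
by rewrite mulr1.
Qed.

Lemma sin_abs_le b : `|sin b| <= `|b|.
Proof.
wlog b0 : b / 0 < b => [hw|].
  have [/hw//|b0|<-] := ltgtP 0 b; last by rewrite sin0 normr0.
  by rewrite -normrN -sinN -[leRHS]normrN; apply: hw; rewrite oppr_gt0.
have [|x _] := @MVT R sin cos 0 b b0 (fun x _ => is_derive_sin x).
  by apply: continuous_subspaceT => x; exact: continuous_sin.
rewrite sin0 !subr0 => ->; rewrite normrM ler_piMl//.
by rewrite ler_norml cos_geN1 cos_le1.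
Qed.

Lemma cos_sub1_le b : `|cos b - 1| <= `|b|.
Proof.
wlog b0 : b / 0 < b => [hw|].
  have [/hw//|b0|<-] := ltgtP 0 b; last by rewrite cos0 subrr normr0.
  by rewrite -cosN -[leRHS]normrN; apply: hw; rewrite oppr_gt0.
have [|x _] := @MVT R cos (fun x => - sin x) 0 b b0 (fun x _ => is_derive_cos x).
  by apply: continuous_subspaceT => x; exact: continuous_cos.
rewrite cos0 subr0 => ->; rewrite normrM ler_piMl// normrN.
by rewrite ler_norml sin_geN1 sin_le1.
Qed.

Lemma cos_sub1_sqr_le b : `|cos b - 1| <= b ^+ 2.
Proof.
wlog b0 : b / 0 < b => [hw|].
  have [/hw//|b0|<-] := ltgtP 0 b; last by rewrite cos0 subrr normr0 expr0n.
  by rewrite -cosN -[leRHS]sqrrN; apply: hw; rewrite oppr_gt0.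
have [|x xb] := @MVT R cos (fun x => - sin x) 0 b b0 (fun x _ => is_derive_cos x).
  by apply: continuous_subspaceT => x; exact: continuous_cos.
move: xb; rewrite in_itv/= => /andP[x0 xb].
rewrite cos0 subr0 => ->; rewrite normrM normrN expr2 (gtr0_norm b0) ler_wpM2r ?(ltW b0)//.
by apply: le_trans (sin_abs_le _) _; rewrite gtr0_norm// ltW.
Qed.

Lemma sin_sub_le b : `|sin b - b| <= b ^+ 2.
Proof.
wlog b0 : b / 0 < b => [hw|].
  have [/hw//|b0|<-] := ltgtP 0 b; last by rewrite sin0 subrr normr0 expr0n.
  by rewrite -normrN opprD -sinN -[leRHS]sqrrN; apply: hw; rewrite oppr_gt0.
have [|x xb] := @MVT R sin cos 0 b b0 (fun x _ => is_derive_sin x).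
  by apply: continuous_subspaceT => x; exact: continuous_sin.
move: xb; rewrite in_itv/= => /andP[x0 xb].
rewrite sin0 !subr0 => ->; rewrite -[X in _ * _ - X]mul1r -mulrBl normrM expr2.
rewrite (gtr0_norm b0) ler_wpM2r ?(ltW b0)//.
by apply: le_trans (cos_sub1_le _) _; rewrite gtr0_norm// ltW.
Qed.

Lemma expR_sub1_le a : `|expR a - 1| <= `|a| * expR `|a|.
Proof.
have h1 := expR_ge1Dx a; have h2 := expR_ge1Dx (- a).
have e0 := expR_gt0 a; have E : expR a * expR (- a) = 1 by rewrite -expRD subrr expR0.
have key : expR a - 1 <= a * expR a.
  have : 0 <= expR a * (expR (- a) - (1 + - a)) by rewrite mulr_ge0 ?(ltW e0)// subr_ge0.
  by rewrite mulrBr E mulrDr mulr1 mulrN mulrC; lra.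
have [a0|a0] := leP 0 a.
  by rewrite (ger0_norm a0) ger0_norm//; lra.
rewrite (ltr0_norm a0) ler0_norm; last first.
  by rewrite subr_le0 -expR0 ler_expR ltW.
have e1 : 1 <= expR (- a) by lra.
apply: le_trans (_ : - a <= _); first by lra.
by rewrite ler_peMr// oppr_ge0 ltW.
Qed.

Lemma expR_sub1D_le a : `|expR a - 1 - a| <= a ^+ 2 * expR `|a|.
Proof.
have h1 := expR_ge1Dx a; have h2 := expR_ge1Dx (- a).
have e0 := expR_gt0 a; have E : expR a * expR (- a) = 1 by rewrite -expRD subrr expR0.
rewrite ger0_norm; last by lra.
apply: le_trans (_ : a * (expR a - 1) <= _).
  have : 0 <= expR a * (expR (- a) - (1 + - a)) by rewrite mulr_ge0 ?(ltW e0)// subr_ge0.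
  by rewrite mulrBr E mulrDr mulr1 mulrN mulrBr mulr1 mulrC; lra.
apply: le_trans (ler_norm _) _; rewrite normrM -(real_normK (num_real a)) expr2 -mulrA.
by rewrite ler_wpM2l// expR_sub1_le.
Qed.

(** The constant 4 counts the four remainders into which the difference splits, two in the real part
    and two in the imaginary part, each at most [|z|^2 exp |z|]. *)
Lemma cexp_sub1D_le z : normc (cexp z - 1 - z) <= 4 * normc z ^+ 2 * expR (normc z).
Proof.
set r := normc z; have a1 := normc_Re z; have b1 := normc_Im z; rewrite -/r in a1 b1.
have E (a b : R) : cexp (a +i* b) - 1 - (a +i* b) =
   (expR a - 1 - a)%:C + (expR a * (cos b - 1))%:C + 'i * (expR a * (sin b - b) + (expR a - 1) * b)%:C.
  by apply/eqP; rewrite /cexp eq_complex /=; apply/andP; split; apply/eqP; ring.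
have -> : cexp z - 1 - z = (expR (Re z) - 1 - Re z)%:C + (expR (Re z) * (cos (Im z) - 1))%:C +
    'i * (expR (Re z) * (sin (Im z) - Im z) + (expR (Re z) - 1) * Im z)%:C.
  by rewrite -E; case: (z).
move: (Re z) (Im z) a1 b1 => a b a1 b1.
have r0 : 0 <= r by exact: Defs.normc_ge0.
have er : expR `|a| <= expR r by rewrite ler_expR.
have er' : expR a <= expR r by apply: le_trans er; rewrite ler_expR ler_norm.
have a2 : a ^+ 2 <= r ^+ 2 by rewrite -(real_normK (num_real a)) ler_pXn2r ?nnegrE.
have b2 : b ^+ 2 <= r ^+ 2 by rewrite -(real_normK (num_real b)) ler_pXn2r ?nnegrE.
have E0 := expR_ge0 a; have E1 := expR_ge0 r.
have t1 : `|expR a - 1 - a| <= r ^+ 2 * expR r.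
  by apply: le_trans (expR_sub1D_le a) _; apply: ler_pM; rewrite ?sqr_ge0 ?expR_ge0.
have t2 : `|expR a * (cos b - 1)| <= r ^+ 2 * expR r.
  rewrite normrM (ger0_norm E0) mulrC; apply: ler_pM => //.
  exact: le_trans (cos_sub1_sqr_le b) b2.
have t3 : `|expR a * (sin b - b)| <= r ^+ 2 * expR r.
  rewrite normrM (ger0_norm E0) mulrC; apply: ler_pM => //.
  exact: le_trans (sin_sub_le b) b2.
have t4 : `|(expR a - 1) * b| <= r ^+ 2 * expR r.
  rewrite normrM; apply: le_trans (_ : r * expR r * r <= _); last by rewrite mulrAC expr2.
  apply: ler_pM => //; apply: le_trans (expR_sub1_le a) _.
  by apply: ler_pM; rewrite ?expR_ge0.
apply: le_trans (Defs.normcD _ _) _.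
apply: le_trans (lerD (Defs.normcD _ _) (lexx _)) _.
rewrite normcM !normcR [normc 'i]/= expr0n/= expr1n add0r sqrtr1 mul1r.
have := ler_normD (expR a * (sin b - b)) ((expR a - 1) * b).
rewrite -mulrA; move: t1 t2 t3 t4.
move: (r ^+ 2 * _) `|_ - a| `|_ * (cos _ - _)| `|expR a * (_ - b)| `|(_ - 1) * b| `|_ + _| => *; lra.
Qed.

Lemma cexp_sub1_le z : normc (cexp z - 1) <= normc z + 4 * normc z ^+ 2 * expR (normc z).
Proof.
rewrite -[cexp z - 1](subrK z) addrC; apply: le_trans (Defs.normcD _ _) _.
by rewrite lerD2l cexp_sub1D_le.
Qed.

End complex_exponential.

(** * Bounded operators and their exponentials *)

Definition complete_nrm (R : realType) (X : normedModType R[i]) :=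
  forall u : nat -> X, (forall e : R, 0 < e -> exists N, forall m n,
    (N <= m)%N -> (N <= n)%N -> nrm (u m - u n) < e) ->
  exists x : X, u n @[n --> \oo] --> x.

(** Splits a square of indices into the triangle [i + j < n], summed along antidiagonals, and its
    complement: the bookkeeping of the Cauchy product. *)
Lemma triangle_sum (V : nmodType) (f : nat -> nat -> V) n :
  \sum_(i < n) \sum_(j < n) f i j =
  \sum_(k < n) \sum_(i < k.+1) f i (k - i)%N + \sum_(i < n) \sum_(n - i <= j < n) f i j.
Proof.
have -> : \sum_(i < n) \sum_(j < n) f i j =
    \sum_(i < n) \sum_(j < n - i) f i j + \sum_(i < n) \sum_(n - i <= j < n) f i j.
  rewrite -big_split/=; apply: eq_bigr => i _.
  rewrite -!(big_mkord xpredT (f i)) -big_cat_nat//; exact: leq_subr.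
congr (_ + _); elim: n => [|n IH]; first by rewrite !big_ord0.
rewrite [RHS]big_ord_recr/= -IH.
have -> : \sum_(i < n.+1) \sum_(j < n.+1 - i) f i j =
    \sum_(i < n.+1) (\sum_(j < n - i) f i j + f i (n - i)%N).
  by apply: eq_bigr => i _; rewrite subSn ?leq_ord// big_ord_recr.
rewrite big_split/=; congr (_ + _).
by rewrite big_ord_recr/= subnn big_ord0 addr0.
Qed.

Section bounded_operators.
Context (R : realType) (X : normedModType R[i]).
Implicit Types (x y : X) (M B : X -> X) (c : R) (z w : R[i]).

Record bop M c : Prop := Bop {
  bop_ge0 : 0 <= c;
  bop_lin : forall (a : R[i]) x y, M (a *: x + y) = a *: M x + M y;
  bop_le : forall x, nrm (M x) <= c * nrm x }.

Lemma bopD M c : bop M c -> forall x y, M (x + y) = M x + M y.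
Proof. by move=> h x y; rewrite -[x]scale1r (bop_lin h) !scale1r. Qed.

Lemma bop0 M c : bop M c -> M 0 = 0.
Proof. by move=> h; apply: nrm_le0; rewrite (le_trans (bop_le h 0))// nrm0 mulr0. Qed.

Lemma bopZ M c : bop M c -> forall a x, M (a *: x) = a *: M x.
Proof. by move=> h a x; rewrite -[_ *: _]addr0 (bop_lin h) (bop0 h) addr0. Qed.

Lemma bopN M c : bop M c -> forall x, M (- x) = - M x.
Proof. by move=> h x; rewrite -scaleN1r (bopZ h) scaleN1r. Qed.

Lemma bopB M c : bop M c -> forall x y, M (x - y) = M x - M y.
Proof. by move=> h x y; rewrite (bopD h) (bopN h). Qed.

Lemma bop_sum M c (I : Type) (r : seq I) (P : pred I) (u : I -> X) : bop M c ->
  M (\sum_(i <- r | P i) u i) = \sum_(i <- r | P i) M (u i).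
Proof. by move=> h; apply: (big_morph M (bopD h) (bop0 h)). Qed.

Lemma bop_weak M c c' : bop M c -> c <= c' -> bop M c'.
Proof.
move=> h cc'; split; [exact: le_trans (bop_ge0 h) cc'|exact: bop_lin h|].
by move=> x; apply: le_trans (bop_le h x) _; rewrite ler_wpM2r ?nrm_ge0.
Qed.

Lemma bop_comp M B c d : bop M c -> bop B d -> bop (fun x => M (B x)) (c * d).
Proof.
move=> hM hB; split; first by rewrite mulr_ge0 ?(bop_ge0 hM) ?(bop_ge0 hB).
  by move=> a x y; rewrite (bop_lin hB) (bop_lin hM).
move=> x; apply: le_trans (bop_le hM _) _.
by rewrite -mulrA ler_wpM2l ?(bop_ge0 hM)// (bop_le hB).
Qed.

Lemma bop_add M B c d : bop M c -> bop B d -> bop (fun x => M x + B x) (c + d).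
Proof.
move=> hM hB; split; first by rewrite addr_ge0 ?(bop_ge0 hM) ?(bop_ge0 hB).
  by move=> a x y; rewrite (bop_lin hB) (bop_lin hM) scalerDr addrACA.
move=> x; apply: le_trans (nrmD _ _) _; rewrite mulrDl.
by apply: lerD; [exact: bop_le hM x|exact: bop_le hB x].
Qed.

Lemma bop_opp M c : bop M c -> bop (fun x => - M x) c.
Proof.
move=> h; split; [exact: bop_ge0 h| |by move=> x; rewrite nrmN (bop_le h)].
by move=> a x y; rewrite (bop_lin h) opprD scalerN.
Qed.

Lemma bop_id : bop id 1.
Proof. by split=> // x; rewrite mul1r. Qed.

Lemma bop_iter M c k : bop M c -> bop (iter k M) (c ^+ k).
Proof.
move=> h; elim: k => [|k IH]; first by rewrite expr0; exact: bop_id.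
by rewrite exprS; exact: bop_comp h IH.
Qed.

Lemma opnormP (F : X -> X) c : opnorm_le setT F c <-> forall x, nrm (F x) <= c * nrm x.
Proof.
split=> h x; first by have := h x I; rewrite !nrmE -realcM lecR.
by move=> _; rewrite !nrmE -realcM lecR.
Qed.

Lemma bop_bounded M c : bop M c -> bounded_linear_on setT M.
Proof.
move=> h; split; first by move=> a x y _ _; exact: bop_lin h a x y.
by exists c; apply/opnormP; exact: bop_le h.
Qed.

Lemma bop_cvg M c (I : Type) (F : set_system I) {FF : Filter F} (u : I -> X) x : bop M c ->
  u i @[i --> F] --> x -> M (u i) @[i --> F] --> M x.
Proof.
move=> h /cvg_nrm0 ux; apply: (cvg_nrm_le _ (cvgMr0 c ux)).
by apply: nearW => i; rewrite -(bopB h) mulrC (bop_le h).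
Qed.

Lemma bop_limit (u : nat -> X -> X) M c : (forall n, bop (u n) c) ->
  (forall x, u n x @[n --> \oo] --> M x) -> bop M c.
Proof.
move=> hu um; split; first exact: bop_ge0 (hu 0%N).
  move=> a x y; apply: (cvg_unique _ (@um (a *: x + y))) => //.
  rewrite (_ : (fun n => _) = fun n => a *: u n x + u n y); last first.
    by apply/funext => n; rewrite (bop_lin (hu n)).
  have h1 : a *: u n x @[n --> \oo] --> a *: M x by apply: cvgZr; exact: um.
  exact: cvgD h1 (@um y).
move=> x; apply: (cvgr_to_le (nrm_cvg (@um x))); apply: nearW => n; exact: bop_le (hu n) x.
Qed.

Hypothesis cmp : complete_nrm X.

Lemma abs_summable (f : nat -> X) (a : nat -> R) (A : R) : (forall k, nrm (f k) <= a k) ->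
  (forall n, \sum_(k < n) a k <= A) -> exists x : X, \sum_(k < n) f k @[n --> \oo] --> x.
Proof.
move=> fa aA; pose s n := \sum_(k < n) a k.
have a0 k : 0 <= a k := le_trans (nrm_ge0 _) (fa k).
have snd : nondecreasing_seq s.
  by apply/nondecreasing_seqP => n; rewrite /s big_ord_recr/= lerDl.
have scv : cvgn s by apply: nondecreasing_is_cvgn => //; exists A => _ [n _ <-]; exact: aA.
apply: cmp => e e0; have /cvgrPdist_lt/(_ (e / 2)) := scv.
rewrite divr_gt0// => /(_ isT)[N _ HN]; exists N.
have h n m : (N <= n)%N -> (n <= m)%N -> nrm (\sum_(k < m) f k - \sum_(k < n) f k) < e.
  move=> Nn nm; apply: le_lt_trans (_ : s m - s n < _).
    rewrite /s -!(big_mkord xpredT f) -!(big_mkord xpredT a).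
    rewrite (big_cat_nat (leq0n n) nm)//= (big_cat_nat (F := a) (leq0n n) nm)//=.
    rewrite ![\sum_(0 <= i < n) _ i + _]addrC !addrK; apply: le_trans (nrm_sum _ _ _) _.
    by apply: ler_sum => k _.
  have := HN _ Nn; have := HN _ (leq_trans Nn nm).
  by rewrite /= !ltr_norml => /andP[? ?] /andP[? ?]; lra.
move=> m n Nm Nn; case: (leqP n m) => [|/ltnW] nm; first exact: h.
by rewrite nrmB h.
Qed.

Definition pexp M z n x : X := \sum_(k < n) (z ^+ k / k`!%:R) *: iter k M x.

(** The exponential at complex time, needed for the holomorphic extension; at real time it is
    [expop], see [expop_cxp]. *)
Definition cxp M z x : X := limn (fun n => pexp M z n x).

Lemma expop_cxp M t x : expop M t x = cxp M t%:C x.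
Proof.
rewrite /expop /cxp (_ : (fun n => \sum_(k < n) _) = pexp M t%:C ^~ x)//.
apply/funext => n; apply: eq_bigr => k _; congr (_ *: _).
by rewrite rmorphM/= fmorphV/= rmorphXn/= rmorph_nat.
Qed.

Definition rexp (r : R) n : R := \sum_(k < n) r ^+ k / k`!%:R.

Lemma rexp_cvg (r : R) : rexp r n @[n --> \oo] --> expR r.
Proof.
have := is_cvg_series_exp_coeff r; rewrite /expR => h.
rewrite (_ : rexp r = series (exp_coeff r)); first exact: h.
by apply/funext => n; rewrite /series/= big_mkord.
Qed.

Lemma rexp_le (r : R) n : 0 <= r -> rexp r n <= expR r.
Proof.
move=> r0; have rc : cvgn (rexp r) by apply/cvg_ex; exists (expR r); exact: rexp_cvg.
rewrite -(cvg_lim _ (@rexp_cvg r))//; apply: nondecreasing_cvgn_le => //.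
by apply/nondecreasing_seqP => k; rewrite /rexp big_ord_recr/= lerDl divr_ge0// exprn_ge0.
Qed.

Lemma normc_fact k : normc ((k`!%:R : R[i])^-1) = (k`!%:R)^-1.
Proof. by rewrite normcV -(rmorph_nat (real_complex R)) normcR ger0_norm. Qed.

Section one_operator.
Variables (M : X -> X) (c : R).
Hypothesis hM : bop M c.

Lemma nrm_expterm z k x :
  nrm ((z ^+ k / k`!%:R) *: iter k M x) <= (normc z * c) ^+ k / k`!%:R * nrm x.
Proof.
rewrite nrmZ normcM normc_fact normcX exprMn -!mulrA.
rewrite ler_wpM2l ?exprn_ge0 ?Defs.normc_ge0// mulrCA ler_wpM2l ?invr_ge0//.
exact: bop_le (bop_iter k hM) x.
Qed.

Lemma zc_ge0 z : 0 <= normc z * c.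
Proof. by rewrite mulr_ge0 ?Defs.normc_ge0 ?(bop_ge0 hM). Qed.

Lemma cxp_cvg z x : pexp M z n x @[n --> \oo] --> cxp M z x.
Proof.
have [n|y hy] := abs_summable (nrm_expterm z ^~ x) (A := expR (normc z * c) * nrm x).
  by rewrite -mulr_suml ler_wpM2r ?nrm_ge0// rexp_le// zc_ge0.
by rewrite /cxp (_ : limn _ = y)//; apply/cvg_lim => //.
Qed.

Lemma bop_pexp z n : bop (pexp M z n) (expR (normc z * c)).
Proof.
split; first exact: expR_ge0.
  move=> a x y; rewrite /pexp scaler_sumr -big_split/=; apply: eq_bigr => k _.
  by rewrite (bop_lin (bop_iter k hM)) scalerDr !scalerA mulrC.
move=> x; apply: le_trans (nrm_sum _ _ _) _.
apply: le_trans (_ : rexp (normc z * c) n * nrm x <= _).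
  by rewrite mulr_suml; apply: ler_sum => k _; exact: nrm_expterm.
by rewrite ler_wpM2r ?nrm_ge0// rexp_le// zc_ge0.
Qed.

Lemma bop_cxp z : bop (cxp M z) (expR (normc z * c)).
Proof. by apply: bop_limit (bop_pexp z) _ => x; exact: cxp_cvg. Qed.

Lemma cxp0 x : cxp M 0 x = x.
Proof.
apply: (cvg_unique _ (cxp_cvg (z := 0) (x := x))) => //.
apply: cvg_near_cst; exists 1%N => // -[//|n] _.
rewrite /pexp big_ord_recl/= expr0 divr1 scale1r big1 ?addr0// => i _.
by rewrite /fintype.bump/= expr0n/= mul0r scale0r.
Qed.

Lemma nrm_pexp2_le z n x :
  nrm (pexp M z n.+2 x - x - z *: M x) <=
  (normc z * c) ^+ 2 * expR (normc z * c) * nrm x.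
Proof.
set r := normc z * c; have r0 : 0 <= r := zc_ge0 z.
have cancel2 (a b d : X) : a + (b + d) - a - b = d.
  by rewrite [a + _ - a]addrAC subrr add0r addrAC subrr add0r.
rewrite /pexp !big_ord_recl/= expr0 divr1 scale1r expr1 divr1 cancel2.
apply: le_trans (nrm_sum _ _ _) _.
apply: le_trans (_ : r ^+ 2 * rexp r n * nrm x <= _); last first.
  by rewrite ler_wpM2r ?nrm_ge0// ler_wpM2l ?sqr_ge0// rexp_le.
rewrite mulr_sumr mulr_suml; apply: ler_sum => k _.
apply: le_trans (nrm_expterm _ _ _) _; rewrite ler_wpM2r ?nrm_ge0// -/r.
rewrite /fintype.bump/= !add1n mulrA -exprD add2n ler_wpM2l ?exprn_ge0//.
rewrite lef_pV2 ?posrE ?ltr0n ?fact_gt0// ler_nat.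
by apply: leq_fact; rewrite -addn2 leq_addr.
Qed.

Lemma cxp_sub1D z x : nrm (cxp M z x - x - z *: M x) <=
  (normc z * c) ^+ 2 * expR (normc z * c) * nrm x.
Proof.
have lim : pexp M z n x - x - z *: M x @[n --> \oo] --> cxp M z x - x - z *: M x.
  by apply: cvgB; [apply: cvgB; [exact: cxp_cvg|exact: cvg_cst]|exact: cvg_cst].
apply: (cvgr_to_le (nrm_cvg lim)); exists 2%N => // -[//|[//|n]] _.
exact: nrm_pexp2_le.
Qed.

Lemma cxp_intertwine (B M' : X -> X) b c' z x : bop M' c' -> bop B b ->
  (forall y, B (M y) = M' (B y)) -> B (cxp M z x) = cxp M' z (B x).
Proof.
move=> hM' hB BM; have hi k y : B (iter k M y) = iter k M' (B y).
  by elim: k => //= k IH; rewrite BM IH.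
have lim := bop_cvg hB (cxp_cvg (z := z) (x := x)).
have E : (fun n => B (pexp M z n x)) = pexp M' z ^~ (B x).
  apply/funext => n; rewrite (bop_sum _ _ _ hB).
  by apply: eq_bigr => k _; rewrite (bopZ hB) hi.
rewrite /cxp; apply/esym/cvg_lim => //; rewrite -E. exact: lim.
Qed.

End one_operator.

Lemma exp_binomial (F : numFieldType) (a b : F) k :
  \sum_(i < k.+1) (a ^+ i / i`!%:R) * (b ^+ (k - i) / (k - i)`!%:R) = (a + b) ^+ k / k`!%:R.
Proof.
rewrite addrC exprDn mulr_suml; apply: eq_bigr => i _.
have ik : (i <= k)%N by rewrite -ltnS.
have h : ('C(k, i)%:R : F) * (i`!%:R * (k - i)`!%:R) = k`!%:R.
  by rewrite -!natrM bin_fact.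
have n0 m : (m`!%:R : F) != 0 by rewrite pnatr_eq0 -lt0n fact_gt0.
have c0 : ('C(k, i)%:R : F) != 0 by rewrite pnatr_eq0 -lt0n bin_gt0.
rewrite -mulr_natr -h; field; by rewrite !n0 c0.
Qed.

(** The product of partial sums at [z] and [w] differs from the partial sum at [z + w] by the terms
    outside the triangle. These are dominated by the same terms for the real exponentials of [|z| c]
    and [|w| c], which tend to 0 since [expR] is multiplicative. *)
Lemma cxpD M c z w x : bop M c -> cxp M (z + w) x = cxp M z (cxp M w x).
Proof.
move=> hM; pose f i j := (z ^+ i / i`!%:R * (w ^+ j / j`!%:R)) *: iter (i + j) M x.
pose a := normc z * c; pose b := normc w * c.
pose g i j := (a ^+ i / i`!%:R) * (b ^+ j / j`!%:R).
have a0 : 0 <= a by rewrite mulr_ge0 ?Defs.normc_ge0 ?(bop_ge0 hM).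
have b0 : 0 <= b by rewrite mulr_ge0 ?Defs.normc_ge0 ?(bop_ge0 hM).
have fE n : pexp M z n (pexp M w n x) = \sum_(i < n) \sum_(j < n) f i j.
  apply: eq_bigr => i _; rewrite /pexp (bop_sum _ _ _ (bop_iter i hM)) scaler_sumr.
  by apply: eq_bigr => j _; rewrite (bopZ (bop_iter i hM)) scalerA -iterD.
have gE n : rexp a n * rexp b n = \sum_(i < n) \sum_(j < n) g i j.
  by rewrite mulr_suml; apply: eq_bigr => i _; rewrite mulr_sumr.
have fd n : \sum_(k < n) \sum_(i < k.+1) f i (k - i)%N = pexp M (z + w) n x.
  apply: eq_bigr => k _; rewrite -exp_binomial scaler_suml; apply: eq_bigr => i _.
  by rewrite /f subnKC// -ltnS.
have gd n : \sum_(k < n) \sum_(i < k.+1) g i (k - i)%N = rexp (a + b) n.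
  by apply: eq_bigr => k _; exact: exp_binomial.
have fg i j : nrm (f i j) <= g i j * nrm x.
  rewrite /f /g nrmZ !normcM !normc_fact !normcX exprMn [b ^+ j]exprMn.
  apply: le_trans (ler_wpM2l _ (bop_le (bop_iter (i + j) hM) x)) _.
    by rewrite !mulr_ge0 ?invr_ge0 ?exprn_ge0 ?Defs.normc_ge0.
  by rewrite exprD le_eqVlt; apply/orP; left; apply/eqP; ring.
have err n : nrm (pexp M z n (pexp M w n x) - pexp M (z + w) n x) <=
    (rexp a n * rexp b n - rexp (a + b) n) * nrm x.
  rewrite fE gE !triangle_sum fd gd [pexp _ _ _ _ + _]addrC addrK [rexp _ _ + _]addrC addrK.
  rewrite mulr_suml; apply: le_trans (nrm_sum _ _ _) _; apply: ler_sum => i _.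
  by rewrite mulr_suml; apply: le_trans (nrm_sum _ _ _) _; apply: ler_sum => j _.
have l1 : pexp M z n (pexp M w n x) @[n --> \oo] --> cxp M z (cxp M w x).
  have e1 : pexp M z n (pexp M w n x) - pexp M z n (cxp M w x) @[n --> \oo] --> (0 : X).
    have /cvg_nrm0 h0 := cxp_cvg hM (z := w) (x := x).
    apply: (cvg_nrm_le _ (cvgMr0 (expR a) h0)).
    apply: nearW => n; rewrite subr0 -(bopB (bop_pexp hM z n)) mulrC.
    exact: bop_le (bop_pexp hM z n) _.
  have h := cvgD e1 (cxp_cvg hM (z := z) (x := cxp M w x)); rewrite add0r in h.
  have E : (fun n => pexp M z n (pexp M w n x)) = fun n =>
      pexp M z n (pexp M w n x) - pexp M z n (cxp M w x) + pexp M z n (cxp M w x).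
    by apply/funext => n; rewrite subrK.
  rewrite E; exact: h.
have l2 : pexp M z n (pexp M w n x) - pexp M (z + w) n x @[n --> \oo] --> (0 : X).
  apply: (@cvg_nrm_le _ _ _ _ _ _ _ (fun n => (rexp a n * rexp b n - rexp (a + b) n) * nrm x)).
    by apply: nearW => n; rewrite subr0; exact: err.
  apply: cvgMr0; rewrite -(subrr (expR (a + b))) {1}expRD.
  by apply: cvgB; [apply: cvgM; exact: rexp_cvg|exact: rexp_cvg].
have l3 : pexp M z n (pexp M w n x) - pexp M (z + w) n x @[n --> \oo] -->
    cxp M z (cxp M w x) - cxp M (z + w) x.
  by apply: cvgB => //; exact: (cxp_cvg hM).
by apply/esym/eqP; rewrite -subr_eq0; apply/eqP; exact: cvg_unique l3 l2.
Qed.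

Lemma cxp_coord M c (dot : X -> X -> R[i]) (t m : R) x v : hilbert dot -> bop M c ->
  (forall j, dot (iter j M x) v = (m ^+ j)%:C * dot x v) ->
  dot (cxp M t%:C x) v = (expR (t * m))%:C * dot x v.
Proof.
move=> H hM h.
have lim : normc (dot (pexp M t%:C n x) v - dot (cxp M t%:C x) v) @[n --> \oo] --> (0 : R).
  by apply: (dot_cvg0 H); exact: (cxp_cvg hM).
have E n : dot (pexp M t%:C n x) v = (rexp (t * m) n)%:C * dot x v.
  rewrite (dot_suml H) rmorph_sum mulr_suml/=; apply: eq_bigr => j _.
  rewrite (dotZl H) h mulrA; congr (_ * _).
  by rewrite exprMn !rmorphM/= fmorphV/= !rmorphXn/= rmorph_nat mulrAC.
apply/eqP; rewrite -subr_eq0; apply/eqP/eq0_normc.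
have lim2 : normc (dot (pexp M t%:C n x) v - (expR (t * m))%:C * dot x v) @[n --> \oo] --> (0 : R).
  apply: (@squeeze0 _ _ _ _ _ (fun n => `|expR (t * m) - rexp (t * m) n| * normc (dot x v))).
    apply: nearW => n; rewrite Defs.normc_ge0 E -mulrBl normcM -rmorphB normcR distrC lexx//.
  apply: cvgMr0; rewrite -(normr0 R) -(subrr (expR (t * m))).
  by apply: cvg_norm; apply: cvgB; [exact: cvg_cst|exact: rexp_cvg].
apply/eqP; rewrite eq_le Defs.normc_ge0 andbT.
have lim3 : normc (dot (pexp M t%:C n x) v - dot (cxp M t%:C x) v) +
    normc (dot (pexp M t%:C n x) v - (expR (t * m))%:C * dot x v) @[n --> \oo] --> (0 + 0 : R).
  exact: cvgD.
rewrite addr0 in lim3.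
apply: (cvgr_to_ge lim3); apply: nearW => n /=.
rewrite [normc (_ - dot (cxp _ _ _) _)]normcB; apply: le_trans (Defs.normcD _ _).
by rewrite addrA subrK.
Qed.

End bounded_operators.

(** * Spectral cut-offs and compressions of the perturbed operator *)

Section perturbation.
Context (R : realType) (X : normedModType R[i]) (dot : X -> X -> R[i]).
Context (e : nat -> X) (lam : nat -> R).
Hypotheses (H : hilbert dot) (He : orthosys dot e).
Hypothesis tot : forall x : X, fsum dot e n x @[n --> \oo] --> x.
Hypothesis lamN : forall L : R, exists N, forall n, (N <= n)%N -> lam n <= L.
Implicit Types (x y v : X) (k n : nat) (z w : R[i]) (t h L : R).

Local Notation co x k := (dot x (e k)).

Let cmp : complete_nrm X := hcomplete H.

Lemma bop_diag (a : nat -> R[i]) c : (forall k, normc (a k) <= c) -> bop (diag dot e a) c.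
Proof.
move=> ac; have c0 : 0 <= c := le_trans (Defs.normc_ge0 _) (ac 0%N).
have ba : bounded_seq a by exists c.
split=> // [b x y|x]; first exact: (diag_linear H He tot).
exact: (nrm_diag_le H He tot).
Qed.

Definition cut L (a b : nat -> R[i]) k := if - L < lam k then a k else b k.

(** For [L = rho] this is the spectral projection [P_cr]; the same construction serves at the larger
    threshold [Lm]. Only finitely many modes are kept, which makes [cutlam] bounded. *)
Definition cutoff L := diag dot e (cut L (fun=> 1) (fun=> 0)).
Definition cutlam L := diag dot e (cut L (fun k => (lam k)%:C) (fun=> 0)).

Lemma cutlam_bounded L : exists c, forall k, normc (cut L (fun k => (lam k)%:C) (fun=> 0) k) <= c.
Proof.
have [N hN] := lamN (- L).
exists (\sum_(j < N) `|lam j|) => k; rewrite /cut; case: ifPn => [Lk|_].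
  rewrite normcR; have kN : (k < N)%N by rewrite ltnNge; apply/negP => /hN; rewrite leNgt Lk.
  by rewrite (bigD1 (Ordinal kN))//= lerDl sumr_ge0.
by rewrite normc0 sumr_ge0.
Qed.

Lemma bop_cutoff L : bop (cutoff L) 1.
Proof.
by apply: bop_diag => k; rewrite /cut; case: ifP => _; rewrite ?normc0// -[1]/(1%:C) normcR normr1.
Qed.

Lemma bop_cutlam L : exists c, bop (cutlam L) c.
Proof. by have [c hc] := cutlam_bounded L; exists c; exact: bop_diag. Qed.

Lemma cutoffE L x k : co (cutoff L x) k = if - L < lam k then co x k else 0.
Proof.
rewrite (diagE H He)//; last first.
  exists 1 => j; rewrite /cut; case: ifP => _; rewrite ?normc0//.
  by rewrite -[1]/(1%:C) normcR normr1.
by rewrite /cut; case: ifP => _; rewrite ?mul1r ?mul0r.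
Qed.

Lemma cutlamE L x k : co (cutlam L x) k = if - L < lam k then (lam k)%:C * co x k else 0.
Proof.
rewrite (diagE H He)//; first by rewrite /cut; case: ifP => _; rewrite ?mul0r.
exact: cutlam_bounded.
Qed.

Variables (rho : R) (G : X -> X) (g : R).
Hypotheses (rho0 : 0 < rho) (hG : bop G g).
Local Notation P := (cutoff rho).
(** The perturbation sees only the low modes; this is what makes the perturbed operator block
    triangular. *)
Hypothesis GP : forall x, G (P x) = G x.

(* The compression to the range of [cutoff L] of the operator with eigenvalues
   [lam], perturbed by [G]. *)
Definition compr L x := cutlam L x + cutoff L (G x).

Lemma comprE L x k : co (compr L x) k = if - L < lam k then (lam k)%:C * co x k + co (G x) k else 0.
Proof. by rewrite (dotDl H) cutlamE cutoffE; case: ifP => // _; rewrite addr0. Qed.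

Lemma bop_compr L : exists c, bop (compr L) c.
Proof. by have [c hc] := bop_cutlam L; exists (c + 1 * g); apply: bop_add => //; exact: bop_comp (bop_cutoff L) hG. Qed.

Local Notation M := (compr rho).

(** [m] bounds the low block [M]. With [m + 1 <= Lm], the modes below [- Lm] are separated by at
    least 1 from the disc of radius [m], so the Sylvester series converges. *)
Variables (Lm m n0 : R).
Local Notation N := (compr Lm).
Hypotheses (rhoL : rho <= Lm) (mL : m + 1 <= Lm) (hM : bop M m) (hN : bop N n0).

Lemma cutL k : - rho < lam k -> - Lm < lam k.
Proof. by move=> h; apply: le_lt_trans h; rewrite lerN2. Qed.

Lemma cutoff_id x : P x = x <-> forall k, - rho < lam k \/ co x k = 0.
Proof.
split=> [<- k|h]; first by rewrite cutoffE; case: ifP; [left|right].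
apply: (coord_inj tot) => k; rewrite cutoffE; case: ifPn => // nk.
by case: (h k) => // pk; rewrite pk in nk.
Qed.

Lemma comprP x : M (P x) = M x.
Proof. by apply: (coord_inj tot) => k; rewrite !comprE GP cutoffE; case: ifP => // ->. Qed.

Lemma cutoffM x : P (M x) = M x.
Proof. by apply: (coord_inj tot) => k; rewrite cutoffE comprE; case: ifP => // ->. Qed.

(** Block triangularity: the low modes evolve by themselves, since [G] depends on them alone. *)
Lemma cutoff_compr x : P (N x) = M (P x).
Proof.
apply: (coord_inj tot) => k; rewrite comprP cutoffE !comprE.
by case: ifP => // /cutL h; rewrite h.
Qed.

Lemma m_ge0 : 0 <= m. Proof. exact: bop_ge0 hM. Qed.

Lemma Lm_ge1 : 1 <= Lm. Proof. by apply: le_trans mL; rewrite lerDr m_ge0. Qed.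

(** * The Sylvester equation and the conjugation that removes the coupling *)

Definition high := diag dot e (cut Lm (fun=> 0) (fun k => ((lam k)^-1)%:C)).

Lemma high_le k : normc (cut Lm (fun=> 0) (fun k => ((lam k)^-1)%:C) k) <= Lm^-1.
Proof.
have L1 := Lm_ge1; have L0 : 0 < Lm by lra.
rewrite /cut; case: ifPn => [_|]; first by rewrite normc0 invr_ge0 ltW.
rewrite -leNgt => lk; rewrite normcR normfV lef_pV2 ?posrE//; last first.
  by rewrite normr_gt0 ltr0_neq0//; lra.
by rewrite ltr0_norm; lra.
Qed.

Lemma bop_high : bop high Lm^-1.
Proof. by apply: bop_diag; exact: high_le. Qed.

Lemma highE x k : co (high x) k = if - Lm < lam k then 0 else (lam k)^-1%:C * co x k.
Proof.
rewrite (diagE H He)//; last by exists Lm^-1; exact: high_le.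
by rewrite /cut; case: ifP => _; rewrite ?mul0r.
Qed.

(* The solution of [high^-1 Y - Y M = G] on the high frequencies, so that
   [1 + Y] conjugates the perturbed operator to a block diagonal one. *)
Definition sylv_term x j := iter j.+1 high (G (iter j M x)).
Definition sylv_sum n x := \sum_(j < n) sylv_term x j.
Definition sylv x := limn (fun n => sylv_sum n x).

Lemma nrm_sylv_term x j : nrm (sylv_term x j) <= Lm^-1 ^+ j.+1 * m ^+ j * (g * nrm x).
Proof.
apply: le_trans (bop_le (bop_iter j.+1 bop_high) _) _.
have L0 : 0 <= Lm^-1 by rewrite invr_ge0 (le_trans _ Lm_ge1).
rewrite -mulrA ler_wpM2l ?exprn_ge0//; apply: le_trans (bop_le hG _) _.
rewrite mulrCA ler_wpM2l ?(bop_ge0 hG)//; exact: bop_le (bop_iter j hM) x.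
Qed.

(** The geometric sum is [(1 - (m / Lm)^n) / (Lm - m)], and [Lm - m >= 1]. *)
Lemma geo_le n : \sum_(j < n) Lm^-1 ^+ j.+1 * m ^+ j <= 1.
Proof.
have L0 : 0 < Lm := lt_le_trans ltr01 Lm_ge1.
have mL' : 1 <= Lm - m by rewrite lerBrDl.
have E : (\sum_(j < n) Lm^-1 ^+ j.+1 * m ^+ j) * (Lm - m) = 1 - (Lm^-1 * m) ^+ n.
  elim: n => [|n IH]; first by rewrite big_ord0 mul0r expr0 subrr.
  rewrite big_ord_recr/= mulrDl IH !exprMn !exprS; field; lra.
set s := (X in X <= _) in E *.
have s0 : 0 <= s.
  by apply: sumr_ge0 => j _; rewrite mulr_ge0 ?exprn_ge0 ?m_ge0 ?invr_ge0 ?(ltW L0).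
have : s * (Lm - m) <= 1.
  by rewrite E gerBl exprn_ge0// mulr_ge0 ?m_ge0 ?invr_ge0 ?(ltW L0).
by apply: le_trans; rewrite ler_peMr.
Qed.

Lemma bop_sylv_sum n : bop (sylv_sum n) g.
Proof.
split; first exact: bop_ge0 hG.
  move=> a x y; rewrite /sylv_sum scaler_sumr -big_split/=; apply: eq_bigr => j _.
  by rewrite /sylv_term (bop_lin (bop_iter j hM)) (bop_lin hG) (bop_lin (bop_iter j.+1 bop_high)).
move=> x; apply: le_trans (nrm_sum _ _ _) _.
apply: le_trans (_ : \sum_(j < n) Lm^-1 ^+ j.+1 * m ^+ j * (g * nrm x) <= _).
  by apply: ler_sum => j _; exact: nrm_sylv_term.
rewrite -mulr_suml -[leRHS]mul1r ler_wpM2r ?geo_le//.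
by rewrite mulr_ge0 ?nrm_ge0 ?(bop_ge0 hG).
Qed.

Lemma sylv_cvg x : sylv_sum n x @[n --> \oo] --> sylv x.
Proof.
have [n|y hy] := abs_summable cmp (nrm_sylv_term x) (A := 1 * (g * nrm x)).
  by rewrite -mulr_suml ler_wpM2r ?geo_le// mulr_ge0 ?nrm_ge0 ?(bop_ge0 hG).
by rewrite /sylv (_ : limn _ = y)//; apply/cvg_lim => //.
Qed.

Lemma bop_sylv : bop sylv g.
Proof. by apply: bop_limit bop_sylv_sum _ => x; exact: sylv_cvg. Qed.

Lemma sylvE x : sylv x = high (G x) + high (sylv (M x)).
Proof.
have l1 : sylv_sum n.+1 x @[n --> \oo] --> sylv x.
  by rewrite (cvg_shiftS (fun n => sylv_sum n x)); exact: sylv_cvg.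
have E n : sylv_sum n.+1 x = high (G x) + high (sylv_sum n (M x)).
  rewrite /sylv_sum big_ord_recl; congr (_ + _).
  rewrite (bop_sum _ _ _ bop_high); apply: eq_bigr => j _.
  by rewrite /sylv_term /= -iterSr.
have l2 : high (G x) + high (sylv_sum n (M x)) @[n --> \oo] --> high (G x) + high (sylv (M x)).
  apply: cvgD; first exact: cvg_cst.
  by apply: (bop_cvg bop_high); exact: sylv_cvg.
have Ef : (fun n => sylv_sum n.+1 x) = fun n => high (G x) + high (sylv_sum n (M x)).
  exact/funext.
by rewrite Ef in l1; exact: cvg_unique l1 l2.
Qed.

Lemma sylvP x : sylv (P x) = sylv x.
Proof.
rewrite /sylv; congr (limn _); apply/funext => n; apply: eq_bigr => -[j] _ _ /=.
rewrite /sylv_term; congr (iter _ _ _); case: j => [|j]; first exact: GP.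
by rewrite !iterSr comprP.
Qed.

Lemma sylv_low x k : - Lm < lam k -> co (sylv x) k = 0.
Proof. by move=> lk; rewrite sylvE (dotDl H) !highE lk addr0. Qed.

Lemma cutoff_sylv x : P (sylv x) = 0.
Proof.
apply: (coord_inj tot) => k; rewrite cutoffE (dot0l H); case: ifP => // /cutL.
exact: sylv_low.
Qed.

(** [sylv] depends only on [P x] and takes values in modes killed by [P]; being nilpotent of order
    two, it makes [1 - sylv] the inverse of [1 + sylv]. *)
Lemma sylv_sylv x : sylv (sylv x) = 0.
Proof. by rewrite -sylvP cutoff_sylv (bop0 bop_sylv). Qed.

Lemma sylv_coord x k :
  (lam k)%:C * co (sylv x) k = if - Lm < lam k then 0 else co (G x) k + co (sylv (M x)) k.
Proof.
case: ifPn => [lk|lk]; first by rewrite sylv_low// mulr0.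
rewrite {1}sylvE (dotDl H) !highE (negPf lk) -mulrDr mulrA -rmorphM/= divff ?mul1r//.
by have := Lm_ge1; move: lk; rewrite -leNgt => ? ?; rewrite ltr0_neq0//; lra.
Qed.

(** * The block-diagonal evolution and its conjugate *)

Definition evol z := diag dot e (cut Lm (fun=> 1) (fun k => cexp ((lam k)%:C * z))).

Lemma evol_le z k : 0 <= Re z -> normc (cut Lm (fun=> 1) (fun k => cexp ((lam k)%:C * z)) k) <= 1.
Proof.
move=> z0; rewrite /cut; case: ifPn => [_|]; first by rewrite -[1]/(1%:C) normcR normr1.
rewrite -leNgt normc_cexp ReCM => lk; rewrite -expR0 ler_expR nmulr_rle0//.
by have := Lm_ge1; lra.
Qed.

Lemma bop_evol z : 0 <= Re z -> bop (evol z) 1.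
Proof. by move=> z0; apply: bop_diag => k; exact: evol_le. Qed.

Lemma evolE z x k : 0 <= Re z ->
  co (evol z x) k = if - Lm < lam k then co x k else cexp ((lam k)%:C * z) * co x k.
Proof.
move=> z0; rewrite (diagE H He)//; last by exists 1 => j; exact: evol_le.
by rewrite /cut; case: ifP => _; rewrite ?mul1r.
Qed.

Lemma evolN z x : 0 <= Re z -> evol z (N x) = N x.
Proof.
by move=> z0; apply: (coord_inj tot) => k; rewrite evolE// comprE; case: ifP => h; rewrite ?h ?mulr0.
Qed.

Lemma cutoff_evol z x : 0 <= Re z -> P (evol z x) = P x.
Proof.
move=> z0; apply: (coord_inj tot) => k; rewrite !cutoffE evolE//.
by case: ifP => // /cutL h; rewrite h.
Qed.

Lemma Nevol z x : 0 <= Re z -> N (evol z x) = N x.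
Proof.
move=> z0; apply: (coord_inj tot) => k; rewrite !comprE evolE//.
rewrite -[G (evol z x)]GP cutoff_evol// GP.
by case: ifP => // ->.
Qed.

Lemma evolD z w x : 0 <= Re z -> 0 <= Re w -> evol (z + w) x = evol z (evol w x).
Proof.
move=> z0 w0; apply: (coord_inj tot) => k; rewrite !evolE//; last first.
  by rewrite ReD addr_ge0.
by case: ifP => // _; rewrite mulrDr cexpD mulrA.
Qed.

Lemma evol0 x : evol 0 x = x.
Proof.
apply: (coord_inj tot) => k; rewrite evolE ?lexx//.
by case: ifP => // _; rewrite mulr0 cexp0 mul1r.
Qed.

Lemma cutoff_cxp z x : P (cxp N z x) = cxp M z (P x).
Proof. exact: (cxp_intertwine cmp hN _ _ hM (bop_cutoff rho) cutoff_compr). Qed.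

Lemma evol_cxp z w x : 0 <= Re z -> evol z (cxp N w x) = cxp N w (evol z x).
Proof.
move=> z0; apply: (cxp_intertwine cmp hN _ _ hN (bop_evol z0)) => y.
by rewrite evolN// Nevol.
Qed.

(** [evol] is the identity on the modes above [- Lm], where [N] takes its values, and [N] does not
    see the modes that [evol] changes. The two factors therefore commute and their product is a
    semigroup. *)
Definition blocks z x := cxp N z (evol z x).

Lemma blocksD z w x : 0 <= Re z -> 0 <= Re w -> blocks (z + w) x = blocks z (blocks w x).
Proof.
move=> z0 w0; rewrite /blocks (evolD _ z0 w0) (cxpD cmp _ _ _ hN).
by congr (cxp _ _ _); rewrite evol_cxp.
Qed.

Lemma cutoff_blocks z x : 0 <= Re z -> P (blocks z x) = cxp M z (P x).
Proof. by move=> z0; rewrite /blocks cutoff_cxp cutoff_evol. Qed.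

(** The conjugate [(1 - Y) blocks (1 + Y)] with [Y = sylv]: the semigroup of the theorem, at complex
    time. *)
Definition sgr z x := blocks z (x + sylv x) - sylv (blocks z (x + sylv x)).

Lemma sylv_inv1 v : (v - sylv v) + sylv (v - sylv v) = v.
Proof. by rewrite (bopB bop_sylv) sylv_sylv subr0 subrK. Qed.

Lemma sylv_inv2 v : (v + sylv v) - sylv (v + sylv v) = v.
Proof. by rewrite (bopD bop_sylv) sylv_sylv addr0 addrK. Qed.

Lemma sgrD z w x : 0 <= Re z -> 0 <= Re w -> sgr (z + w) x = sgr z (sgr w x).
Proof. by move=> z0 w0; rewrite /sgr sylv_inv1 blocksD. Qed.

Lemma bop_sgr (r : R) : exists2 c, 1 <= c & forall z, 0 <= Re z -> normc z <= r -> bop (sgr z) c.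
Proof.
pose c0 := expR (r * n0) * 1 * (1 + g); exists (1 + (c0 + g * c0)).
  by rewrite lerDl addr_ge0 ?mulr_ge0 ?expR_ge0 ?addr_ge0 ?(bop_ge0 hG).
move=> z z0 zr; have hY := bop_add (bop_id X) bop_sylv.
have hE : bop (blocks z) (expR (r * n0) * 1).
  apply: bop_comp (bop_evol z0); apply: bop_weak (bop_cxp cmp hN z) _.
  by rewrite ler_expR ler_wpM2r// (bop_ge0 hN).
have hEY := bop_comp hE hY.
apply: bop_weak (bop_add hEY (bop_opp (bop_comp bop_sylv hEY))) _.
by rewrite lerDr.
Qed.

Lemma cutoff_sgr z x : 0 <= Re z -> P (sgr z x) = cxp M z (P x).
Proof.
move=> z0; rewrite /sgr (bopB (bop_cutoff rho)) cutoff_sylv subr0 cutoff_blocks//.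
by rewrite (bopD (bop_cutoff rho)) cutoff_sylv addr0.
Qed.

Lemma cxp_sub1 z v : nrm (cxp N z v - v) <=
  (normc z * n0 + (normc z * n0) ^+ 2 * expR (normc z * n0)) * nrm v.
Proof.
rewrite -[X in nrm X](subrK (z *: N v)); apply: le_trans (nrmD _ _) _.
rewrite mulrDl addrC; apply: lerD; last exact: cxp_sub1D.
by rewrite nrmZ -mulrA ler_wpM2l ?Defs.normc_ge0 ?(bop_le hN).
Qed.

Lemma evol_strong x (d : R) : 0 < d ->
  exists2 r : R, 0 < r & forall z, 0 <= Re z -> normc z < r -> nrm (evol z x - x) < d.
Proof.
move=> d0.
(* The filter of neighbourhoods of 0 within the closed right half-plane, where the multipliers stay
   bounded; it lets [diag_strong0] apply to a complex parameter. *)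
pose F : set_system R[i] := [set A | exists2 r : R, 0 < r &
  forall z, 0 <= Re z -> normc z < r -> A z].
have FF : Filter F.
  split; first by exists 1.
    move=> A B [r r0 hA] [s s0 hB]; exists (Num.min r s); first by rewrite lt_min r0 s0.
    by move=> z z0; rewrite lt_min => /andP[zr zs]; split; [exact: hA|exact: hB].
  by move=> A B AB [r r0 hA]; exists r => // z z0 zr; apply: AB; exact: hA.
have nF : normc z @[z --> F] --> (0 : R).
  apply/cvgrPdist_lt => r r0; exists r => // z z0 zr.
  by rewrite sub0r normrN ger0_norm ?Defs.normc_ge0.
have pF : \forall z \near F, 0 <= Re z by exists 1.
pose a z := cut Lm (fun=> 0) (fun k => cexp ((lam k)%:C * z) - 1).
have a2 : \forall z \near F, forall k, normc (a z k) <= 2.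
  apply: filterS pF => z z0 k; rewrite /a; have := evol_le k z0; rewrite /cut.
  case: ifP => _; first by rewrite normc0.
  move=> h; apply: le_trans (Defs.normcD _ _) _; rewrite normcN.
  by rewrite -[1]/(1%:C) normcR normr1; lra.
have a0 k : normc (a z k) @[z --> F] --> (0 : R).
  rewrite /a /cut; case: (- Lm < lam k).
    by under eq_fun do rewrite normc0; exact: cvg_cst.
  pose b (z : R[i]) := `|lam k| * normc z.
  have b0 : b z @[z --> F] --> (0 : R).
    by rewrite -(mulr0 `|lam k|); apply: cvgM => //; exact: cvg_cst.
  apply: (@squeeze0 _ _ _ _ _ (fun z => b z + 4 * (b z * b z) * expR (b z))).
    apply: nearW => z; rewrite Defs.normc_ge0/=.
    by have := cexp_sub1_le ((lam k)%:C * z); rewrite normcM normcR expr2.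
  rewrite (_ : 0 = 0 + 4 * (0 * 0) * expR 0 :> R); last by rewrite !mulr0 mul0r addr0.
  apply: cvgD => //; apply: cvgM.
    by apply: cvgM; [exact: cvg_cst|exact: cvgM].
  by apply: (cvg_comp _ _ b0); exact: continuous_expR.
have := diag_strong0 H He tot (FF := FF) x a2 a0 => /cvg_nrmP/(_ _ d0) hd.
have [r r0 hr] := filterI pF hd; exists r => // z z0 zr.
have [_] := hr z z0 zr; rewrite subr0; congr (nrm _ < _); apply: (coord_inj tot) => k.
rewrite (dotBl H) evolE// (diagE H He)//; last first.
  by exists 2 => j; rewrite /a; have := evol_le j z0; rewrite /cut; case: ifP => _; [rewrite normc0|move=> h; apply: le_trans (Defs.normcD _ _) _; rewrite normcN -[1]/(1%:C) normcR normr1; lra].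
by rewrite /a /cut; case: ifP => _; rewrite ?subrr ?mul0r// mulrBl mul1r.
Qed.

Lemma sgr_strong x (d : R) : 0 < d ->
  exists2 r : R, 0 < r & forall z, 0 <= Re z -> normc z < r -> nrm (sgr z x - x) < d.
Proof.
move=> d0; pose v := x + sylv x.
have n00 := bop_ge0 hN; have g0 := bop_ge0 hG.
have E z : sgr z x - x = (blocks z v - v) - sylv (blocks z v - v).
  by rewrite -{2}(sylv_inv2 x) /sgr -/v (bopB bop_sylv) !opprB addrACA [RHS]addrACA [in RHS](addrC (- v)).
pose d1 := d / (1 + g) / 2; have d10 : 0 < d1 by rewrite !divr_gt0// ltr_wpDr.
have [r r0 hr] := evol_strong v d10.
pose C := (n0 + n0 ^+ 2 * expR n0) * nrm v + 1.
have C0 : 0 < C.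
  by rewrite ltr_wpDl// mulr_ge0 ?nrm_ge0// addr_ge0// mulr_ge0 ?sqr_ge0 ?expR_ge0.
exists (Num.min r (Num.min 1 (d1 / C))); first by rewrite !lt_min r0 ltr01 divr_gt0.
move=> z z0; rewrite !lt_min => /and3P[zr z1 zd].
have zn := Defs.normc_ge0 z.
suff hb : nrm (blocks z v - v) < d / (1 + g).
  rewrite E; apply: le_lt_trans (nrmD _ _) _; rewrite nrmN.
  apply: le_lt_trans (lerD (lexx _) (bop_le bop_sylv _)) _.
  by rewrite -[X in X + _]mul1r -mulrDl mulrC -ltr_pdivlMr// ltr_wpDr.
rewrite -(subrK (evol z v) (blocks z v)) -addrA; apply: le_lt_trans (nrmD _ _) _.
have -> : d / (1 + g) = d1 + d1 by rewrite /d1; field; lra.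
apply: ler_ltD; last exact: hr.
apply: le_trans (cxp_sub1 z (evol z v)) _.
have nv : nrm (evol z v) <= nrm v by have := bop_le (bop_evol z0) v; rewrite mul1r.
apply: le_trans (_ : normc z * C <= _); last by rewrite -ler_pdivlMr// ltW.
rewrite /C mulrDr mulr1; apply: le_trans (_ : normc z * ((n0 + n0 ^+ 2 * expR n0) * nrm v) <= _); last by rewrite lerDl.
rewrite mulrA; apply: ler_pM => //.
- by rewrite addr_ge0 ?(mulr_ge0, expR_ge0, exprn_ge0).
- exact: nrm_ge0.
rewrite mulrDr lerD2l.
have -> : (normc z * n0) ^+ 2 * expR (normc z * n0) =
    normc z * (normc z * (n0 ^+ 2 * expR (normc z * n0))) by ring.
rewrite ler_wpM2l//.
have e1 : expR (normc z * n0) <= expR n0 by rewrite ler_expR ler_piMl// ltW.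
apply: le_trans (_ : 1 * (n0 ^+ 2 * expR (normc z * n0)) <= _).
  by rewrite ler_wpM2r ?(ltW z1)// mulr_ge0 ?sqr_ge0 ?expR_ge0.
by rewrite mul1r ler_wpM2l ?sqr_ge0.
Qed.

(** * The generator *)

Lemma right0_cvg : h @[h --> (0 : R)^'+] --> (0 : R).
Proof. exact: cvg_within. Qed.

Lemma expR_quot0 (s : R) : `|h^-1 * (expR (s * h) - 1) - s| @[h --> (0 : R)^'+] --> (0 : R).
Proof.
have l1 : h * (s ^+ 2 * expR `|s|) @[h --> (0 : R)^'+] --> (0 : R).
  exact: cvgMr0 right0_cvg.
apply: squeeze0 l1; near=> h.
have h0 : 0 < h by near: h; exact: nbhs_right_gt.
have h1 : h < 1 by near: h; exact: nbhs_right_lt.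
rewrite normr_ge0/=.
have -> : h^-1 * (expR (s * h) - 1) - s = h^-1 * (expR (s * h) - 1 - s * h).
  by field; rewrite gt_eqF.
rewrite normrM gtr0_norm ?invr_gt0// ler_pdivrMl//.
apply: le_trans (expR_sub1D_le _) _.
have -> : h * (h * (s ^+ 2 * expR `|s|)) = (s * h) ^+ 2 * expR `|s| by ring.
rewrite ler_wpM2l ?sqr_ge0// ler_expR normrM (ger0_norm (ltW h0)).
by rewrite ler_piMr// ltW.
Unshelve. all: by end_near. Qed.

Lemma evol_generator v y : (h^-1)%:C *: (evol h%:C v - v) @[h --> (0 : R)^'+] --> y <->
  forall k, co y k = if - Lm < lam k then 0 else (lam k)%:C * co v k.
Proof.
have cE (h : R) k : 0 < h -> co ((h^-1)%:C *: (evol h%:C v - v)) k =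
    if - Lm < lam k then 0 else (h^-1 * (expR (lam k * h) - 1))%:C * co v k.
  move=> h0; rewrite (dotZl H) (dotBl H) evolE ?ReC ?(ltW h0)//.
  case: ifP => _; first by rewrite subrr mulr0.
  by rewrite -realcM cexp_real realcM rmorphB/= -mulrA mulrBl mul1r.
have pos : \forall h \near (0 : R)^'+, 0 < h by exact: nbhs_right_gt.
split=> [hy k|hy].
  have l1 : normc (co ((h^-1)%:C *: (evol h%:C v - v)) k - co y k) @[h --> (0 : R)^'+] --> (0 : R).
    exact: (dot_cvg0 H).
  set c := (X in _ = X).
  have l2 : normc (co ((h^-1)%:C *: (evol h%:C v - v)) k - c) @[h --> (0 : R)^'+] --> (0 : R).
    apply: (@squeeze0 _ _ _ _ _ (fun h => `|h^-1 * (expR (lam k * h) - 1) - lam k| * normc (co v k))).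
      apply: filterS pos => h h0; rewrite Defs.normc_ge0 cE//= /c; case: ifP => _.
        by rewrite subrr normc0 mulr_ge0 ?Defs.normc_ge0.
      by rewrite -mulrBl normcM -rmorphB normcR.
    exact: cvgMr0 (@expR_quot0 (lam k)).
  apply/eqP; rewrite -subr_eq0; apply/eqP/eq0_normc/eqP.
  rewrite eq_le Defs.normc_ge0 andbT.
  have l3 : normc (co ((h^-1)%:C *: (evol h%:C v - v)) k - co y k) +
      normc (co ((h^-1)%:C *: (evol h%:C v - v)) k - c) @[h --> (0 : R)^'+] --> (0 + 0 : R).
    exact: cvgD.
  rewrite addr0 in l3; apply: (cvgr_to_ge l3); apply: nearW => h /=.
  rewrite [normc (_ - co y k)]normcB; apply: le_trans (Defs.normcD _ _).
  by rewrite addrA subrK.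
(* Since [y] already carries the factor [lam k], the error of the difference quotient is a
   multiplier applied to [y] rather than to [v]. It equals [(exp s - 1) / s - 1] with
   [s = lam k h < 0], hence is bounded by 1 uniformly in [k]. *)
pose a (h : R) := cut Lm (fun=> 0) (fun k => (((lam k)^-1) * (h^-1 * (expR (lam k * h) - 1) - lam k))%:C).
have a1 (h : R) : 0 < h -> forall k, normc (a h k) <= 1.
  move=> h0 k; rewrite /a /cut; case: ifPn => [_|]; first by rewrite normc0.
  rewrite -leNgt => lk; have L1 := Lm_ge1; have l0 : lam k < 0 by lra.
  rewrite normcR; set E := expR _.
  have E1 : E <= 1 by rewrite -expR0 ler_expR; nra.
  have E2 : 1 + lam k * h <= E by exact: expR_ge1Dx.
  have p0 : 0 < - (lam k * h) by rewrite -mulNr mulr_gt0// oppr_gt0.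
  have -> : (lam k)^-1 * (h^-1 * (E - 1) - lam k) = (E - 1) / (lam k * h) - 1.
    by field; rewrite ?(ltr0_neq0 l0) ?gt_eqF.
  have q0 : 0 <= (E - 1) / (lam k * h).
    by rewrite -[_ / _]opprK -mulNr -mulrN -invrN divr_ge0//; lra.
  have q1 : (E - 1) / (lam k * h) <= 1.
    by rewrite -[_ / _]opprK -mulNr -mulrN -invrN ler_pdivrMr//; lra.
  by rewrite ler_norml; apply/andP; split; lra.
have aM : \forall h \near (0 : R)^'+, forall k, normc (a h k) <= 1.
  by apply: filterS pos => h; exact: a1.
have a0 k : normc (a h k) @[h --> (0 : R)^'+] --> (0 : R).
  rewrite /a /cut; case: (- Lm < lam k).
    by under eq_fun do rewrite normc0; exact: cvg_cst.
  under eq_fun do rewrite normcR normrM mulrC.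
  exact: cvgMr0 (@expR_quot0 (lam k)).
have lim : diag dot e (a h) y @[h --> (0 : R)^'+] --> (0 : X).
  exact: (diag_strong0 H He tot y aM a0).
apply/cvg_nrm0; have lim0 : nrm (diag dot e (a h) y) @[h --> (0 : R)^'+] --> nrm (0 : X).
  exact: nrm_cvg lim.
rewrite nrm0 in lim0.
apply: squeeze0 lim0; apply: filterS pos => h h0; rewrite nrm_ge0/=.
rewrite le_eqVlt; apply/orP; left; apply/eqP; congr nrm; apply: (coord_inj tot) => k.
rewrite (dotBl H) cE// hy (diagE H He); last by exists 1; exact: a1.
rewrite /a /cut hy; case: ifPn => [_|]; first by rewrite subrr mul0r.
rewrite -leNgt => lk; have L1 := Lm_ge1; have l0 : lam k < 0 by lra.
rewrite -mulrBl -rmorphB/= mulrA -rmorphM/=; congr (_%:C * _).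
by field; rewrite ?(ltr0_neq0 l0) ?gt_eqF.
Qed.

Lemma blocks_generator v y : (h^-1)%:C *: (blocks h%:C v - v) @[h --> (0 : R)^'+] --> y <->
  forall k, co y k = (if - Lm < lam k then 0 else (lam k)%:C * co v k) + co (N v) k.
Proof.
have diff : (h^-1)%:C *: (blocks h%:C v - evol h%:C v) @[h --> (0 : R)^'+] --> N v.
  have l1 : h * (n0 ^+ 2 * expR n0 * nrm v) @[h --> (0 : R)^'+] --> (0 : R).
    exact: cvgMr0 right0_cvg.
  apply: cvg_nrm_le l1; near=> h.
  have h0 : 0 < h by near: h; exact: nbhs_right_gt.
  have h1 : h < 1 by near: h; exact: nbhs_right_lt.
  have hC : (0 : R) <= Re h%:C by rewrite ReC ltW.
  have -> : (h^-1)%:C *: (blocks h%:C v - evol h%:C v) - N v =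
      (h^-1)%:C *: (cxp N h%:C (evol h%:C v) - evol h%:C v - h%:C *: N (evol h%:C v)).
    rewrite [RHS]scalerBr scalerA -rmorphM/= mulVf ?gt_eqF// scale1r.
    by rewrite Nevol.
  rewrite nrmZ normcR gtr0_norm ?invr_gt0// ler_pdivrMl//.
  apply: le_trans (cxp_sub1D cmp hN _ _) _.
  rewrite normcR gtr0_norm//.
  have -> : h * (h * (n0 ^+ 2 * expR n0 * nrm v)) = (h * n0) ^+ 2 * expR n0 * nrm v by ring.
  apply: ler_pM; rewrite ?nrm_ge0 ?(mulr_ge0 _ (expR_ge0 _)) ?sqr_ge0//.
    by rewrite ler_wpM2l ?sqr_ge0// ler_expR ler_piMl ?(bop_ge0 hN)// ltW.
  by have := bop_le (bop_evol hC) v; rewrite mul1r.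
have sp (h : R) : (h^-1)%:C *: (blocks h%:C v - v) =
    (h^-1)%:C *: (blocks h%:C v - evol h%:C v) + (h^-1)%:C *: (evol h%:C v - v).
  by rewrite -scalerDr addrA subrK.
have evl : (h^-1)%:C *: (blocks h%:C v - v) @[h --> (0 : R)^'+] --> y <->
    (h^-1)%:C *: (evol h%:C v - v) @[h --> (0 : R)^'+] --> y - N v.
  split=> [hy|hy].
    have E : (fun h : R => (h^-1)%:C *: (evol h%:C v - v)) = fun h =>
        (h^-1)%:C *: (blocks h%:C v - v) - (h^-1)%:C *: (blocks h%:C v - evol h%:C v).
      by apply/funext => h; rewrite sp [RHS]addrAC subrr add0r.
    by rewrite E; exact: cvgB.
  rewrite (funext sp) -[y](subrK (N v)) addrC; exact: cvgD.
rewrite evl evol_generator; split=> hk k.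
  by rewrite -hk (dotBl H) subrK.
by rewrite (dotBl H) hk addrK.
Unshelve. all: by end_near. Qed.

(** Conjugation reduces the limit at [x] to that of [blocks] at [x + sylv x]. There the Sylvester
    equation turns the image of [sylv x] into the missing high part of [G x] plus [sylv (M x)], and
    the latter matches [sylv y]. The existence of a [y] with these coordinates is the domain
    condition. *)
Lemma sgr_generator x y : (h^-1)%:C *: (sgr h%:C x - x) @[h --> (0 : R)^'+] --> y <->
  forall k, co y k = (lam k)%:C * co x k + co (G x) k.
Proof.
pose v := x + sylv x.
have E1 (h : R) : (h^-1)%:C *: (sgr h%:C x - x) =
    (h^-1)%:C *: (blocks h%:C v - v) - sylv ((h^-1)%:C *: (blocks h%:C v - v)).
  rewrite (bopZ bop_sylv) -scalerBr; congr (_ *: _).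
  rewrite -{2}(sylv_inv2 x) /sgr -/v (bopB bop_sylv) !opprB addrACA [RHS]addrACA.
  by rewrite [in RHS](addrC (- v)).
have E2 (h : R) : (h^-1)%:C *: (blocks h%:C v - v) =
    (h^-1)%:C *: (sgr h%:C x - x) + sylv ((h^-1)%:C *: (sgr h%:C x - x)).
  by rewrite E1 sylv_inv1.
have evl : (h^-1)%:C *: (sgr h%:C x - x) @[h --> (0 : R)^'+] --> y <->
    (h^-1)%:C *: (blocks h%:C v - v) @[h --> (0 : R)^'+] --> y + sylv y.
  split=> hy.
    by rewrite (funext E2); apply: cvgD => //; exact: (bop_cvg bop_sylv).
  by rewrite (funext E1) -[y]sylv_inv2; apply: cvgB => //; exact: (bop_cvg bop_sylv).
rewrite evl blocks_generator.
have Gv : G v = G x.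
  by rewrite -GP /v (bopD (bop_cutoff rho)) cutoff_sylv addr0 GP.
have Rk k : (if - Lm < lam k then 0 else (lam k)%:C * co v k) + co (N v) k =
    (lam k)%:C * co x k + co (G x) k + co (sylv (M x)) k.
  rewrite comprE Gv; have := sylv_coord x k; rewrite /v (dotDl H) mulrDr.
  case: ifPn => lk; first by move=> ->; rewrite sylv_low// !addr0 add0r.
  by move=> ->; rewrite addr0 addrA.
have cE k : co (y + sylv y) k = co y k + co (sylv y) k by rewrite (dotDl H).
split=> hk k; last first.
  rewrite Rk cE hk; congr (_ + _); rewrite -sylvP -[P y](_ : M x = _)//.
  by apply: (coord_inj tot) => j; rewrite comprE cutoffE hk.
(* On the modes above [- rho] every term in [sylv] vanishes, so the low part of [y] can be read off
   first; it identifies [sylv y] with [sylv (M x)], which then cancels on all modes. *)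
have PyM : P y = M x.
  apply: (coord_inj tot) => j; rewrite cutoffE comprE; case: ifPn => // jr.
  by have := hk j; rewrite Rk cE !sylv_low ?cutL// !addr0.
by have := hk k; rewrite Rk cE -[sylv y]sylvP PyM => /addIr.
Qed.

(** * Holomorphy in operator norm on the right half-plane *)

Lemma mul_expR_le (s a : R) : s < 0 -> 0 < a -> - s * expR (s * a) <= a^-1.
Proof.
move=> s0 a0; have e1 := expR_ge1Dx (- (s * a)); have e0 := expR_gt0 (s * a).
have E : expR (s * a) * expR (- (s * a)) = 1 by rewrite -expRD subrr expR0.
rewrite -[leRHS]mul1r ler_pdivlMr//; set u := expR (s * a) in E e0 *; nra.
Qed.

Lemma sqr_mul_expR_le (s a : R) : s < 0 -> 0 < a -> s ^+ 2 * expR (s * a) <= 4 / a ^+ 2.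
Proof.
move=> s0 a0; have a2 : 0 < a / 2 by rewrite divr_gt0.
have h := mul_expR_le s0 a2.
have -> : s ^+ 2 * expR (s * a) = (- s * expR (s * (a / 2))) ^+ 2.
  rewrite exprMn sqrrN; congr (_ * _); rewrite expr2 -expRD; congr expR; lra.
have -> : 4 / a ^+ 2 = ((a / 2)^-1) ^+ 2 by field; rewrite gt_eqF.
by rewrite ler_sqr ?nnegrE ?invr_ge0 ?(ltW a2)// mulr_ge0 ?expR_ge0// oppr_ge0 ltW.
Qed.

Definition devol z :=
  diag dot e (cut Lm (fun=> 0) (fun k => (lam k)%:C * cexp ((lam k)%:C * z))).

Lemma devol_le z k : 0 < Re z ->
  normc (cut Lm (fun=> 0) (fun k => (lam k)%:C * cexp ((lam k)%:C * z)) k) <= (Re z)^-1.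
Proof.
move=> z0; rewrite /cut; case: ifPn => [_|]; first by rewrite normc0 invr_ge0 ltW.
rewrite -leNgt => lk; have L1 := Lm_ge1; have l0 : lam k < 0 by lra.
by rewrite normcM normcR ltr0_norm// normc_cexp ReCM; exact: mul_expR_le.
Qed.

Lemma bop_devol z : 0 < Re z -> bop (devol z) (Re z)^-1.
Proof. by move=> z0; apply: bop_diag => k; exact: devol_le. Qed.

(** Taylor remainder of order two, uniform over the unbounded set of eigenvalues: as
    [|w| <= Re z / 2], a factor [exp (lam k Re z / 2)] remains to absorb [lam k ^+ 2]. The constant
    is 4 from [cexp_sub1D_le] times [4 / (Re z / 2)^2]. *)
Lemma evol_diff z w x : 0 < Re z -> normc w <= Re z / 2 ->
  nrm (evol (z + w) x - evol z x - w *: devol z x) <=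
  64 / Re z ^+ 2 * normc w ^+ 2 * nrm x.
Proof.
move=> z0 wz; have wR := normc_Re w; have w0 := Defs.normc_ge0 w.
have zw0 : 0 <= Re (z + w) by rewrite ReD; move: wR; rewrite ler_norml => /andP[? _]; lra.
apply: (coord_nrm_le H He tot).
  by rewrite mulr_ge0 ?sqr_ge0// divr_ge0 ?sqr_ge0.
move=> k; rewrite !(dotBl H) (dotZl H) !evolE// ?(ltW z0)//.
rewrite (diagE H He)//; last by exists (Re z)^-1 => j; exact: devol_le.
rewrite /cut; case: ifPn => [_|].
  rewrite mul0r mulr0 subr0 subrr normc0 mulr_ge0 ?Defs.normc_ge0//.
  by rewrite mulr_ge0 ?sqr_ge0// divr_ge0 ?sqr_ge0.
rewrite -leNgt => lk; have L1 := Lm_ge1; have l0 : lam k < 0 by lra.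
set c := co x k; set l := (lam k)%:C.
have -> : cexp (l * (z + w)) * c - cexp (l * z) * c - w * (l * cexp (l * z) * c) =
    cexp (l * z) * (cexp (l * w) - 1 - l * w) * c.
  by rewrite mulrDr cexpD; ring.
rewrite normcM ler_wpM2r ?Defs.normc_ge0// normcM.
apply: le_trans (ler_wpM2l (Defs.normc_ge0 _) (cexp_sub1D_le _)) _.
rewrite /l normc_cexp ReCM !normcM !normcR ltr0_norm//.
set u := normc w in wz w0 wR *; set a := Re z in z0 wz *.
have a2 : 0 < a / 2 by rewrite divr_gt0.
have h := sqr_mul_expR_le l0 a2.
have e1 : expR (lam k * a) * expR (- lam k * u) <= expR (lam k * (a / 2)).
  by rewrite -expRD ler_expR; nra.
have -> : 64 / a ^+ 2 * u ^+ 2 = 4 * u ^+ 2 * (4 / (a / 2) ^+ 2) by field; rewrite gt_eqF.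
have -> : expR (lam k * a) * (4 * (- lam k * u) ^+ 2 * expR (- lam k * u)) =
  4 * u ^+ 2 * (lam k ^+ 2 * (expR (lam k * a) * expR (- lam k * u))) by ring.
rewrite ler_wpM2l ?mulr_ge0 ?sqr_ge0//; apply: le_trans h.
by rewrite ler_wpM2l ?sqr_ge0.
Qed.

Definition dblocks z x := cxp N z (N x + devol z x).

Lemma blocks_diff z : 0 < Re z -> exists2 C : R, 0 <= C & forall w x,
  normc w <= 1 -> normc w <= Re z / 2 ->
  nrm (blocks (z + w) x - blocks z x - w *: dblocks z x) <= C * normc w ^+ 2 * nrm x.
Proof.
move=> z0; have n00 := bop_ge0 hN.
exists (expR (normc z * n0) * (n0 ^+ 2 * expR n0 + 64 / Re z ^+ 2)).
  by rewrite mulr_ge0 ?expR_ge0// addr_ge0 ?mulr_ge0 ?expR_ge0 ?sqr_ge0 ?invr_ge0 ?sqr_ge0.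
move=> w x w1 wz; have w0 := Defs.normc_ge0 w; have wR := normc_Re w.
have zw0 : 0 <= Re (z + w) by rewrite ReD; move: wR; rewrite ler_norml => /andP[? _]; lra.
pose v := evol (z + w) x; have hC := bop_cxp cmp hN z.
have Nv : N v = N x by rewrite /v Nevol.
have -> : blocks (z + w) x - blocks z x - w *: dblocks z x =
    cxp N z ((cxp N w v - v - w *: N v) + (v - evol z x - w *: devol z x)).
  rewrite /blocks /dblocks (cxpD cmp _ _ _ hN) -/v Nv.
  move: (cxp N z) hC (cxp N w v) (N x) (evol z x) (devol z x) => F hF a b p q.
  rewrite -(bopZ hF) -!(bopB hF); congr (F _).
  by rewrite [RHS]addrACA [X in _ = X + _]addrA subrK -opprD -scalerDr.
apply: le_trans (bop_le hC _) _.
rewrite -[leRHS]mulrA -[leRHS]mulrA ler_wpM2l ?expR_ge0//.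
apply: le_trans (nrmD _ _) _; rewrite mulrDl; apply: lerD; last first.
  by apply: le_trans (evol_diff _ z0 wz) _; rewrite mulrA.
apply: le_trans (cxp_sub1D cmp hN _ _) _.
have nv : nrm v <= nrm x by have := bop_le (bop_evol zw0) x; rewrite mul1r.
have -> : n0 ^+ 2 * expR n0 * (normc w ^+ 2 * nrm x) =
   ((normc w * n0) ^+ 2 * expR n0) * nrm x by ring.
apply: ler_pM => //; rewrite ?nrm_ge0 ?(mulr_ge0 _ (expR_ge0 _)) ?sqr_ge0//.
by rewrite ler_wpM2l ?sqr_ge0// ler_expR ler_piMl.
Qed.

Definition dsgr z x := dblocks z (x + sylv x) - sylv (dblocks z (x + sylv x)).

Lemma bop_dsgr z : 0 < Re z -> exists c, bop (dsgr z) c.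
Proof.
move=> z0; have hD : bop (dblocks z) (expR (normc z * n0) * (n0 + (Re z)^-1)).
  by apply: (bop_comp (bop_cxp cmp hN z)); exact: (bop_add hN (bop_devol z0)).
have hDY := bop_comp hD (bop_add (bop_id X) bop_sylv).
exists (expR (normc z * n0) * (n0 + (Re z)^-1) * (1 + g) +
  g * (expR (normc z * n0) * (n0 + (Re z)^-1) * (1 + g))).
exact: (bop_add hDY (bop_opp (bop_comp bop_sylv hDY))).
Qed.

Lemma sgr_diff z : 0 < Re z -> exists2 C : R, 0 <= C & forall w x,
  normc w <= 1 -> normc w <= Re z / 2 ->
  nrm (sgr (z + w) x - sgr z x - w *: dsgr z x) <= C * normc w ^+ 2 * nrm x.
Proof.
move=> z0; have [C C0 hC] := blocks_diff z0; have g0 := bop_ge0 hG.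
exists ((1 + g) * C * (1 + g)); first by rewrite !mulr_ge0 ?addr_ge0.
move=> w x w1 wz; pose v := x + sylv x.
have nv : nrm v <= (1 + g) * nrm x by exact: bop_le (bop_add (bop_id X) bop_sylv) x.
pose D := blocks (z + w) v - blocks z v - w *: dblocks z v.
have -> : sgr (z + w) x - sgr z x - w *: dsgr z x = D - sylv D.
  have subBB (a a' b b' : X) : (a - a') - (b - b') = (a - b) - (a' - b').
    by rewrite !opprB addrACA [RHS]addrACA [in RHS](addrC (- b)).
  rewrite /D /sgr /dsgr -/v !(bopB bop_sylv) (bopZ bop_sylv) scalerBr.
  by rewrite [X in X - _ = _]subBB [LHS]subBB.
apply: le_trans (nrmD _ _) _; rewrite nrmN.
apply: le_trans (lerD (lexx _) (bop_le bop_sylv _)) _.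
rewrite -[X in X + _]mul1r -mulrDl.
have -> : (1 + g) * C * (1 + g) * normc w ^+ 2 * nrm x =
    (1 + g) * (C * normc w ^+ 2 * ((1 + g) * nrm x)) by ring.
rewrite ler_wpM2l ?addr_ge0//; apply: le_trans (hC w v w1 wz) _.
by rewrite ler_wpM2l// mulr_ge0 ?sqr_ge0.
Qed.

(** On the kernel of [P] both [G] and [sylv] vanish along the whole orbit, so the evolution is
    diagonal with factors [exp (lam k t)] and [lam k <= - rho]. *)
Lemma sgr_high t x : 0 <= t -> P x = 0 -> nrm (sgr t%:C x) <= expR (- rho * t) * nrm x.
Proof.
move=> t0 Px; have tC : (0 : R) <= Re t%:C by [].
have Y0 y : P y = 0 -> sylv y = 0 by move=> Py; rewrite -sylvP Py (bop0 bop_sylv).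
have x0 j : - rho < lam j -> co x j = 0.
  by move=> hj; have := cutoffE rho x j; rewrite Px (dot0l H) hj.
have hC := bop_cxp cmp hM t%:C.
have -> : sgr t%:C x = blocks t%:C x.
  rewrite /sgr (Y0 x)// addr0 (Y0 (blocks _ _)) ?subr0//.
  by rewrite cutoff_blocks// Px (bop0 hC).
pose u := evol t%:C x.
have u0 j : - rho < lam j -> co u j = 0.
  by move=> hj; rewrite /u evolE// cutL// x0.
have Gu y : (forall j, - rho < lam j -> co y j = 0) -> G y = 0.
  move=> hy; rewrite -GP (_ : P y = 0) ?(bop0 hG)//.
  by apply: (coord_inj tot) => j; rewrite cutoffE (dot0l H); case: ifP => // /hy.
apply: (coord_nrm_le H He tot) => [|k]; first exact: expR_ge0.
(* The eigenvalue seen by [N] in the mode [k]: modes between the thresholds evolve through [cxp N],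
   those below [- Lm] through [evol]. *)
pose a := if - Lm < lam k then lam k else 0.
have it j : co (iter j N u) k = (a ^+ j)%:C * co u k /\
    forall i, - rho < lam i -> co (iter j N u) i = 0.
  elim: j => [|j [IH1 IH2]]; first by rewrite expr0 mul1r.
  rewrite iterS; split=> [|i hi]; rewrite comprE (Gu _ IH2) (dot0l H) addr0; last first.
    by rewrite IH2// mulr0; case: ifP.
  have -> c : (if - Lm < lam k then (lam k)%:C * c else 0) = a%:C * c.
    by rewrite /a; case: ifP => _; rewrite ?mul0r.
  by rewrite IH1 exprS realcM mulrA.
rewrite /blocks -/u (cxp_coord (m := a) cmp _ H hN) => [|j]; last by have [] := it j.
case: (boolP (- rho < lam k)) => [hk|]; first by rewrite u0// x0// mulr0 normc0 mulr0.
rewrite -leNgt => hk.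
rewrite normcM normcR ger0_norm ?expR_ge0// /u evolE// /a.
have le1 : expR (t * lam k) <= expR (- rho * t) by rewrite ler_expR; nra.
case: ifP => _; first by rewrite ler_wpM2r ?Defs.normc_ge0.
rewrite mulr0 expR0 mul1r -realcM cexp_real normcM normcR ger0_norm ?expR_ge0//.
by rewrite ler_wpM2r ?Defs.normc_ge0// [lam k * t]mulrC.
Qed.

(** * Exponential decay *)

Section decay.
Variables (Mc w0 : R).
Hypotheses (Mc1 : 1 <= Mc) (w00 : 0 < w0) (w0rho : w0 <= rho).
Hypothesis lowdecay : forall t x, 0 <= t -> P x = x ->
  nrm (cxp M t%:C x) <= Mc * expR (- w0 * t) * nrm x.

Local Notation T t := (sgr t%:C).

Lemma cutoffK x : P (P x) = P x.
Proof. by apply/cutoff_id => k; rewrite cutoffE; case: ifP; [left|right]. Qed.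

Lemma nrm_cutoff x : nrm (P x) <= nrm x.
Proof. by have := bop_le (bop_cutoff rho) x; rewrite mul1r. Qed.

Lemma nrm_cutoffC x : nrm (x - P x) <= nrm x.
Proof.
rewrite -[leRHS]mul1r; apply: (coord_nrm_le H He tot) => // k; rewrite mul1r (dotBl H) cutoffE.
by case: ifP => _; rewrite ?subrr ?subr0// normc0 Defs.normc_ge0.
Qed.

Lemma nrm_cutoff_sgr t x : 0 <= t -> nrm (P (T t x)) <= Mc * expR (- w0 * t) * nrm x.
Proof.
move=> t0; rewrite cutoff_sgr//; apply: le_trans (lowdecay t0 (cutoffK x)) _.
by rewrite ler_wpM2l ?nrm_cutoff// mulr_ge0 ?expR_ge0// (le_trans _ Mc1).
Qed.

(** [T (t + 1) x] is [T 1] applied to the low and high parts of [T t x]: the low part has already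
    decayed by hypothesis, and the high part contracts by [exp (- rho)], at most [exp (- w0)]. The
    recursion over unit times replaces the variation of constants formula. *)
Lemma nrm_cutoffC_sgr_step c t x : 1 <= c -> (forall s, 0 <= s <= 1 -> bop (T s) c) ->
  0 <= t ->
  nrm (T (t + 1) x - P (T (t + 1) x)) <=
  c * (Mc * expR (- w0 * t) * nrm x) + expR (- w0) * nrm (T t x - P (T t x)).
Proof.
move=> c1 hT t0; have h1 : bop (T 1) c by apply: hT; rewrite ler01 lexx.
have E : T (t + 1) x = T 1 (T t x).
  by rewrite addrC realcD sgrD ?ReC ?ler01.
rewrite E; move: (T t x) (nrm_cutoff_sgr x t0) => y hy.
have := bopD h1 (P y) (y - P y); rewrite addrC subrK => ->.
have PQ : P (y - P y) = 0 by rewrite (bopB (bop_cutoff rho)) cutoffK subrr.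
rewrite [P (_ + _)](bopD (bop_cutoff rho)) opprD addrACA; apply: le_trans (nrmD _ _) _; apply: lerD.
  apply: le_trans (nrm_cutoffC _) _; apply: le_trans (bop_le h1 _) _.
  by rewrite ler_wpM2l ?(le_trans ler01 c1).
apply: le_trans (nrm_cutoffC _) _.
have := sgr_high ler01 PQ; rewrite [- rho * 1]mulr1 => h; apply: le_trans h _.
apply: ler_wpM2r; first exact: nrm_ge0.
by rewrite ler_expR lerN2.
Qed.

(** Each unit of time adds one more term [C exp (- w0 t)] to the high part. The factor linear in [t]
    reflects that the two blocks may have the same rate [w0]. *)
Lemma sgr_decay_linear : exists2 C : R, 1 <= C & forall t x, 0 <= t ->
  nrm (T t x) <= (t + 2) * C * expR (- w0 * t) * nrm x.
Proof.
have [c c1 hc] := bop_sgr 1.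
have hT s : 0 <= s <= 1 -> bop (T s) c.
  by move=> /andP[s0 s1]; apply: hc; rewrite ?ReC// normcR ger0_norm.
(* [expR w0] pays for one unit of time: the coupling term of a step becomes exactly
   [C expR (- w0 * (s + 1))], and the bound also covers [0 <= t <= 1]. *)
pose C := c * Mc * expR w0.
have Mc0 : 0 < Mc := lt_le_trans ltr01 Mc1.
have c0 : 0 < c := lt_le_trans ltr01 c1.
have E1 : 1 <= expR w0 by rewrite -expR0 ler_expR ltW.
have cMc : c <= c * Mc by rewrite ler_peMr// ltW.
have McC : Mc <= C.
  rewrite /C mulrAC; apply: ler_peMl; first exact: ltW.
  by apply: le_trans c1 _; rewrite ler_peMr// ltW.
have claim n t x : 0 <= t <= n.+1%:R ->
    nrm (T t x - P (T t x)) <= n.+1%:R * C * expR (- w0 * t) * nrm x.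
  elim: n t => [|n IH] t /andP[t0 tn].
    apply: le_trans (nrm_cutoffC _) _; apply: le_trans (bop_le (hT t _) x) _.
      by rewrite t0.
    rewrite ler_wpM2r ?nrm_ge0// mul1r /C -mulrA -expRD.
    apply: le_trans cMc _; rewrite ler_peMr ?mulr_ge0 ?(ltW c0) ?(ltW Mc0)//.
    by rewrite -expR0 ler_expR mulNr subr_ge0 ler_piMr// ltW.
  have n1 : 1 <= n.+1%:R :> R by rewrite ler1n.
  have C0 : 0 <= C := le_trans (ltW Mc0) McC.
  have [tn'|tn'] := leP t n.+1%:R.
    apply: le_trans (IH t _) _; first by rewrite t0 tn'.
    rewrite ler_wpM2r ?nrm_ge0// ler_wpM2r ?expR_ge0// ler_wpM2r//.
    by rewrite ler_nat.
  have s0 : 0 <= t - 1 by lra.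
  have -> : t = (t - 1) + 1 by rewrite subrK.
  set s := t - 1; apply: le_trans (nrm_cutoffC_sgr_step x c1 hT s0) _.
  have hs : 0 <= s <= n.+1%:R by rewrite s0 /s lerBlDr natr1.
  apply: le_trans (lerD (lexx _) (ler_wpM2l (expR_ge0 _) (IH s hs))) _.
  have -> : expR (- w0 * (s + 1)) = expR (- w0) * expR (- w0 * s).
    by rewrite mulrDr mulr1 expRD mulrC.
  have -> : c * (Mc * expR (- w0 * s) * nrm x) =
      C * (expR (- w0) * expR (- w0 * s)) * nrm x.
    rewrite /C; have E : expR w0 * expR (- w0) = 1 by rewrite -expRD subrr expR0.
    rewrite -[c * Mc * _ * (_ * _)]mulrA [expR w0 * _]mulrA E; ring.
  rewrite -[n.+2%:R]natr1; move: (n.+1%:R : R) => a.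
  by rewrite le_eqVlt; apply/orP; left; apply/eqP; ring.
have C1 : 1 <= C := le_trans Mc1 McC.
clearbody C; exists C => // t x t0.
have [n tn] : exists n, t <= n.+1%:R /\ n%:R <= t.
  exists (Num.truncn t); have := truncn_itv t0.
  by move=> /andP[-> /ltW].
have C0 : 0 <= C := le_trans ler01 C1.
have h1 := claim n t x; rewrite t0 tn.1 in h1; have {}h1 := h1 isT.
have h2 := nrm_cutoff_sgr x t0.
rewrite -(subrK (P (T t x)) (T t x)); apply: le_trans (nrmD _ _) _.
have -> : (t + 2) * C * expR (- w0 * t) * nrm x =
  (t + 1) * (C * expR (- w0 * t) * nrm x) + C * expR (- w0 * t) * nrm x by ring.
apply: lerD; last first.
  apply: le_trans h2 _; rewrite ler_wpM2r ?nrm_ge0// ler_wpM2r ?expR_ge0//.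
apply: le_trans h1 _; rewrite -!mulrA ler_wpM2r//; first by rewrite !mulr_ge0 ?expR_ge0 ?nrm_ge0.
by rewrite -natr1 lerD2r tn.2.
Qed.

Lemma sgr_decay om : om < w0 -> exists2 C : R, 1 <= C & forall t x, 0 <= t ->
  nrm (T t x) <= C * expR (- om * t) * nrm x.
Proof.
move=> omw; have [C C1 hC] := sgr_decay_linear.
pose d := w0 - om; have d0 : 0 < d by rewrite subr_gt0.
exists ((2 + d^-1) * C).
  have : 0 < d^-1 by rewrite invr_gt0.
  move: (d^-1) => q q0; nra.
move=> t x t0; apply: le_trans (hC t x t0) _; rewrite ler_wpM2r ?nrm_ge0//.
have -> : - om * t = d * t + - w0 * t by rewrite /d; ring.
rewrite expRD -mulrA -[leRHS]mulrA [leRHS]mulrA [leRHS]mulrAC -!mulrA.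
have h := expR_ge1Dx (d * t).
have key : t + 2 <= (2 + d^-1) * expR (d * t).
  apply: le_trans (_ : (2 + d^-1) * (1 + d * t) <= _); last first.
    by rewrite ler_wpM2l// addr_ge0// invr_ge0 ltW.
  have -> : (2 + d^-1) * (1 + d * t) = t + 2 + (d^-1 + 2 * d * t).
    by field; rewrite gt_eqF.
  by rewrite lerDl addr_ge0 ?invr_ge0 ?(ltW d0)// !mulr_ge0// ltW.
rewrite mulrA [leRHS](_ : _ = (2 + d^-1) * expR (d * t) * (C * expR (- w0 * t))); last by ring.
rewrite -mulrA ler_wpM2r// mulr_ge0 ?expR_ge0//; exact: le_trans C1.
Qed.

End decay.

(** * Assembling the semigroup properties *)

Lemma sgr0 x : sgr 0 x = x.
Proof. by rewrite /sgr /blocks (cxp0 cmp hN) evol0 sylv_inv2. Qed.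

Lemma sgr_C0 : C0_semigroup (fun t : R => sgr t%:C).
Proof.
split=> [t t0|x|s t x s0 t0|x]; first 1 last.
- exact: sgr0.
- by rewrite realcD sgrD ?ReC.
- apply/cvg_nrmP => d d0; have [r r0 hr] := sgr_strong x d0; near=> t.
  have t0 : 0 < t by near: t; exact: nbhs_right_gt.
  have tr : t < r by near: t; exact: nbhs_right_lt.
  by apply: hr; rewrite ?ReC ?(ltW t0)// normcR gtr0_norm.
- have [c _ hc] := bop_sgr t; apply: (bop_bounded (c := c)); apply: hc; rewrite ?ReC//.
  by rewrite normcR ger0_norm.
Unshelve. all: by end_near. Qed.

Lemma sgr_generates (A : unbounded_op X) :
  (forall u y, (dom A u /\ A u = y) <-> forall k, co y k = (lam k)%:C * co u k) ->
  generates (UnboundedOp (dom A) (fun x => A x + G x)) (fun t : R => sgr t%:C).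
Proof.
move=> hA; split=> [|x y]; first exact: sgr_C0.
rewrite sgr_generator; split=> [hy|[/= dx ->] k]; last first.
  by rewrite (dotDl H) ((hA x (A x)).1 (conj dx erefl)).
have [|dx Ax] := (hA x (y - G x)).2.
  by move=> k; rewrite (dotBl H) hy addrK.
by split=> //=; rewrite Ax subrK.
Qed.

Lemma sector_half_plane z : sector (pi / 2) z -> 0 < Re z.
Proof.
move=> [r [theta [r0]]]; rewrite ltr_norml => th -> /=.
by rewrite mulr_gt0// cos_gt0_pihalf.
Qed.

Lemma normc_lt z (r : R) : `|z| < r%:C -> normc z < r.
Proof. by rewrite -[`|z|]/((normc z)%:C) ltcR. Qed.

(** The sector is the whole open right half-plane, of half-angle [pi / 2]: the diagonal part has
    real eigenvalues and everything else in [sgr] is bounded. *)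
Lemma sgr_analytic : analytic_semigroup (fun t : R => sgr t%:C).
Proof.
split; first exact: sgr_C0.
exists (pi / 2), sgr; split.
- by rewrite divr_gt0 ?pi_gt0//= lexx.
- by move=> t x _.
- split=> [z /sector_half_plane z0|z w x /sector_half_plane z0 /sector_half_plane w0].
    by have [c _ hc] := bop_sgr (normc z); apply: (bop_bounded (hc z (ltW z0) (lexx _))).
  by rewrite sgrD ?ltW.
- move=> z /sector_half_plane z0; exists (dsgr z).
    by have [c hc] := bop_dsgr z0; exact: bop_bounded hc.
  move=> d d0; have [C C0 hC] := sgr_diff z0.
  exists (Num.min 1 (Num.min (Re z / 2) (d / (C + 1)))).
    by rewrite !lt_min ltr01 !divr_gt0// ltr_wpDl.
  move=> w /andP[w0 /normc_lt]; rewrite !lt_min => /and3P[w1 wz wd].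
  have wn0 : w != 0 by rewrite -normr_gt0.
  have nw0 := normc_gt0 wn0.
  apply/opnormP => x.
  have -> : w^-1 *: (sgr (z + w) x - sgr z x) - dsgr z x =
      w^-1 *: (sgr (z + w) x - sgr z x - w *: dsgr z x).
    by rewrite [RHS]scalerBr scalerA mulVf// scale1r.
  rewrite nrmZ normcV; apply: le_trans (ler_wpM2l _ (hC w x (ltW w1) (ltW wz))) _.
    by rewrite invr_ge0 ltW.
  have -> : (normc w)^-1 * (C * normc w ^+ 2 * nrm x) = normc w * C * nrm x.
    by field; rewrite gt_eqF.
  rewrite ler_wpM2r ?nrm_ge0//; apply: le_trans (_ : normc w * (C + 1) <= _).
    by rewrite ler_wpM2l ?(ltW nw0)// lerDl.
  by rewrite -ler_pdivlMr ?ltW// ltr_wpDl.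
- move=> delta x /andP[_ dpi] d d0; have [r r0 hr] := sgr_strong x d0.
  exists r => // z zs /normc_lt zr; rewrite nrmE ltcR; apply: hr => //.
  apply/ltW/sector_half_plane; case: zs => s [theta [s0 th zE]].
  by exists s, theta; split=> //; exact: lt_trans th dpi.
Qed.

End perturbation.

Theorem perturbed_semigroup (R : realType) (X : normedModType R[i]) (dot : X -> X -> R[i])
    (e : nat -> X) (lam : nat -> R) (A : unbounded_op X) (G : X -> X) (g rho Mc w : R) :
  hilbert dot -> orthosys dot e -> (forall x, fsum dot e n x @[n --> \oo] --> x) ->
  (forall L, exists N, forall n, (N <= n)%N -> lam n <= L) ->
  (forall u y, (dom A u /\ A u = y) <-> forall k, dot y (e k) = (lam k)%:C * dot u (e k)) ->
  bop G g -> (forall x, G (cutoff dot e lam rho x) = G x) ->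
  0 < rho -> 1 <= Mc -> 0 < w ->
  (forall (t : R) x, 0 <= t -> cutoff dot e lam rho x = x ->
    nrm (cxp (compr dot e lam G rho) t%:C x) <= Mc * expR (- w * t) * nrm x) ->
  exists T : R -> X -> X,
    [/\ generates (UnboundedOp (dom A) (fun x => A x + G x)) T, analytic_semigroup T,
        exponentially_stable T & forall omega, 0 < omega < Num.min rho w ->
          exists2 MF : R, 1 <= MF & exp_bounded T MF omega].
Proof.
move=> H He tot lamN hA hG GP rho0 Mc1 w0 low.
have [m hM] := bop_compr H He tot lamN hG rho.
(* The second threshold can be fixed only after a bound [m] of the low block is known. *)
pose Lm := Num.max rho (m + 1); have [n0 hN] := bop_compr H He tot lamN hG Lm.
have rhoL : rho <= Lm by rewrite le_max lexx.
have mL : m + 1 <= Lm by rewrite le_max lexx orbT.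
pose w' := Num.min rho w.
have w'0 : 0 < w' by rewrite lt_min rho0.
have w'rho : w' <= rho by rewrite ge_min lexx.
have low' (t : R) x : 0 <= t -> cutoff dot e lam rho x = x ->
    nrm (cxp (compr dot e lam G rho) t%:C x) <= Mc * expR (- w' * t) * nrm x.
  move=> t0 Px; apply: le_trans (low t x t0 Px) _.
  rewrite ler_wpM2r ?nrm_ge0// ler_wpM2l ?(le_trans ler01)// ler_expR.
  by rewrite ler_wpM2r// lerN2 ge_min lexx orbT.
have dec omega : omega < w' -> exists2 MF : R, 1 <= MF &
    exp_bounded (fun t : R => sgr dot e lam rho G Lm t%:C) MF omega.
  move=> ow; have [C C1 hC] :=
    sgr_decay H He tot lamN hG GP rhoL mL hM hN Mc1 w'0 w'rho low' ow.
  by exists C => // t t0; apply/opnormP => x; exact: hC.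
exists (fun t : R => sgr dot e lam rho G Lm t%:C); split.
- exact: (sgr_generates H He tot lamN hG GP rhoL mL hM hN).
- exact: (sgr_analytic H He tot lamN hG GP rhoL mL hM hN).
- have [|MF MF1 hF] := dec (w' / 2); first by rewrite ltr_pdivrMr// ltr_pMr// ltr1n.
  by exists MF, (w' / 2); split=> //; rewrite divr_gt0.
- by move=> omega /andP[_]; exact: dec.
Qed.

(** * The spectral projection in coordinates *)

Lemma lin_spanDZ (R : realType) (X : normedModType R[i]) (E : set X) (a : R[i]) v x :
  E v -> lin_span E x -> lin_span E (x + a *: v).
Proof.
move=> Ev [n [c [u [Eu ->]]]].
exists n.+1, (fun i => if unlift ord_max i is Some j then c j else a),
  (fun i => if unlift ord_max i is Some j then u j else v); split.
  by move=> i; case: unliftP.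
rewrite big_ord_recr/= unlift_none; congr (_ + _); apply: eq_bigr => i _.
have -> : widen_ord (leqnSn n) i = lift ord_max i by apply: ord_inj; rewrite lift_max.
by rewrite liftK.
Qed.

Section spectral_projection.
Context (R : realType) (l rho : R) (A : unbounded_op (L2I l)).
Context (e : nat -> L2I l) (lam : nat -> R).
Local Notation dot := (@L2dot _ _ R (muI l)).
Local Notation HL := (L2dot_hilbert (muI l)).
Local Notation co x k := (dot x (e k)).
Hypothesis He : orthosys dot e.
Hypothesis tot : forall x : L2I l, fsum dot e n x @[n --> \oo] --> x.
Hypothesis lamN : forall L : R, exists N, forall n, (N <= n)%N -> lam n <= L.
Hypothesis hA : forall u y, (dom A u /\ A u = y) <->
  forall k, co y k = (lam k)%:C * co u k.

Local Notation S := (lin_span (eigenvectors A [set k | - rho < k])).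

Lemma cut_fsum : exists N, forall x : L2I l,
  (forall k, - rho < lam k \/ co x k = 0) -> x = fsum dot e N x.
Proof.
have [N hN] := lamN (- rho); exists N => x hx; apply: (coord_inj tot) => k.
rewrite (dot_fsum HL He); case: ltnP => // Nk.
by case: (hx k) => //; rewrite ltNge hN.
Qed.

Lemma eigenvectors_basis k : - rho < lam k -> e k != 0 -> eigenvectors A [set k | - rho < k] (e k).
Proof.
move=> hk ek; have [|dk Ak] := (hA (e k) ((lam k)%:C *: e k)).2.
  move=> j; rewrite (dotZl HL); have [->//|kj] := eqVneq k j.
  by rewrite (ortho_neq He kj) !mulr0.
by split=> //; split=> //; exists (lam k).
Qed.

(** An eigenvector with eigenvalue [mu] satisfies [(mu - lam k) co = 0] in every mode, so it has no
    component with [lam k <= - rho]. Conversely such an [x] is a finite Fourier sum, since only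
    finitely many modes lie above [- rho]. *)
Lemma spanP (x : L2I l) : S x <-> forall k, - rho < lam k \/ co x k = 0.
Proof.
split=> [[n [c [v [hv ->]]]] k|hx].
  have [hk|hk] := ltP (- rho) (lam k); [by left|right].
  rewrite (dot_suml HL) big1// => i _; rewrite (dotZl HL).
  have [_ [dv [mu hmu Av]]] := hv i; have /(_ k) := (hA (v i) _).1 (conj dv Av).
  rewrite (dotZl HL) => /eqP; rewrite -subr_eq0 -mulrBl mulf_eq0 => /orP[|/eqP ->].
    rewrite subr_eq0 => /eqP/complexI mul.
    by move: hmu hk; rewrite /= mul ltNge => /negP.
  by rewrite mulr0.
have [N hN] := cut_fsum; rewrite (hN x hx).
have S0 : S 0 by exists 0%N, (fun=> 0), (fun=> 0); split; [case|rewrite big_ord0].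
rewrite /fsum /csum; elim: N {hN} => [|N IH]; first by rewrite big_ord0.
rewrite big_ord_recr/=; case: (hx N) => [lN|->]; last by rewrite scale0r addr0.
have [->|eN] := eqVneq (e N) 0; first by rewrite scaler0 addr0.
by apply: lin_spanDZ => //; exact: eigenvectors_basis.
Qed.

(** The cut-off is a best approximation in the span, so [orth_proj] does not return its junk value,
    and orthogonality to the retained [e k] forces the coordinates. *)
Lemma spectral_proj_cutoff (x : L2I l) :
  spectral_proj A [set k | - rho < k] x = cutoff dot e lam rho x.
Proof.
have cE := cutoffE lam HL He rho x.
rewrite /spectral_proj /orth_proj; case: xgetP => [y _ [/spanP Sy hy]|/(_ (cutoff dot e lam rho x)) none].
  apply: (coord_inj tot) => k; rewrite cE; case: ifPn => hk.
    have [->|ek] := eqVneq (e k) 0; first by rewrite !(dot0r HL).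
    have Sk : S (e k).
      apply/spanP => j; have [<-|kj] := eqVneq k j; first by left.
      by right; exact: (ortho_neq He).
    by have /eqP := hy _ Sk; rewrite (dotBl HL) subr_eq0 => /eqP.
  by case: (Sy k) => // hk'; rewrite hk' in hk.
exfalso; apply: none; split=> [|z /spanP Sz].
  by apply/spanP => k; rewrite cE; case: ifP; [left|right].
have [N zN] := cut_fsum; rewrite (zN z Sz) (dot_sumr HL) big1// => k _.
rewrite (dotZr HL) (dotBl HL) cE; case: (Sz k) => [->|->]; first by rewrite subrr mulr0.
by rewrite [X in X * _](_ : _ = 0) ?mul0r//; exact: conjc0.
Qed.

End spectral_projection.

Theorem theorem4 (R : realType) (l eps1 rho : R)
    (alpha1 : R -> R) (g : R -> R[i])
    (l_gt0 : 0 < l) (eps1_gt0 : 0 < eps1) (rho_gt0 : 0 < rho)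
    (alpha1_Linfty : alpha1 \in Lfun (muI l) +oo%E)
    (g_Linfty : g \in cLinfty (muI l))
    (g_neq0 : (0 < muI l [set x | (g x != 0)%R])%E)
    (A := An l eps1 alpha1)
    (B := L2mul (muI l) g : L2I l -> L2I l)
    (P := spectral_proj A [set k | - rho < k])
    (Xcr := range P)
    (K : L2I l -> L2I l) (K_bounded : bounded_linear_on Xcr K)
    (Mcr omega_cr : R) (Mcr_ge1 : 1 <= Mcr) (omega_cr_gt0 : 0 < omega_cr)
    (exp_cr : forall t, 0 <= t ->
       opnorm_le Xcr (expop (fun x => A x + P (B (K x))) t)
         (Mcr * expR (- omega_cr * t)))
    (AF := UnboundedOp (dom A) (fun x => A x + B (K (P x)))) :
  exists T : R -> L2I l -> L2I l,
    [/\ generates AF T, analytic_semigroup T, exponentially_stable T &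
        forall omega, 0 < omega < Num.min rho omega_cr ->
          exists2 MF : R, 1 <= MF & exp_bounded T MF omega].
Proof.
have [e [lam [He tot lamN hA]]] := An_spectral l_gt0 eps1_gt0 alpha1_Linfty.
pose HL := L2dot_hilbert (muI l).
have PE x : P x = cutoff (@L2dot _ _ R (muI l)) e lam rho x.
  exact: (spectral_proj_cutoff rho He tot lamN hA).
pose Q := cutoff (@L2dot _ _ R (muI l)) e lam rho.
have hQ : bop Q 1 by exact: (bop_cutoff lam HL He tot).
have QK x : Q (Q x) = Q x by exact: (cutoffK lam HL He tot).
have [Klin [cK /= Kle]] := K_bounded.
have XQ x : Xcr (Q x) by exists x => //; rewrite PE.
have XcrP x : Xcr x <-> Q x = x.
  split=> [[y _ <-]|<-//]; by rewrite PE QK.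
have [cB cB0 Ble] := L2mul_le g_Linfty.
have hB : bop B cB := Bop cB0 (L2mul_lin g_Linfty) Ble.
(* The constant provided by boundedness on [Xcr] carries no sign, whereas [bop] requires a
   nonnegative one. *)
have hKQ : bop (fun x => K (Q x)) `|cK|.
  split=> // [a x y|x]; first by rewrite (bop_lin hQ) Klin.
  have := Kle _ (XQ x); rewrite !nrmE -realcM lecR => h; apply: le_trans h _.
  apply: le_trans (_ : `|cK| * nrm (Q x) <= _); first by rewrite ler_wpM2r ?nrm_ge0 ?ler_norm.
  by rewrite ler_wpM2l//; have := bop_le hQ x; rewrite mul1r.
pose G x := B (K (Q x)).
have hG : bop G (cB * `|cK|) := bop_comp hB hKQ.
have GQ x : G (Q x) = G x by rewrite /G QK.
have low (t : R) x : 0 <= t -> Q x = x ->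
    nrm (cxp (compr (@L2dot _ _ R (muI l)) e lam G rho) t%:C x) <=
    Mcr * expR (- omega_cr * t) * nrm x.
  move=> t0 Qx; set M := compr _ _ _ _ _.
  (* On [Xcr] the operator [A] is defined everywhere, its values having the coordinates of [cutlam],
     so the closed-loop matrix of the hypothesis is the compression [M]. *)
  have step y : Q y = y -> A y + P (B (K y)) = M y.
    move=> Qy; have [|_ Ay] := (hA y (cutlam (@L2dot _ _ R (muI l)) e lam rho y)).2.
      move=> k; rewrite (cutlamE HL He lamN); case: ifPn => // hk.
      by rewrite -Qy /Q (cutoffE lam HL He) (negPf hk) mulr0.
    by rewrite PE [A y]Ay /M /compr /G Qy.
  have QM y : Q (M y) = M y by exact: (cutoffM HL He tot lamN).
  (* The two operators agree only on [Xcr]; since the iterates of [M] stay there, the two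
     exponential series coincide term by term. *)
  have it k : iter k (fun x => A x + P (B (K x))) x = iter k M x /\ Q (iter k M x) = iter k M x.
    elim: k => [//|k [IH1 IH2]]; rewrite !iterS IH1 step//.
  have := exp_cr t t0 x ((XcrP x).2 Qx).
  have -> : expop (fun x => A x + P (B (K x))) t x = expop M t x.
    rewrite /expop; congr (limn _); apply/funext => n; apply: eq_bigr => k _.
    by rewrite (it k).1.
  by rewrite expop_cxp !nrmE -realcM lecR.
have [T hT] := perturbed_semigroup HL He tot lamN hA hG GQ rho_gt0 Mcr_ge1 omega_cr_gt0 low.
exists T; rewrite /AF (_ : (fun x => A x + B (K (P x))) = fun x => A x + G x)//.
by apply/funext => x; rewrite PE.
Qed.
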